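(* Let $-\infty\leqslant a<b\leqslant\infty$ and let $f$ be an $\mathbb{R}$-valued measurable function on $(a,b)$. The following statements are equivalent. (a) $ID_{\mathrm{AB}}(\mathbb{R}^d)\subset\mathfrak D^0(\Phi_f)$. (b) $\int_a^b1_{\{f(s)\neq0\}}ds<\infty$ and $\int_a^b|f(s)|ds<\infty$.
   Context: $ID(\mathbb{R}^d)$ ($d$ fixed) is the class of infinitely divisible distributions on $\mathbb{R}^d$. For $\mu\in ID(\mathbb{R}^d)$, $C_\mu$ is the unique complex-valued continuous function on $\mathbb{R}^d$ with $C_\mu(0)=0$ and $\widehat\mu(z)=e^{C_\mu(z)}$; $\mu$ has Lévy–Khintchine triplet $(A,\nu,\gamma)$ if $$C_\mu(z)=-\tfrac12\langle z,Az\rangle+\int_{\mathbb{R}^d}\Big(e^{i\langle z,x\rangle}-1-\frac{i\langle z,x\rangle}{1+|x|^2}\Big)\nu(dx)+i\langle\gamma,z\rangle,$$ with $A$ symmetric nonnegative-definite, $\nu(\{0\})=0$, $\int(|x|^2\wedge1)\nu(dx)<\infty$, $\gamma\in\mathbb{R}^d$. $ID_{\mathrm{AB}}(\mathbb{R}^d)$ is the class of $\mu\in ID(\mathbb{R}^d)$ of type A or B, i.e. with $A=0$ and $\int_{|x|\leqslant1}|x|\nu(dx)<\infty$. Random measure. $X^{(\mu)}=\{X^{(\mu)}(B)\colon B\text{ bounded Borel in }\mathbb{R}\}$ is the (unique in law) $\mathbb{R}^d$-valued homogeneous independently scattered random measure on $\mathbb{R}$ such that $X^{(\mu)}((t,t+1])$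 has distribution $\mu$ for all $t$: (1) for disjoint bounded Borel sets $B_1,B_2,\dots$ with bounded union, $\sum_n X^{(\mu)}(B_n)$ converges a.s. and equals $X^{(\mu)}(\bigcup_n B_n)$ a.s.; (2) values on finitely many disjoint sets are independent; (3) $X^{(\mu)}(\{t\})=0$ a.s.; and the law of $X^{(\mu)}(B+t)$ equals that of $X^{(\mu)}(B)$. Integrals. Let $\mathcal B^0_{(a,b)}$ be the class of Borel sets $B\subset(a,b)$ with $\inf B>a$, $\sup B<b$. For a simple function $f=\sum_{j=1}^n r_j1_{B_j}$ ($B_j$ disjoint Borel in $(a,b)$, $r_j\in\mathbb{R}$), $\int_B f\,dX^{(\mu)}=\sum_j r_jX^{(\mu)}(B\cap B_j)$ for $B\in\mathcal B^0_{(a,b)}$. A measurable $f\colon(a,b)\to\mathbb{R}$ belongs to $\mathbf L_{(a,b)}(X^{(\mu)})$ (locally $X^{(\mu)}$-integrable) if there are simple $f_n\to f$ Lebesgue-a.e. such that $\int_B f_n\,dX^{(\mu)}$ converges in probability for every $B\in\mathcal B^0_{(a,b)}$. Domain. $\mathfrak D^0(\Phi_f)$ is the class of $\mu\in ID(\mathbb{R}^d)$ such that $f\in\mathbf L_{(a,b)}(X^{(\mu)})$ and $\int_a^b|C_\mu(f(s)z)|ds<\infty$ for all $z\in\mathbb{R}^d$. *)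

(* Defs.v *)
From HB Require Import structures.
From mathcomp Require Import all_boot all_order all_algebra.
From mathcomp Require Import complex.
From mathcomp Require Import all_classical all_reals all_analysis.

Set Implicit Arguments.
Unset Strict Implicit.
Unset Printing Implicit Defensive.

Import Order.TTheory GRing.Theory Num.Theory.
Import numFieldNormedType.Exports.

Local Open Scope classical_set_scope.
Local Open Scope ring_scope.

(* Row vectors carry their Borel sigma-algebra. *)
HB.instance Definition _ (R : realType) (d : nat) :=
  @isMeasurable.Build (sigma_display (@open 'rV[R]_d)) 'rV[R]_d
    <<s @open 'rV[R]_d >> (@sigma_algebra0 _ setT _)
    (@sigma_algebraC _ _) (@sigma_algebra_bigcup _ setT _).

Definition dotp {R : realType} {d : nat} (x y : 'rV[R]_d) : R :=
  \sum_(i < d) x 0 i * y 0 i.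

(* The library norm `|x| on 'rV[R]_d is the sup norm. *)
Definition enorm {R : realType} {d : nat} (x : 'rV[R]_d) : R :=
  Num.sqrt (dotp x x).

Definition cexp {R : realType} (w : R[i]) : R[i] :=
  Complex (expR (complex.Re w) * cos (complex.Im w)) (expR (complex.Re w) * sin (complex.Im w)).

Definition cintegral {R : realType} {disp} {T : measurableType disp}
    (m : {measure set T -> \bar R}) (g : T -> R[i]) : R[i] :=
  Complex (\int[m]_x complex.Re (g x)) (\int[m]_x complex.Im (g x)).

Definition char_fun {R : realType} {d : nat} (mu : probability 'rV[R]_d R)
    (z : 'rV[R]_d) : R[i] :=
  cintegral mu (fun x => cexp (Complex 0 (dotp z x))).

(* [conv m1 m2 A] is the integral of m1 (A - y) with respect to m2 (dy). *)
Definition conv {R : realType} {d : nat} (m1 m2 : set 'rV[R]_d -> \bar R)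
    (A : set 'rV[R]_d) : \bar R :=
  (\int[m2]_y m1 [set x | A (x + y)%R])%E.

Fixpoint conv_pow {R : realType} {d : nat} (m : set 'rV[R]_d -> \bar R)
    (n : nat) : set 'rV[R]_d -> \bar R :=
  if n is n'.+1 then conv (conv_pow m n') m else \d_(0 : 'rV[R]_d).

Definition ID (R : realType) (d : nat) : set (probability 'rV[R]_d R) :=
  [set mu | forall n, (0 < n)%N -> exists mun : probability 'rV[R]_d R,
     forall A, measurable A -> mu A = conv_pow mun n A].

(* C is the function C_mu; the regular-module alias R[i]^o carries the norm
   topology of the complex numbers. *)
Definition is_cumulant {R : realType} {d : nat} (mu : probability 'rV[R]_d R)
    (C : 'rV[R]_d -> R[i]) : Prop :=
  [/\ continuous (C : 'rV[R]_d -> R[i]^o), C 0 = 0 &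
      forall z, char_fun mu z = cexp (C z)].

Definition LK_exponent {R : realType} {d : nat} (A : 'M[R]_d)
    (nu : {measure set 'rV[R]_d -> \bar R}) (gamma z : 'rV[R]_d) : R[i] :=
  Complex (- (2^-1 * dotp z (z *m A^T))) 0
  + cintegral nu (fun x => cexp (Complex 0 (dotp z x)) - 1
                           - Complex 0 (dotp z x / (1 + enorm x ^+ 2)))
  + Complex 0 (dotp gamma z).

Definition levy_measure {R : realType} {d : nat}
    (nu : {measure set 'rV[R]_d -> \bar R}) : Prop :=
  nu [set 0] = 0%E /\
  (\int[nu]_x (Num.min (enorm x ^+ 2) 1)%:E < +oo)%E.

Definition has_triplet {R : realType} {d : nat} (mu : probability 'rV[R]_d R)
    (A : 'M[R]_d) (nu : {measure set 'rV[R]_d -> \bar R}) (gamma : 'rV[R]_d)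
    : Prop :=
  [/\ A^T = A, (forall z : 'rV[R]_d, 0 <= dotp z (z *m A^T)), levy_measure nu &
      is_cumulant mu (LK_exponent A nu gamma)].

Definition ID_AB (R : realType) (d : nat) : set (probability 'rV[R]_d R) :=
  [set mu | ID mu /\
     exists A (nu : {measure set 'rV[R]_d -> \bar R}) gamma,
       [/\ has_triplet mu A nu gamma, A = 0 &
           (\int[nu]_(x in [set x | (enorm x <= 1)%R]) (enorm x)%:E < +oo)%E]].

Definition bounded_borel {R : realType} (B : set R) : Prop :=
  measurable B /\ bounded_set B.

(* X is a version of X^(mu) on the probability space (T, P); its values at sets
   which are not bounded Borel sets are irrelevant. *)
Record is_random_measure {R : realType} {d : nat}
    (mu : probability 'rV[R]_d R) {disp} {T : measurableType disp}
    (P : probability T R) (X : set R -> T -> 'rV[R]_d) : Prop := {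
  rm_measurable : forall B, bounded_borel B -> measurable_fun setT (X B) ;
  rm_additive : forall B : nat -> set R,
    (forall n, bounded_borel (B n)) -> trivIset setT B ->
    bounded_borel (\bigcup_n B n) ->
    {ae P, forall w, \sum_(i < n) X (B i) w @[n --> \oo]
                       --> X (\bigcup_n B n) w} ;
  rm_independent : forall (n : nat) (B : 'I_n -> set R)
      (A : 'I_n -> set 'rV[R]_d),
    (forall i, bounded_borel (B i)) -> trivIset setT B ->
    (forall i, measurable (A i)) ->
    P [set w | forall i, A i (X (B i) w)]
      = (\prod_(i < n) P (X (B i) @^-1` A i))%E ;
  rm_atomless : forall t : R, {ae P, forall w, X [set t] w = 0} ;
  rm_homogeneous : forall (B : set R) (t : R) (A : set 'rV[R]_d),
    bounded_borel B -> measurable A ->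
    P (X [set s + t | s in B] @^-1` A) = P (X B @^-1` A) ;
  rm_law : forall (t : R) (A : set 'rV[R]_d), measurable A ->
    P (X `]t, t + 1]%classic @^-1` A) = mu A
}.

Definition ointerval {R : realType} (a b : \bar R) : set R :=
  [set s : R | (a < s%:E < b)%E].

(* The class B^0_(a,b). *)
Definition inner_borel {R : realType} (a b : \bar R) (B : set R) : Prop :=
  [/\ measurable B, B `<=` ointerval a b,
      (a < ereal_inf (EFin @` B))%E & (ereal_sup (EFin @` B) < b)%E].

(* A simple function, given as a sum of r_j * 1_(B_j) over j < n. *)
Record simple_on {R : realType} (a b : \bar R) := SimpleOn {
  simple_card : nat ;
  simple_coef : 'I_simple_card -> R ;
  simple_set : 'I_simple_card -> set R ;
  simple_measurable : forall j, measurable (simple_set j) ;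
  simple_sub : forall j, simple_set j `<=` ointerval a b ;
  simple_disjoint : trivIset setT simple_set
}.

Arguments simple_coef {R a b} s j.
Arguments simple_set {R a b} s j _.

Definition simple_val {R : realType} {a b : \bar R} (phi : simple_on a b)
    (s : R) : R :=
  \sum_j simple_coef phi j * \1_(simple_set phi j) s.

Definition simple_integral {R : realType} {d : nat} {T : Type} {a b : \bar R}
    (X : set R -> T -> 'rV[R]_d) (phi : simple_on a b) (B : set R) (w : T)
    : 'rV[R]_d :=
  \sum_j simple_coef phi j *: X (B `&` simple_set phi j) w.

Definition cvg_in_probability {R : realType} {d : nat} {disp}
    {T : measurableType disp} (P : probability T R)
    (Y : nat -> T -> 'rV[R]_d) : Prop :=
  exists2 Z : T -> 'rV[R]_d, measurable_fun setT Z &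
    forall e : R, 0 < e ->
      P [set w | e < enorm (Y n w - Z w)] @[n --> \oo] --> 0%E.

Definition locally_integrable_wrt {R : realType} {d : nat} {disp}
    {T : measurableType disp} (P : probability T R)
    (X : set R -> T -> 'rV[R]_d) (a b : \bar R) (f : R -> R) : Prop :=
  measurable_fun (ointerval a b) f /\
  exists phi : nat -> simple_on a b,
    {ae (@lebesgue_measure R), forall s, ointerval a b s ->
       simple_val (phi n) s @[n --> \oo] --> f s} /\
    (forall B, inner_borel a b B ->
       cvg_in_probability P (fun n => simple_integral X (phi n) B)).

(* X^(mu) is determined only in law, so the condition is imposed on all of its
   versions, on any probability space. *)
Definition locally_X_integrable {R : realType} {d : nat}
    (mu : probability 'rV[R]_d R) (a b : \bar R) (f : R -> R) : Prop :=
  forall disp (T : measurableType disp) (P : probability T R)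
    (X : set R -> T -> 'rV[R]_d),
    is_random_measure mu P X -> locally_integrable_wrt P X a b f.

Definition D0 {R : realType} {d : nat} (a b : \bar R) (f : R -> R)
    : set (probability 'rV[R]_d R) :=
  [set mu | [/\ ID mu, locally_X_integrable mu a b f &
     exists2 C : 'rV[R]_d -> R[i], is_cumulant mu C &
       forall z, (\int[@lebesgue_measure R]_(s in ointerval a b)
                    (Normc.normc (C (f s *: z)))%:E < +oo)%E]].

(* Main.v *)
From HB Require Import structures.
Require Import Defs.
From mathcomp Require Import all_boot all_order all_algebra.
From mathcomp Require Import complex ring lra.
From mathcomp Require Import all_classical all_reals all_analysis.
From mathcomp Require Import measurable_realfun.
Import Order.TTheory GRing.Theory Num.Theory.
Import numFieldNormedType.Exports.
Local Open Scope classical_set_scope.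
Local Open Scope ring_scope.
Set Implicit Arguments.
Unset Strict Implicit.
Unset Printing Implicit Defensive.

(** Write [F] for [f] extended by [0] outside [(a, b)], and [C] for the exponent
    of [mu].

    The conditions are sufficient. If [mu] has type A or B, then [min (|x|, 1)]
    is [nu]-integrable, and as [|e^(iu) - 1| <= min (|u|, 2)] the exponent has
    linear growth along each line ([LK_exponent_growth]). It is continuous and
    vanishes at [0], so for every [e > 0] there is a [K] with
    [|C (v z)| <= e 1_(v <> 0) + K |v|] for all real [v] ([exponent_bound]).
    With [v = F s] and an integration over [s], this is the integrability of
    [C (f s z)]. For local integrability, [X B] has the characteristic function
    [exp (|B| C)] ([rm_cfE]): this is first obtained for dyadic intervals, where
    the continuity of both sides in [z] selects the right square root, then for
    intervals by countable additivity, then for bounded Borel sets by a monotone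
    class argument. Hence for simple [g] and [h] and [Y] the
    difference of their integrals over [B], in the direction [z],
    [|1 - E e^(itY)| <= \int_B |C (t (g - h) z)| <= e |{g <> h}| + K t |g - h|_1].
    Averaging over [t] in [[0, S]] ([large_values_mass_le]) turns this into a
    bound on [P (|Y| >= 2 / S)] ([prob_simple_diff]). Simple functions which
    converge to [F] fast enough in [L^1], and vanish where [F] does, thus have
    integrals that form a fast Cauchy sequence in probability.

    The conditions are necessary. The Dirac law at [gamma] is of type A with
    exponent [i <gamma, z>], which gives the integrability of [|f|]. Suppose that
    [{F <> 0}] has infinite measure. Then [g x = \int (1 - cos (x F s)) ds] is
    unbounded: by the same averaging inequality, now for Lebesgue measure,
    [g <= M] would give [|{F <> 0}| <= 2 M] ([support_measure_le]). Take [x_n]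
    with [g x_n > 4^n], and a compound Poisson law whose jumps are [x_n e] and
    [- x_n e], each at rate [2^-(n+2)], for a unit vector [e]
    ([ID_AB_with_jumps]). It is of type A, and
    [- Re (C (v e)) = \sum_n 2^-(n+1) (1 - cos (v x_n))], so that
    [\int |C (F s e)| ds >= 2^-(n+1) 4^n] for every [n], which is impossible for
    a law in the domain. That a compound Poisson law is infinitely divisible is
    the semigroup property of its mixture of convolution powers
    ([conv_cpoisson]). *)

(** * Trigonometric and complex inequalities *)

Section trig.
Context {R : realType}.
Implicit Types x y : R.

Lemma norm_sin_le x : `|sin x| <= `|x|.
Proof.
wlog x0 : x / 0 <= x.
  move=> h; case: (leP 0 x) => [/h //|/ltW x0].
  by rewrite -normrN -sinN -(normrN x); apply: h; rewrite oppr_ge0.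
have [c _] := @MVT_segment R sin cos 0 x x0 (fun y _ => is_derive_sin y)
  (continuous_subspaceT (@continuous_sin R)).
rewrite sin0 !subr0 => ->; rewrite normrM -[leRHS]mul1r.
by rewrite ler_wpM2r// cos_max.
Qed.

Lemma one_sub_cosE x : 1 - cos x = 2 * sin (x / 2) ^+ 2.
Proof.
have -> : cos x = cos ((x / 2) *+ 2) by congr cos; rewrite mulr2n; field.
by rewrite cos_mulr2n sin2cos2 !mulr2n; ring.
Qed.

Lemma one_sub_cos_sqr x : 1 - cos x <= x ^+ 2 / 2.
Proof.
rewrite one_sub_cosE.
have : sin (x / 2) ^+ 2 <= (x / 2) ^+ 2.
  by rewrite -[leLHS]real_normK ?num_real// -[leRHS]real_normK ?num_real//
    lerXn2r ?nnegrE// norm_sin_le.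
lra.
Qed.

Lemma one_sub_cos_ge0 x : 0 <= 1 - cos x.
Proof. by rewrite subr_ge0 cos_le1. Qed.

Lemma one_sub_cos_le2 x : 1 - cos x <= 2.
Proof. by have := cos_geN1 x; lra. Qed.

Lemma one_sub_cos_norm x : 1 - cos x <= `|x|.
Proof.
have h := norm_sin_le (x / 2); have s1 := sin_max (x / 2).
rewrite one_sub_cosE -real_normK ?num_real//.
have i2 : `|2^-1 : R| = 2^-1 by rewrite ger0_norm// invr_ge0.
rewrite normrM i2 in h.
have := normr_ge0 (sin (x / 2)); nra.
Qed.

End trig.

Section complex_tools.
Context {R : realType}.
Implicit Types (w u : R[i]) (x y : R).
Local Notation normc := Normc.normc.

Lemma complex_eqP w u :
  complex.Re w = complex.Re u -> complex.Im w = complex.Im u -> w = u.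
Proof. by case: w u => [a b] [c e] /= -> ->. Qed.

Lemma cexpD w u : cexp (w + u) = cexp w * cexp u.
Proof.
case: w u => [a b] [c e]; apply: complex_eqP => /=;
  by rewrite expRD ?cosD ?sinD; ring.
Qed.

Lemma cexp0 : cexp (0 : R[i]) = 1.
Proof. by rewrite /cexp/= expR0 cos0 sin0 mulr1 mulr0. Qed.

Lemma normc_cexp w : normc (cexp w) = expR (complex.Re w).
Proof.
case: w => a b /=; rewrite !exprMn -mulrDr cos2Dsin2 mulr1.
by rewrite sqrtr_sqr ger0_norm// expR_ge0.
Qed.

Lemma cexp_neq0 w : cexp w != 0.
Proof.
apply/eqP => w0; have := normc_cexp w; rewrite w0 Normc.normc0.
by move/eqP; rewrite eq_sym expR_eq0.
Qed.

Lemma cexpMn w n : cexp (w *+ n) = cexp w ^+ n.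
Proof.
by elim: n => [|n ih]; rewrite ?mulr0n ?cexp0 ?expr0// mulrS cexpD ih exprS.
Qed.

Lemma cexp_sum (I : Type) (s : seq I) (F : I -> R[i]) :
  cexp (\sum_(i <- s) F i) = \prod_(i <- s) cexp (F i).
Proof. by elim/big_ind2 : _ => [|? ? ? ? <- <-|]; rewrite ?cexp0 ?cexpD. Qed.

Lemma normc_ge0 w : 0 <= normc w.
Proof. by case: w => a b; exact: sqrtr_ge0. Qed.

Lemma normcE w : normc w = Num.sqrt (complex.Re w ^+ 2 + complex.Im w ^+ 2).
Proof. by case: w. Qed.

Lemma sqr_normc w : normc w ^+ 2 = complex.Re w ^+ 2 + complex.Im w ^+ 2.
Proof. by rewrite normcE sqr_sqrtr// addr_ge0 ?sqr_ge0. Qed.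

Lemma Re_le_normc w : `|complex.Re w| <= normc w.
Proof.
by rewrite normcE -sqrtr_sqr ler_wsqrtr// lerDl sqr_ge0.
Qed.

Lemma Im_le_normc w : `|complex.Im w| <= normc w.
Proof.
by rewrite normcE -sqrtr_sqr ler_wsqrtr// lerDr sqr_ge0.
Qed.

Lemma normc_le_sum w : normc w <= `|complex.Re w| + `|complex.Im w|.
Proof.
rewrite -(@ler_pXn2r _ 2)// ?nnegrE ?normc_ge0 ?addr_ge0//.
rewrite sqr_normc sqrrD !real_normK ?num_real// mulr2n.
have : 0 <= `|complex.Re w| * `|complex.Im w| by rewrite mulr_ge0.
lra.
Qed.

Lemma normcD w u : normc (w + u) <= normc w + normc u.
Proof. exact: le_normcD. Qed.

Lemma normc_sum (I : Type) (s : seq I) (F : I -> R[i]) :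
  normc (\sum_(i <- s) F i) <= \sum_(i <- s) normc (F i).
Proof.
elim/big_ind2 : _ => //; first by rewrite Normc.normc0.
by move=> w a u b wa ub; rewrite (le_trans (normcD _ _))// lerD.
Qed.

Lemma ReZ x w : complex.Re (Complex x 0 * w) = x * complex.Re w.
Proof. by case: w => a b /=; rewrite mul0r subr0. Qed.

Lemma ImZ x w : complex.Im (Complex x 0 * w) = x * complex.Im w.
Proof. by case: w => a b /=; rewrite mul0r addr0. Qed.

Lemma normcZ x w : 0 <= x -> normc (Complex x 0 * w) = x * normc w.
Proof.
by move=> x0; rewrite Normc.normcM /= expr0n addr0 sqrtr_sqr ger0_norm.
Qed.

(** With [w = a + i b] and [a <= 0],
    [|1 - e^w|^2 = (1 - e^a)^2 + 2 e^a (1 - cos b) <= a^2 + b^2]. *)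
Lemma normc_one_sub_cexp w : complex.Re w <= 0 -> normc (1 - cexp w) <= normc w.
Proof.
move=> w0; rewrite -(@ler_pXn2r _ 2)// ?nnegrE ?normc_ge0// !sqr_normc.
case: w w0 => a b /= a0.
have e0 := expR_ge0 a; have e1 : expR a <= 1 by rewrite expR_le1.
have ea := expR_ge1Dx a; have cb := one_sub_cos_sqr b.
have sb := cos2Dsin2 b; have cb0 := one_sub_cos_ge0 b.
have h1 : (1 - expR a) ^+ 2 <= a ^+ 2 by nra.
have h2 : expR a * (1 - cos b) <= b ^+ 2 / 2 by nra.
have -> : (1 - expR a * cos b) ^+ 2 + (0 - expR a * sin b) ^+ 2 =
  (1 - expR a) ^+ 2 + 2 * (expR a * (1 - cos b))
   + expR a ^+ 2 * (cos b ^+ 2 + sin b ^+ 2 - 1) by ring.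
by rewrite sb; lra.
Qed.

Lemma cexp_inj_Re w u : cexp w = cexp u -> complex.Re w = complex.Re u.
Proof. by move=> /(congr1 (@Normc.normc R)); rewrite !normc_cexp => /expR_inj. Qed.

End complex_tools.

(** * Continuous logarithms, Borel functions of row vectors *)

Section complex_topology.
Context {R : realType}.
Local Notation normc := Normc.normc.

(** The norm of [R[i]^o] takes its values in [R[i]] itself; continuity of the two
    parts brings the problem back to real functions. *)
Lemma continuous_complexP {T : topologicalType} (C : T -> R[i]) :
  continuous (C : T -> R[i]^o) <->
  continuous (fun t => complex.Re (C t)) /\
  continuous (fun t => complex.Im (C t)).
Proof.
split=> [cC|[cRe cIm]].
  have h (t : T) (e : R) : 0 < e ->
      \forall s \near t, normc (C t - C s) < e.
    move=> e0; have := cC t => /cvgrPdist_lt/(_ e%:C%C).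
    rewrite ltcR => /(_ e0); apply: filterS => s.
    by rewrite -ltcR; case: (C t - C s).
  split=> t; apply/cvgrPdist_lt => e e0; near=> s.
  - rewrite (_ : _ - _ = complex.Re (C t - C s)); last by case: (C t) (C s) => ? ? [].
    rewrite (le_lt_trans (Re_le_normc _))//; near: s; exact: h.
  - rewrite (_ : _ - _ = complex.Im (C t - C s)); last by case: (C t) (C s) => ? ? [].
    rewrite (le_lt_trans (Im_le_normc _))//; near: s; exact: h.
move=> t; apply/cvgrPdist_lt => -[e e'].
rewrite ltcE /= => /andP[/eqP -> e0].
have e20 : 0 < e / 2 by rewrite divr_gt0.
move/cvgrPdist_lt : (cRe t) => /(_ _ e20) h1.
move/cvgrPdist_lt : (cIm t) => /(_ _ e20) h2.
near=> s.
rewrite (_ : `|_| = (normc (C t - C s))%:C%C); last by case: (C t - C s).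
rewrite ltcR (le_lt_trans (normc_le_sum _))// [ltRHS]splitr ltrD//.
- rewrite (_ : complex.Re _ = complex.Re (C t) - complex.Re (C s)).
    by near: s.
  by case: (C t) (C s) => ? ? [].
- rewrite (_ : complex.Im _ = complex.Im (C t) - complex.Im (C s)).
    by near: s.
  by case: (C t) (C s) => ? ? [].
Unshelve. all: by end_near. Qed.

(** By the intermediate value theorem, a continuous function cannot cross a gap
    [(0, c)] in its range. *)
Lemma continuous_gap (h : R -> R) (c : R) : 0 < c -> continuous h -> h 0 = 0 ->
  (forall t, 0 < h t < c -> False) -> h 1 < c.
Proof.
move=> c0 ch h0 gap; rewrite ltNge; apply/negP => h1.
have [t _ ht] : exists2 t, t \in `[0, 1]%R & h t = c / 2.
  apply: IVT => //; first exact: continuous_subspaceT.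
  rewrite h0 ge_min le_max.
  apply/andP; split; apply/orP; [left|right].
    by rewrite divr_ge0// ltW.
  by rewrite (le_trans _ h1)// ler_pdivrMr// mulr_natr mulr2n lerDl ltW.
by apply: (gap t); rewrite ht divr_gt0//= ltr_pdivrMr// mulr_natr mulr2n ltrDl.
Qed.

(** The difference [D] of two continuous logarithms of the same function takes
    values in a discrete set: [cos D = 1] excludes [0 < |D| < pi]. *)
Lemma continuous_cos1_eq0 (D : R -> R) : continuous D -> D 0 = 0 ->
  (forall t, cos (D t) = 1) -> D 1 = 0.
Proof.
move=> cD D0 cosD.
have pi0 := pi_gt0 R.
have gap (t : R) : 0 < `|D t| < pi -> False.
  move=> /andP[h1 h2]; have : cos `|D t| = cos 0 by rewrite cos_norm cosD cos0.
  move=> /cos_inj.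
  rewrite !in_itv/= normr_ge0 lexx (ltW h2) (ltW pi0) => /(_ isT isT) h.
  by rewrite h ltxx in h1.
have cn : continuous (fun t => `|D t|).
  by move=> t; apply: cvg_norm; exact: cD.
have := @continuous_gap (fun t => `|D t|) pi pi0 cn; rewrite D0 normr0.
move=> /(_ erefl gap) => h.
apply/eqP; rewrite -normr_eq0 -[_ == _]negbK; apply/negP => h'.
by apply: (gap 1); rewrite h normr_gt0 -normr_eq0 h'.
Qed.

(** The values are [1] and [-1], so [1 - u] cannot cross the gap [(0, 2)]. *)
Lemma continuous_sqr1_eq1 (u : R -> R) : continuous u -> u 0 = 1 ->
  (forall t, u t ^+ 2 = 1) -> u 1 = 1.
Proof.
move=> cu u0 u2.
have uE t : u t = 1 \/ u t = -1.
  have /eqP := u2 t; rewrite sqrf_eq1 => /orP[]/eqP; by [left|right].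
have cn : continuous (fun t => 1 - u t).
  by move=> t; apply: cvgB; [exact: cvg_cst|exact: cu].
have := @continuous_gap (fun t => 1 - u t) 2 ltac:(by []) cn; rewrite u0 subrr.
move=> /(_ erefl); case: (uE 1) => [->//|->].
have -> : (1 - -1 : R) = 2 by ring.
rewrite ltxx => h; exfalso; suff : false by [].
apply: h => t; case: (uE t) => ->; first by rewrite subrr ltxx.
have -> : (1 - -1 : R) = 2 by ring.
by rewrite ltxx andbF.
Qed.

End complex_topology.

Lemma continuous_sumr {R : realType} {T : topologicalType} (I : Type) (s : seq I)
  (F : I -> T -> R) : (forall i, continuous (F i)) ->
  continuous (fun x => \sum_(i <- s) F i x).
Proof.
move=> cF; elim: s => [|i s ih].
  by under eq_fun do rewrite big_nil; move=> x; exact: cvg_cst.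
by under eq_fun do rewrite big_cons; move=> x; apply: cvgD; [exact: cF|exact: ih].
Qed.

Section vectors.
Context {R : realType} {d : nat}.
Implicit Types x y z : 'rV[R]_d.

Lemma dotpDr z x y : dotp z (x + y) = dotp z x + dotp z y.
Proof. by rewrite /dotp -big_split/=; apply: eq_bigr => i _; rewrite mxE mulrDr. Qed.

Lemma dotpZr (c : R) z x : dotp z (c *: x) = c * dotp z x.
Proof. by rewrite /dotp big_distrr/=; apply: eq_bigr => i _; rewrite mxE; ring. Qed.

Lemma dotpC z x : dotp z x = dotp x z.
Proof. by apply: eq_bigr => i _; rewrite mulrC. Qed.

Lemma dotpZl (c : R) z x : dotp (c *: z) x = c * dotp z x.
Proof. by rewrite dotpC dotpZr dotpC. Qed.

Lemma dotp0r z : dotp z 0 = 0.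
Proof. by rewrite /dotp big1// => i _; rewrite mxE mulr0. Qed.

Lemma dotpNr z x : dotp z (- x) = - dotp z x.
Proof. by rewrite -scaleN1r dotpZr mulN1r. Qed.

Lemma dotp_sumr (I : Type) (s : seq I) (F : I -> 'rV[R]_d) z :
  dotp z (\sum_(i <- s) F i) = \sum_(i <- s) dotp z (F i).
Proof.
by elim/big_ind2 : _ => [|? ? ? ? <- <-|//]; rewrite ?dotp0r ?dotpDr.
Qed.

Lemma dotp_delta (i : 'I_d) x : dotp (delta_mx 0 i) x = x 0 i.
Proof.
rewrite /dotp (bigD1 i)//= big1 ?addr0 ?mxE ?eqxx ?mul1r// => j ji.
by rewrite mxE (negbTE ji) andbF mul0r.
Qed.

Lemma enorm_ge0 x : 0 <= enorm x.
Proof. exact: sqrtr_ge0. Qed.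

Lemma coord_le_enorm x i : `|x 0 i| <= enorm x.
Proof.
rewrite /enorm -sqrtr_sqr ler_wsqrtr// /dotp (bigD1 i)//= -expr2 lerDl.
by apply: sumr_ge0 => j _; rewrite -expr2 sqr_ge0.
Qed.

Lemma enorm_le_sum x : enorm x <= \sum_(i < d) `|x 0 i|.
Proof.
have s0 : 0 <= \sum_(i < d) `|x 0 i| by apply: sumr_ge0.
rewrite /enorm -(ger0_norm s0) -sqrtr_sqr ler_wsqrtr// /dotp.
rewrite expr2 mulr_sumr ler_sum// => i _.
rewrite -expr2 -real_normK ?num_real// expr2 ler_wpM2r//.
by rewrite (bigD1 i)//= lerDl; apply: sumr_ge0.
Qed.

Lemma dotp_le_enorm z x : `|dotp z x| <= (\sum_(i < d) `|z 0 i|) * enorm x.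
Proof.
rewrite /dotp (le_trans (ler_norm_sum _ _ _))// mulr_suml ler_sum// => i _.
by rewrite normrM ler_wpM2l// coord_le_enorm.
Qed.

Lemma continuous_dotp z : continuous (dotp z).
Proof.
apply: continuous_sumr => i x.
by apply: (@continuousM _ _ (fun=> z 0 i) (fun y : 'rV[R]_d => y 0 i)); [exact: cst_continuous|exact: coord_continuous].
Qed.

Lemma continuous_enorm : continuous (@enorm R d).
Proof.
move=> x; apply: (@continuous_comp _ _ _ (fun y : 'rV[R]_d => dotp y y) Num.sqrt); last exact: sqrt_continuous.
move: x.
apply: continuous_sumr => i y; by apply: (@continuousM _ _ (fun y : 'rV[R]_d => y 0 i) (fun y : 'rV[R]_d => y 0 i)); exact: coord_continuous.
Qed.

Lemma open_measurable_rV (U : set 'rV[R]_d) : open U -> measurable U.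
Proof. by move=> oU; exact: sub_sigma_algebra. Qed.

Lemma continuous_measurable_rV (g : 'rV[R]_d -> R) :
  continuous g -> measurable_fun setT g.
Proof.
move=> /continuousP cg.
apply: (measurability _ (RGenOpens.measurableE R)) => // _ [_ [a [b ->] <-]].
by rewrite setTI; apply: open_measurable_rV; apply: cg; exact: interval_open.
Qed.

Lemma measurable_dotp z : measurable_fun setT (dotp z).
Proof. by apply: continuous_measurable_rV; exact: continuous_dotp. Qed.

Lemma measurable_enorm : measurable_fun setT (@enorm R d).
Proof. by apply: continuous_measurable_rV; exact: continuous_enorm. Qed.

Lemma measurable_coord i : measurable_fun setT (fun x : 'rV[R]_d => x 0 i).
Proof. by apply: continuous_measurable_rV; exact: (@coord_continuous R 1 d 0 i). Qed.

(** Every open set is a countable union of cubes with rational centres and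
    radii [1/(k+1)], so the Borel sets are generated by the coordinates. *)
Lemma measurable_rVP {disp} {T : measurableType disp} (Y : T -> 'rV[R]_d) :
  (forall i, measurable_fun setT (fun w => Y w 0 i)) -> measurable_fun setT Y.
Proof.
move=> mY; apply: (measurability (@open 'rV[R]_d)) => // _ [U oU <-].
rewrite setTI.
pose box (qk : 'rV[rat]_d * nat) : set 'rV[R]_d :=
  [set x | forall i, `|x 0 i - ratr (qk.1 0 i)| < qk.2.+1%:R^-1].
pose S n : set T := if unpickle n is Some qk then
  (if `[< box qk `<=` U >] then Y @^-1` box qk else set0) else set0.
have -> : Y @^-1` U = \bigcup_n S n.
  apply/seteqP; split => [w Uw|w [n _]]; last first.
    rewrite /S; case: unpickle => // qk; case: ifPn => // /asboolP h; exact: h.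
  have oUw : open_nbhs (Y w) U by split.
  have /nbhs_ballP[e /= e0 eU] := open_nbhs_nbhs oUw.
  have [k ke] : exists k, (k.+1%:R^-1 : R) < e / 2.
    have e20 : 0 < e / 2 by rewrite divr_gt0.
    by have [k] := ltr_add_invr e20; rewrite add0r; exists k.
  have /choice[q hq] : forall i : 'I_d, exists q : rat, `|Y w 0 i - ratr q| < k.+1%:R^-1.
    move=> i; have [q] := @rat_in_itvoo R (Y w 0 i) (Y w 0 i + k.+1%:R^-1)
      ltac:(by rewrite ltrDl invr_gt0).
    rewrite in_itv/= => /andP[h1 h2]; exists q.
    by rewrite ltr_distlC h2 andbT (lt_trans _ h1)// gtrDl oppr_lt0 invr_gt0.
  exists (pickle (\row_i q i, k)) => //; rewrite /S pickleK asboolT; last first.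
    move=> x bx; apply: eU; split => // i j; rewrite ord1.
    rewrite /ball/= (le_lt_trans (ler_distD (ratr (q j)) _ _))// [ltRHS]splitr ltrD//.
      exact: lt_trans (hq j) ke.
    by have := bx j; rewrite /= mxE distrC => /lt_trans; exact.
  by move=> i; rewrite mxE.
apply: bigcupT_measurable => n; rewrite /S.
case: unpickle => [qk|]//; case: ifPn => // _.
have -> : Y @^-1` box qk = \big[setI/setT]_(i < d)
   (fun w => `|Y w 0 i - ratr (qk.1 0 i)|) @^-1` `]-oo, (qk.2.+1%:R^-1 : R)[%classic.
  apply/seteqP; split => [w bw|w].
    by elim/big_ind : _ => // i _ /=; rewrite in_itv/=; exact: bw.
  by rewrite -bigcap_seq => h i; have := h i; rewrite /= mem_index_enum in_itv/=; exact.
apply: bigsetI_measurable => i _; rewrite -[X in measurable X]setTI.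
by apply: measurableT_comp => //; apply: measurable_funB.
Qed.

End vectors.

(** * Averaging inequality *)

Section averaging.
Context {R : realType}.

Lemma continuous_one_sub_cosM (y : R) : continuous (fun t : R => 1 - cos (t * y)).
Proof.
move=> t; apply: cvgB; first exact: cvg_cst.
apply: continuous_comp; last exact: continuous_cos.
exact: mulrr_continuous.
Qed.

(** The integral is [T - sin (T y) / y], and [|sin (T y) / y| <= 1 / |y| <= T / 2]. *)
Lemma integral_one_sub_cos (T y : R) : 0 < T -> 2 <= T * `|y| ->
  ((T / 2)%:E <= \int[@lebesgue_measure R]_(t in `[0%R, T]) (1 - cos (t * y))%:E)%E.
Proof.
move=> T0 Ty; have y0 : 0 < `|y|.
  by rewrite lt_neqAle normr_ge0 andbT; apply/eqP => y0; move: Ty; rewrite -y0; lra.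
have yN0 : y != 0 by rewrite -normr_gt0.
pose F (t : R) : R := t - y^-1 * sin (t * y).
have dF (t : R) : is_derive t 1 F (1 - cos (t * y)).
  rewrite /F; apply: is_derive_eq.
  by rewrite scaler0 add0r /GRing.scale/= mulr1; field.
have cF : continuous F by move=> t; apply/differentiable_continuous/derivable1_diffP; case: (dF t).
rewrite (@continuous_FTC2 _ _ F)//.
- rewrite /F mul0r sin0 mulr0 subr0 -EFinB lee_fin subr0.
  have : `|y^-1 * sin (T * y)| <= T / 2.
    rewrite normrM normfV -[leRHS]mulr1 ler_pM//; last exact: sin_max.
    by rewrite -div1r ler_pdivrMr//; lra.
  by rewrite ler_norml; lra.
- by apply: continuous_subspaceT; exact: continuous_one_sub_cosM.
- split.
  + by move=> t _; case: (dF t).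
  + by apply: cvg_at_right_filter; exact: cF.
  + by apply: cvg_at_left_filter; exact: cF.
- by move=> t _; rewrite derive1E; case: (dF t).
Qed.

(** The truncation inequality that underlies the continuity theorem of Paul
    Levy: the mean of [1 - cos (t h)] over [t] in [[0, S]] is at least [1/2] where
    [|h| >= 2 / S], and Tonelli exchanges this mean with the integral over [m].
    It is used for a probability and for Lebesgue measure. *)
Lemma large_values_mass_le {disp} {T : measurableType disp}
  (m : {sigma_finite_measure set T -> \bar R}) (h : T -> R) (S M : R) :
  measurable_fun setT h -> 0 < S ->
  (forall t, 0 <= t <= S -> (\int[m]_x (1 - cos (t * h x))%:E <= M%:E)%E) ->
  (m [set x | 2 <= S * `|h x|]%R <= (2 * M)%:E)%E.
Proof.
move=> mh S0 hM.
pose F (z : R * T) : \bar R := (\1_(`[0%R, S]%classic) z.1 * (1 - cos (z.1 * h z.2)))%:E.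
have mF : measurable_fun setT F.
  apply/measurable_EFinP; apply: measurable_funM.
    apply: (@measurableT_comp _ _ _ _ _ _ (\1_`[0%R, S]%classic : R -> R)) => //.
  apply: measurable_funB => //.
  apply: (@measurableT_comp _ _ _ _ _ _ (@cos R)).
    by apply: continuous_measurable_fun; exact: continuous_cos.
  by apply: measurable_funM => //; exact: measurableT_comp.
have F0 z : (0 <= F z)%E.
  by rewrite lee_fin mulr_ge0// one_sub_cos_ge0.
have := @fubini_tonelli _ _ _ _ _ (@lebesgue_measure R) m F mF F0.
set A := [set x | _].
have mA : measurable A.
  rewrite (_ : A = (fun x => S * `|h x|) @^-1` `[2, +oo[%classic).
    rewrite -[X in measurable X]setTI.
    apply: measurable_funM => //; exact: measurableT_comp.
  by apply/seteqP; split => x; rewrite /= in_itv/= andbT.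
move=> H.
have H1 : (\int[@lebesgue_measure R]_t \int[m]_x F (t, x) <= (S * M)%:E)%E.
  apply: (@le_trans _ _ (\int[@lebesgue_measure R]_t ((\1_(`[0%R, S]%classic) t) * M)%:E)%E).
    apply: ge0_le_integral => //=.
    - by move=> t _; exact: integral_ge0.
    - exact: measurable_fun_fubini_tonelli_F.
    - by apply/measurable_EFinP; apply: measurable_funM.
    - move=> t _; rewrite /F/= indicE; have [|_] := boolP (t \in _); last first.
        by rewrite mul0r; under eq_integral do rewrite mul0r; rewrite integral0.
      rewrite inE/= in_itv/= => t0.
      by rewrite mul1r; under eq_integral do rewrite mul1r; exact: hM.
  under eq_integral do rewrite EFinM muleC.
  have M0 : 0 <= M.
    have := hM 0; rewrite lexx (ltW S0) => /(_ isT).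
    under eq_integral do rewrite mul0r cos0 subrr.
    by rewrite integral0 lee_fin.
  rewrite ge0_integralZl//; last exact/measurable_EFinP.
  have hS : lebesgue_measure (`[0%R, S]%classic : set R) = S%:E.
    by rewrite lebesgue_measure_itv/= lte_fin S0 sube0.
  rewrite integral_indic// setIT muleC EFinM.
  by rewrite [X in (X * _)%E]hS.
have H2 : ((S / 2)%:E * m A <= \int[m]_x \int[@lebesgue_measure R]_t F (t, x))%E.
  rewrite -[in leLHS](setIT A) -integral_indic// -ge0_integralZl//; last 2 first.
    exact/measurable_EFinP.
    by rewrite lee_fin divr_ge0// ltW.
  apply: ge0_le_integral => //=.
  - by move=> x _; rewrite -EFinM lee_fin mulr_ge0// divr_ge0// ltW.
  - by apply: emeasurable_funM => //; exact/measurable_EFinP.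
  - exact: measurable_fun_fubini_tonelli_G.
  - move=> x _; rewrite indicE; have [|_] := boolP (x \in _); last first.
      by rewrite mule0; exact: integral_ge0.
    rewrite inE/= mule1 => xA.
    apply: (le_trans (integral_one_sub_cos S0 xA)).
    rewrite integral_mkcond; apply: ge0_le_integral => //=.
    + by move=> t _; rewrite erestrict_ge0// => *; rewrite lee_fin one_sub_cos_ge0.
    + apply/(measurable_restrictT _ _).1 => //; apply/measurable_funTS/measurable_EFinP.
      by apply: continuous_measurable_fun; exact: continuous_one_sub_cosM.
    + by apply: measurableT_comp mF _; exact: measurable_pair2.
    + move=> t _; rewrite patchE /F/= indicE; by case: ifPn => _; rewrite ?mul1r// mul0r; exact: lexx.
have : ((S / 2)%:E * m A <= (S / 2)%:E * (2 * M)%:E)%E.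
  apply: (le_trans H2); rewrite -H; apply: (le_trans H1).
  by rewrite -EFinM lee_fin; lra.
by rewrite lee_pmul2l// lte_fin divr_gt0.
Qed.

End averaging.

(** * Characteristic functions of independent sums *)

Lemma integrable_bounded_fin {R : realType} {disp} {T : measurableType disp}
  (m : {measure set T -> \bar R}) (f : T -> R) (M : R) :
  (m setT < +oo)%E -> measurable_fun setT f ->
  (forall x, `|f x| <= M) -> m.-integrable setT (EFin \o f).
Proof.
move=> moo mf fM; apply: measurable_bounded_integrable => //.
by exists M; split; rewrite ?num_real// => N MN x _ /=; rewrite (le_trans (fM x))// ltW.
Qed.

Lemma integrable_bounded {R : realType} {disp} {T : measurableType disp}
  (m : {finite_measure set T -> \bar R}) (f : T -> R) (M : R) :
  measurable_fun setT f ->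
  (forall x, `|f x| <= M) -> m.-integrable setT (EFin \o f).
Proof.
apply: integrable_bounded_fin.
by rewrite -ge0_fin_numE//; exact: fin_num_measure.
Qed.

Section real_random_variables.
Context {R : realType} {disp} {T : measurableType disp} (P : probability T R).
Implicit Types U V : T -> R.

Lemma measurable_cos D (f : T -> R) : measurable_fun D f ->
  measurable_fun D (fun x => cos (f x)).
Proof.
move=> mf; apply: (@measurableT_comp _ _ _ _ _ _ (@cos R)) => //.
by apply: continuous_measurable_fun; exact: continuous_cos.
Qed.

Lemma measurable_sin D (f : T -> R) : measurable_fun D f ->
  measurable_fun D (fun x => sin (f x)).
Proof.
move=> mf; apply: (@measurableT_comp _ _ _ _ _ _ (@sin R)) => //.
by apply: continuous_measurable_fun; exact: continuous_sin.
Qed.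

(** The joint law of [(U, V)] is the product of the two laws, so that Fubini
    applies. *)
Lemma expectation_indep U V (F G : R -> R) :
  measurable_fun setT U -> measurable_fun setT V ->
  measurable_fun setT F -> measurable_fun setT G ->
  (forall x, `|F x| <= 1) -> (forall x, `|G x| <= 1) ->
  (forall A B, measurable A -> measurable B ->
    P (U @^-1` A `&` V @^-1` B) = (P (U @^-1` A) * P (V @^-1` B))%E) ->
  \int[P]_x (F (U x) * G (V x)) = (\int[P]_x F (U x)) * (\int[P]_x G (V x)).
Proof.
move=> mU mV mF mG F1 G1 UV.
pose U' : {mfun T >-> R} := HB.pack U (isMeasurableFun.Build _ _ _ _ U mU).
pose V' : {mfun T >-> R} := HB.pack V (isMeasurableFun.Build _ _ _ _ V mV).
have mW : measurable_fun setT (fun x => (U x, V x)) by exact: measurable_fun_pair.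
pose W : {mfun T >-> (R * R)%type} :=
  HB.pack (fun x => (U x, V x)) (isMeasurableFun.Build _ _ _ _ _ mW).
pose m1 := distribution P U'; pose m2 := distribution P V'.
pose H (z : R * R) := F z.1 * G z.2.
have mH : measurable_fun setT H by apply: measurable_funM; exact: measurableT_comp.
have H1 z : `|H z| <= 1 by rewrite normrM mulr_ile1.
have iF : m1.-integrable setT (EFin \o F) by exact: integrable_bounded mF F1.
have iG : m2.-integrable setT (EFin \o G) by exact: integrable_bounded mG G1.
have -> : \int[P]_x F (U x) = fine (\int[m1]_x (F x)%:E)%E.
  rewrite integral_distribution//; first exact/measurable_EFinP.
  apply: (@integrable_bounded _ _ _ _ _ 1) => //; exact: measurableT_comp.
have -> : \int[P]_x G (V x) = fine (\int[m2]_x (G x)%:E)%E.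
  rewrite integral_distribution//; first exact/measurable_EFinP.
  apply: (@integrable_bounded _ _ _ _ _ 1) => //; exact: measurableT_comp.
rewrite -fineM; [|exact: integrable_fin_num|exact: integrable_fin_num].
congr fine.
transitivity (\int[distribution P W]_z (H z)%:E)%E.
  rewrite integral_distribution//; first exact/measurable_EFinP.
  by apply: (@integrable_bounded _ _ _ _ _ 1) => //; exact: measurableT_comp.
have m12 A : measurable A -> (m1 \x m2)%E A = distribution P W A.
  by move: A; apply: product_measure_unique => B C mB mC; exact: UV.
rewrite (eq_measure_integral (m1 \x m2)%E); last first.
  by move=> A mA _; exact: (esym (m12 A mA)).
have m120 : (m1 \x m2)%E setT = 1%E.
  exact: etrans (m12 _ measurableT) (probability_setT (distribution P W)).
have iH : (m1 \x m2)%E.-integrable setT (EFin \o H).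
  by apply: integrable_bounded_fin mH H1; rewrite [ltLHS]m120 ltry.
rewrite -integral12_prod_meas1// /fubini_F /H/=.
under eq_integral => x _.
  under eq_integral do rewrite EFinM.
  rewrite integralZl//.
  rewrite -[X in (_ * X)%E](@fineK R); last exact: integrable_fin_num.
  over.
rewrite integralZr// fineK//; exact: integrable_fin_num.
Qed.

(** The characteristic function of a real random variable, at [1]. *)
Definition cfun U : R[i] := Complex (\int[P]_x cos (U x)) (\int[P]_x sin (U x)).

Lemma cfunD U V : measurable_fun setT U -> measurable_fun setT V ->
  (forall A B, measurable A -> measurable B ->
    P (U @^-1` A `&` V @^-1` B) = (P (U @^-1` A) * P (V @^-1` B))%E) ->
  cfun (fun x => U x + V x) = cfun U * cfun V.
Proof.
move=> mU mV UV.
have mc : measurable_fun setT (@cos R) by apply: continuous_measurable_fun; exact: continuous_cos.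
have ms : measurable_fun setT (@sin R) by apply: continuous_measurable_fun; exact: continuous_sin.
have c1 (x : R) : `|cos x| <= 1 := cos_max x.
have s1 (x : R) : `|sin x| <= 1 := sin_max x.
have int2 (F G : R -> R) : measurable_fun setT F -> measurable_fun setT G ->
   (forall x, `|F x| <= 1) -> (forall x, `|G x| <= 1) ->
   P.-integrable setT (EFin \o (fun x => F (U x) * G (V x))).
  move=> mF mG F1 G1; apply: (@integrable_bounded _ _ _ _ _ 1) => //.
    by apply: measurable_funM; exact: measurableT_comp.
  by move=> x; rewrite normrM mulr_ile1.
apply: complex_eqP => /=.
- under eq_Rintegral do rewrite cosD.
  by rewrite RintegralB//; [rewrite !expectation_indep|exact: int2|exact: int2].
- under eq_Rintegral do rewrite sinD.
  rewrite RintegralD//; [rewrite !expectation_indep//|exact: int2|exact: int2].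
  by rewrite addrC.
Qed.

(** The joint laws of [(U, V)] under [P] restricted to [G] and under [P]
    scaled by [P G] agree on rectangles, hence everywhere. In the applications
    [G] is an event about the remaining members of an independent family. *)
Lemma indep_sum_event U V (G : set T) (A : set R) :
  measurable_fun setT U -> measurable_fun setT V -> measurable G ->
  measurable A ->
  (forall A B, measurable A -> measurable B ->
    P (U @^-1` A `&` V @^-1` B `&` G) =
    (P (U @^-1` A) * P (V @^-1` B) * P G)%E) ->
  (forall A B, measurable A -> measurable B ->
    P (U @^-1` A `&` V @^-1` B) = (P (U @^-1` A) * P (V @^-1` B))%E) ->
  P ((fun x => U x + V x) @^-1` A `&` G) =
  (P ((fun x => U x + V x)%R @^-1` A) * P G)%E.
Proof.
move=> mU mV mG mA UVG UV.
pose U' : {mfun T >-> R} := HB.pack U (isMeasurableFun.Build _ _ _ _ U mU).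
pose V' : {mfun T >-> R} := HB.pack V (isMeasurableFun.Build _ _ _ _ V mV).
have mW : measurable_fun setT (fun x => (U x, V x)) by exact: measurable_fun_pair.
pose W : {mfun T >-> (R * R)%type} :=
  HB.pack (fun x => (U x, V x)) (isMeasurableFun.Build _ _ _ _ _ mW).
pose m1 := distribution P U'; pose m2 := distribution P V'.
have PG0 : 0 <= fine (P G) by exact: fine_ge0.
pose g := NngNum PG0.
have PGE : (g%:num)%:E = P G by rewrite /= fineK// fin_num_measure.
have mS : measurable ((fun z : R * R => z.1 + z.2) @^-1` A).
  rewrite -[X in measurable X]setTI; apply: measurable_funD => //.
pose mg : {measure set (R * R) -> \bar R} := mscale g (distribution P W).
have [mr mrE] : exists mr : {measure set (R * R) -> \bar R},
    forall B, mr B = P (W @^-1` B `&` G).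
  pose mr : {measure set (R * R) -> \bar R} :=
    pushforward (mrestr P mG) W.
  by exists (mr mW).
have m2E C : mscale g m2 C = (P G * P (V @^-1` C))%E by rewrite -PGE.
have E1 : (m1 \x mscale g m2)%E ((fun z : R * R => z.1 + z.2) @^-1` A) =
  mg ((fun z : R * R => z.1 + z.2) @^-1` A).
  apply: product_measure_unique => // B C mB mC.
  transitivity (P G * P (U @^-1` B `&` V @^-1` C))%E; first by rewrite -PGE.
  rewrite UV// muleCA; congr (_ * _)%E; exact: esym (m2E C).
have E2 : (m1 \x mscale g m2)%E ((fun z : R * R => z.1 + z.2) @^-1` A) =
  mr ((fun z : R * R => z.1 + z.2) @^-1` A).
  apply: product_measure_unique => // B C mB mC.
  transitivity (P (U @^-1` B `&` V @^-1` C `&` G)); first exact: mrE.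
  rewrite UVG// -muleA [X in (_ * X)%E]muleC; congr (_ * _)%E.
  exact: esym (m2E C).
rewrite [RHS]muleC -PGE; transitivity (mr ((fun z : R * R => z.1 + z.2) @^-1` A)).
  by rewrite mrE.
by rewrite -E2 E1.
Qed.

End real_random_variables.

Section independent_family.
Context {R : realType} {disp} {T : measurableType disp} (P : probability T R).
Context {I : finType} (X : I -> T -> R).
Hypothesis mX : forall i, measurable_fun setT (X i).

Lemma measurable_preim (Y : T -> R) (A : set R) :
  measurable_fun setT Y -> measurable A -> measurable (Y @^-1` A).
Proof. by move=> mY mA; rewrite -[X in measurable X]setTI; exact: mY. Qed.

Let rest (s : seq I) (B : I -> set R) : set T :=
  [set w | forall i, i \notin s -> B i (X i w)].

Let measurable_rest s B : (forall i, measurable (B i)) -> measurable (rest s B).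
Proof.
move=> mB.
rewrite (_ : rest s B = \bigcap_(i in [set i | i \notin s]) (X i @^-1` B i))//.
by apply: fin_bigcap_measurable => [|i _]; [exact: finite_finset|exact: measurable_preim].
Qed.

Hypothesis prodX : forall B : I -> set R, (forall i, measurable (B i)) ->
  P [set w | forall i, B i (X i w)] = (\prod_i P (X i @^-1` B i))%E.

Let S (s : seq I) (w : T) : R := \sum_(i <- s) X i w.

Let mS s : measurable_fun setT (S s).
Proof. exact: measurable_sum. Qed.

(** Members of the family move one by one into the partial sum, which stays
    independent of those that remain. *)
Let indep_partial_sum s (A : set R) (B : I -> set R) : uniq s -> measurable A ->
  (forall i, measurable (B i)) ->
  P (S s @^-1` A `&` rest s B) =
  (P (S s @^-1` A) * \prod_(i | i \notin s) P (X i @^-1` B i))%E.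
Proof.
elim: s A B => [|j s ih] A B /=.
  move=> _ mA mB.
  have -> : rest [::] B = [set w | forall i, B i (X i w)].
    by apply/seteqP; split => w /= h i; [exact: h|move=> _; exact: h].
  have [A0|A0] := pselect (A 0).
    have -> : S [::] @^-1` A = setT by apply/seteqP; split => // w _; rewrite /S/= big_nil.
    by rewrite setTI probability_setT mul1e prodX.
  have -> : S [::] @^-1` A = set0.
    by apply/seteqP; split => // w; rewrite /S/= big_nil.
  by rewrite set0I measure0 mul0e.
move=> /andP[js us] mA mB.
have SE : S (j :: s) = (fun w => S s w + X j w).
  by apply/funext => w; rewrite /S big_cons addrC.
pose B' C i := if i == j then C else B i.
have mB' C : measurable C -> forall i, measurable (B' C i).
  by move=> mC i; rewrite /B'; case: ifPn.
have rE C : X j @^-1` C `&` rest (j :: s) B = rest s (B' C).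
  apply/seteqP; split=> [w [wC h] i iNs|w h].
    rewrite /B'; have [->//|ij] := eqVneq i j.
    by apply: h; rewrite inE negb_or ij.
  split; first by have := h j js; rewrite /B' eqxx.
  move=> i; rewrite inE negb_or => /andP[ij iNs].
  by have := h i iNs; rewrite /B' (negbTE ij).
have pE C : (\prod_(i | i \notin s) P (X i @^-1` B' C i) =
   P (X j @^-1` C) * \prod_(i | i \notin j :: s) P (X i @^-1` B i))%E.
  rewrite (bigD1 j)//= {1}/B' eqxx; congr (_ * _)%E.
  apply: eq_big => [i|i /andP[_ ij]]; first by rewrite inE negb_or andbC.
  by rewrite /B' (negbTE ij).
have PG : P (rest (j :: s) B) = (\prod_(i | i \notin j :: s) P (X i @^-1` B i))%E.
  have := ih setT (B' setT) us measurableT (mB' _ measurableT).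
  by rewrite -rE pE !preimage_setT !setTI !probability_setT !mul1e.
rewrite SE -PG; apply: indep_sum_event => //.
- exact: measurable_rest.
- move=> A1 A2 mA1 mA2; rewrite -setIA rE ih ?pE ?PG ?muleA//; exact: mB'.
- move=> A1 A2 mA1 mA2.
  pose C i := if i == j then A2 else setT.
  have mC i : measurable (C i) by rewrite /C; case: ifPn.
  have := ih A1 C us mA1 mC.
  have -> : rest s C = X j @^-1` A2.
    apply/seteqP; split=> [w h|w h i _]; first by have := h j js; rewrite /C eqxx.
    by rewrite /C; have [->|] := eqVneq i j.
  move=> ->; rewrite (bigD1 j)//= {1}/C eqxx big1 ?mule1// => i /andP[_ ij].
  by rewrite /C (negbTE ij) preimage_setT probability_setT.
Qed.

Lemma cfun_sum_indep : cfun P (fun w => \sum_i X i w) = \prod_i cfun P (X i).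
Proof.
have cf s : uniq s -> cfun P (S s) = \prod_(i <- s) cfun P (X i).
  elim: s => [_|j s ih /= /andP[js us]].
    rewrite big_nil; apply: complex_eqP => /=.
      under eq_Rintegral do rewrite /S big_nil cos0.
      rewrite Rintegral_cst// mul1r; exact: (congr1 fine (probability_setT P)).
    under eq_Rintegral do rewrite /S big_nil sin0.
    by rewrite Rintegral_cst// mul0r.
  rewrite big_cons -ih// mulrC -cfunD//.
    by congr cfun; apply/funext => w; rewrite /S big_cons addrC.
  move=> A1 A2 mA1 mA2.
  pose C i := if i == j then A2 else setT.
  have mC i : measurable (C i) by rewrite /C; case: ifPn.
  have := indep_partial_sum us mA1 mC.
  have -> : rest s C = X j @^-1` A2.
    apply/seteqP; split=> [w h|w h i _]; first by have := h j js; rewrite /C eqxx.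
    by rewrite /C; have [->|] := eqVneq i j.
  move=> ->; rewrite (bigD1 j)//= {1}/C eqxx big1 ?mule1// => i /andP[_ ij].
  by rewrite /C (negbTE ij) preimage_setT probability_setT.
by rewrite -(cf _ (index_enum_uniq I)).
Qed.

End independent_family.

(** * Characteristic function of a random measure *)

Section cfun_limits.
Context {R : realType} {disp} {T : measurableType disp} (P : probability T R).

Lemma cfun_ae (U V : T -> R) : measurable_fun setT U -> measurable_fun setT V ->
  {ae P, forall w, U w = V w} -> cfun P U = cfun P V.
Proof.
move=> mU mV UV; apply: complex_eqP => /=; congr fine; apply: ae_eq_integral => //.
- by apply/measurable_EFinP; exact: measurable_cos.
- by apply/measurable_EFinP; exact: measurable_cos.
- by apply: filterS UV => w -> _.
- by apply/measurable_EFinP; exact: measurable_sin.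
- by apply/measurable_EFinP; exact: measurable_sin.
- by apply: filterS UV => w -> _.
Qed.

Lemma cvg_expectation (F : R -> R) (U : nat -> T -> R) (V : T -> R) :
  continuous F -> (forall x, `|F x| <= 1) ->
  (forall n, measurable_fun setT (U n)) -> measurable_fun setT V ->
  {ae P, forall w, U n w @[n --> \oo] --> V w} ->
  \int[P]_w F (U n w) @[n --> \oo] --> \int[P]_w F (V w).
Proof.
move=> cF F1 mU mV UV.
have mF : measurable_fun setT F by exact: continuous_measurable_fun.
have iV : P.-integrable setT (EFin \o (fun w => F (V w))).
  by apply: (@integrable_bounded _ _ _ _ _ 1) => //; exact: measurableT_comp.
apply: fine_cvg; rewrite fineK; last exact: integrable_fin_num.
have [|||||_ _] := @dominated_convergence _ T R P setT measurableT
  (fun n w => (F (U n w))%:E) (fun w => (F (V w))%:E) (cst 1%E); last by [].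
- by move=> n; apply/measurable_EFinP; exact: measurableT_comp.
- by apply/measurable_EFinP; exact: measurableT_comp.
- apply: filterS UV => w UVw _; apply/cvg_EFin; first exact: nearW.
  by apply: continuous_cvg => //; exact: cF.
- by apply: (@integrable_bounded _ _ _ _ (cst 1) 1) => // x; rewrite normr1.
- by apply: aeW => w n _ /=; rewrite lee_fin.
Qed.

Lemma cfun_continuous (Y : T -> R) : measurable_fun setT Y ->
  continuous (fun t : R => complex.Re (cfun P (fun w => t * Y w))) /\
  continuous (fun t : R => complex.Im (cfun P (fun w => t * Y w))).
Proof.
move=> mY; split=> t; apply/(@cvg_nbhsP _ R^o) => u ut; apply: cvg_expectation.
all: try exact: continuous_cos; try exact: continuous_sin.
all: try exact: cos_max; try exact: sin_max.
all: try by move=> n; apply: measurable_funM.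
all: try by apply: measurable_funM.
all: by apply: aeW => w; apply: cvgM => //; exact: cvg_cst.
Qed.

End cfun_limits.

Section random_measure_additivity.
Context {R : realType} {d : nat} {mu : probability 'rV[R]_d R}
  {disp} {T : measurableType disp} {P : probability T R}
  {X : set R -> T -> 'rV[R]_d}.
Hypothesis HX : is_random_measure mu P X.

Lemma bounded_borelS (A B : set R) : measurable A -> bounded_borel B ->
  A `<=` B -> bounded_borel A.
Proof.
move=> mA [_ [M [Mr BM]]] AB; split => //; exists M; split => // N MN x Ax.
by apply: (BM N MN); exact: AB.
Qed.

Lemma bounded_borel_itv (x y : R) : bounded_borel `]x, y]%classic.
Proof.
split => //; exists (`|x| + `|y|); split; rewrite ?num_real// => M MM z /=.
rewrite in_itv/= => /andP[xz zy]; rewrite (le_trans _ (ltW MM))//.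
have := ler_norm x; have := ler_norm (- x); have := ler_norm y; have := ler_norm (- y).
have := normr_ge0 x; have := normr_ge0 y.
by rewrite !normrN ler_norml => *; apply/andP; split; lra.
Qed.

Lemma bounded_borelU (A B : set R) : bounded_borel A -> bounded_borel B ->
  bounded_borel (A `|` B).
Proof.
move=> [mA bA] [mB bB]; split; first exact: measurableU.
rewrite /bounded_set/=.
move: bA bB => [M [Mr AM]] [N [Nr BN]]; exists (Num.max M N); split => [|z].
  by rewrite num_real.
rewrite gt_max => /andP[Mz Nz] x [/AM|/BN]; exact.
Qed.

Lemma bounded_borel0 : bounded_borel (set0 : set R).
Proof. by apply: (bounded_borelS _ (bounded_borel_itv 0 0)). Qed.

(** Additivity for a sequence of empty sets makes [n X(set0)] converge, which
    forces [X(set0) = 0]. *)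
Lemma random_measure_set0 : {ae P, forall w, X set0 w = 0}.
Proof.
have := rm_additive HX (B := fun=> set0) (fun=> bounded_borel0).
rewrite bigcup0// => /(_ _ bounded_borel0) H.
have {}H := H ltac:(by apply/trivIsetP => i j _ _ _; rewrite set0I).
apply: filterS H => w.
under eq_fun do rewrite sumr_const card_ord.
move=> h.
have h1 : (X set0 w *+ n.+1) @[n --> \oo] --> X set0 w.
  by move: h; rewrite -(cvg_shiftS (fun n => X set0 w *+ n)).
have h2 : (X set0 w *+ n.+1 - X set0 w *+ n) @[n --> \oo] --> X set0 w - X set0 w.
  exact: cvgB.
move: h2; under eq_fun do rewrite mulrSr addrC addKr.
rewrite subrr => h2; apply: (@cvg_unique _ (@norm_hausdorff _ _) _ _ _ _ _ h2).
exact: cvg_cst.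
Qed.

Lemma random_measureU (A B : set R) : bounded_borel A -> bounded_borel B ->
  A `&` B = set0 -> {ae P, forall w, X (A `|` B) w = X A w + X B w}.
Proof.
move=> bA bB AB.
have bAB n : bounded_borel (bigcup2 A B n).
  by case: n => [|[|n]]//=; exact: bounded_borel0.
have tAB : trivIset setT (bigcup2 A B) by apply/trivIsetP => -[|[|i]] [|[|j]] //= _ _ _; rewrite ?setI0 ?set0I// setIC.
have := rm_additive HX bAB tAB; rewrite bigcup2E => /(_ (bounded_borelU bA bB)).
move=> H; have H0 := random_measure_set0; near=> w.
have h : \sum_(i < n) X (bigcup2 A B i) w @[n --> \oo] --> X (A `|` B) w.
  by near: w.
have w0 : X set0 w = 0 by near: w.
apply: (@cvg_unique _ (@norm_hausdorff _ _) _ _ _ _ h).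
apply: cvg_near_cst; exists 2%N => // n /= n2.
rewrite -(subnK n2) addnC big_ord_recl big_ord_recl/= big1 ?addr0.
Unshelve. all: by end_near. Qed.
End random_measure_additivity.

Lemma sum_scale_complex {R : realType} (I : Type) (s : seq I) (a : I -> R) (c : R[i]) :
  \sum_(i <- s) Complex (a i) 0 * c = Complex (\sum_(i <- s) a i) 0 * c.
Proof.
elim: s => [|i s ih]; first by rewrite !big_nil (_ : Complex 0 0 = 0)// mul0r.
rewrite !big_cons ih -mulrDl; congr (_ * _).
by apply: complex_eqP => /=; rewrite ?addr0.
Qed.

Section random_measure_cf.
Context {R : realType} {d : nat} {mu : probability 'rV[R]_d R}
  {disp} {T : measurableType disp} {P : probability T R}
  {X : set R -> T -> 'rV[R]_d}.
Hypothesis HX : is_random_measure mu P X.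

Definition rm_cf (B : set R) (z : 'rV[R]_d) : R[i] :=
  cfun P (fun w => dotp z (X B w)).
Local Notation phi := rm_cf.

Lemma measurable_dotp_rm z B : bounded_borel B ->
  measurable_fun setT (fun w => dotp z (X B w)).
Proof.
move=> bB; apply: (@measurableT_comp _ _ _ _ _ _ (dotp z)).
  exact: measurable_dotp.
exact: (rm_measurable HX).
Qed.

(** The directions [z i] may differ: the difference of two integrals of simple
    functions is a sum of this form. *)
Lemma rm_cf_family (I : finType) (B : I -> set R) (z : I -> 'rV[R]_d) :
  (forall i, bounded_borel (B i)) -> trivIset setT B ->
  cfun P (fun w => \sum_i dotp (z i) (X (B i) w)) = \prod_i phi (B i) (z i).
Proof.
move=> bB tB; apply: cfun_sum_indep => [i|A mA]; first exact: measurable_dotp_rm.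
have := rm_independent HX (B := fun j : 'I_#|I| => B (enum_val j))
  (A := fun j => dotp (z (enum_val j)) @^-1` A (enum_val j)) (fun j => bB _).
have tB' : trivIset setT (fun j : 'I_#|I| => B (enum_val j)).
  by move=> i j _ _ h; apply: enum_val_inj; exact: tB.
move=> /(_ tB').
have mA' : forall j : 'I_#|I|, measurable (dotp (z (enum_val j)) @^-1` A (enum_val j)).
  move=> j; rewrite -[X in measurable X]setTI; exact: measurable_dotp.
move=> /(_ mA') H.
transitivity (P [set w | forall j : 'I_#|I|,
    (dotp (z (enum_val j)) @^-1` A (enum_val j)) (X (B (enum_val j)) w)]).
  congr (P _); apply/seteqP; split => w /= h; first by move=> j; exact: h.
  by move=> i; have := h (enum_rank i); rewrite enum_rankK.
rewrite H -(big_enum_val (A := I) (fun i => P ((fun w => dotp (z i) (X (B i) w)) @^-1` A i))).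
by apply: eq_bigl.
Qed.

Lemma rm_cfU (A B : set R) z : bounded_borel A -> bounded_borel B ->
  A `&` B = set0 -> phi (A `|` B) z = phi A z * phi B z.
Proof.
move=> bA bB AB.
pose F (b : bool) := if b then A else B.
have bF b : bounded_borel (F b) by case: b.
have tF : trivIset setT F.
  by apply/trivIsetP => -[] [] //= _ _ _; rewrite /F ?AB// setIC.
have := rm_cf_family (fun=> z) bF tF; rewrite big_bool/= => <-.
apply: cfun_ae.
- by apply: measurable_dotp_rm; exact: bounded_borelU.
- by apply: measurable_sum => b; exact: measurable_dotp_rm.
- apply: filterS (random_measureU HX bA bB AB) => w ->.
  by rewrite big_bool/= dotpDr.
Qed.

(** Additivity gives almost sure convergence of the partial sums, and dominated
    convergence passes to the limit in their characteristic functions. *)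
Lemma rm_cf_bigcup (F : nat -> set R) (a : nat -> R) (l : R) (z : 'rV[R]_d) (c : R[i]) :
  (forall n, bounded_borel (F n)) -> trivIset setT F ->
  bounded_borel (\bigcup_n F n) ->
  (forall n, phi (F n) z = cexp (Complex (a n) 0 * c)) ->
  \sum_(i < n) a i @[n --> \oo] --> l ->
  phi (\bigcup_n F n) z = cexp (Complex l 0 * c).
Proof.
move=> bF tF bU phiF al.
have mU := measurable_dotp_rm z bU.
pose S n w := \sum_(i < n) dotp z (X (F i) w).
have mS n : measurable_fun setT (S n).
  by apply: measurable_sum => i; exact: measurable_dotp_rm.
have SX : {ae P, forall w, S n w @[n --> \oo] --> dotp z (X (\bigcup_n F n) w)}.
  apply: filterS (rm_additive HX bF tF bU) => w h.
  rewrite /S; under eq_fun do rewrite -dotp_sumr.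
  exact: (cvg_comp _ _ h (@continuous_dotp R d z _)).
have phiS n : cfun P (S n) = cexp (Complex (\sum_(i < n) a i) 0 * c).
  rewrite /S (rm_cf_family (B := fun i : 'I_n => F i) (fun=> z))//; last first.
    by move=> i j _ _ h; apply: val_inj; exact: tF.
  rewrite (eq_bigr (fun i : 'I_n => cexp (Complex (a i) 0 * c)))//.
  by rewrite -cexp_sum sum_scale_complex.
apply: complex_eqP.
- have h1 := cvg_expectation (@continuous_cos R) (@cos_max R) mS mU SX.
  have : (expR ((\sum_(i < n) a i) * complex.Re c) *
     cos ((\sum_(i < n) a i) * complex.Im c)) @[n --> \oo] -->
     expR (l * complex.Re c) * cos (l * complex.Im c).
    apply: cvgM.
      by apply: continuous_cvg; [exact: continuous_expR|apply: cvgM => //; exact: cvg_cst].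
    by apply: continuous_cvg; [exact: continuous_cos|apply: cvgM => //; exact: cvg_cst].
  rewrite [complex.Re (cexp _)]/= ReZ ImZ.
  have e n : expR ((\sum_(i < n) a i) * complex.Re c) *
     cos ((\sum_(i < n) a i) * complex.Im c) = \int[P]_w cos (S n w).
    have := congr1 (@complex.Re R) (phiS n).
    by rewrite [in RHS]/cexp [in RHS]/= -/(complex.Re _) ReZ ImZ => <-.
  under eq_fun do rewrite e.
  by move=> h2; exact: (@cvg_unique _ (@Rhausdorff R) _ _ _ _ h1 h2).
- have h1 := cvg_expectation (@continuous_sin R) (@sin_max R) mS mU SX.
  have : (expR ((\sum_(i < n) a i) * complex.Re c) *
     sin ((\sum_(i < n) a i) * complex.Im c)) @[n --> \oo] -->
     expR (l * complex.Re c) * sin (l * complex.Im c).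
    apply: cvgM.
      by apply: continuous_cvg; [exact: continuous_expR|apply: cvgM => //; exact: cvg_cst].
    by apply: continuous_cvg; [exact: continuous_sin|apply: cvgM => //; exact: cvg_cst].
  rewrite [complex.Im (cexp _)]/= ReZ ImZ.
  have e n : expR ((\sum_(i < n) a i) * complex.Re c) *
     sin ((\sum_(i < n) a i) * complex.Im c) = \int[P]_w sin (S n w).
    have := congr1 (@complex.Im R) (phiS n).
    by rewrite [in RHS]/cexp [in RHS]/= -/(complex.Re _) ReZ ImZ => <-.
  under eq_fun do rewrite e.
  by move=> h2; exact: (@cvg_unique _ (@Rhausdorff R) _ _ _ _ h1 h2).
Qed.

End random_measure_cf.

Lemma continuous_compT {T U V : topologicalType} (f : T -> U) (g : U -> V) :
  continuous f -> continuous g -> continuous (fun t => g (f t)).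
Proof. by move=> cf cg t; apply: continuous_comp; [exact: cf|exact: cg]. Qed.

Lemma Rintegral_law {R : realType} {disp disp'} {T : measurableType disp}
  {T' : measurableType disp'} (P : probability T R) (m : probability T' R)
  (Y : T -> T') (g : T' -> R) (M : R) :
  measurable_fun setT Y -> (forall A, measurable A -> P (Y @^-1` A) = m A) ->
  measurable_fun setT g -> (forall x, `|g x| <= M) ->
  \int[P]_w g (Y w) = \int[m]_x g x.
Proof.
move=> mY law mg gM; congr fine.
pose Y' : {mfun T >-> T'} := HB.pack Y (isMeasurableFun.Build _ _ _ _ Y mY).
rewrite (@eq_measure_integral _ _ _ _ (distribution P Y')); last first.
  by move=> A mA _; exact: (esym (law A mA)).
rewrite integral_distribution//; first exact/measurable_EFinP.
by apply: (@integrable_bounded _ _ _ _ _ M) => //; exact: measurableT_comp.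
Qed.

Section random_measure_dyadic.
Context {R : realType} {d : nat} {mu : probability 'rV[R]_d R}
  {disp} {T : measurableType disp} {P : probability T R}
  {X : set R -> T -> 'rV[R]_d}.
Hypothesis HX : is_random_measure mu P X.
Context (C : 'rV[R]_d -> R[i]).
Hypothesis HC : is_cumulant mu C.
Local Notation phi := (rm_cf (P := P) (X := X)).

Let mcosdot z : measurable_fun setT (fun x : 'rV[R]_d => cos (dotp z x)).
Proof. by apply: measurable_cos; exact: measurable_dotp. Qed.

Let msindot z : measurable_fun setT (fun x : 'rV[R]_d => sin (dotp z x)).
Proof. by apply: measurable_sin; exact: measurable_dotp. Qed.

Lemma rm_cf_law (B : set R) z (m : probability 'rV[R]_d R) : bounded_borel B ->
  (forall A, measurable A -> P (X B @^-1` A) = m A) -> phi B z = char_fun m z.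
Proof.
move=> bB law; have mXB := rm_measurable HX bB.
apply: complex_eqP; rewrite /= /rm_cf/=.
  rewrite (Rintegral_law mXB law (mcosdot z) (fun x => cos_max _)).
  by apply: eq_Rintegral => x _; rewrite /= expR0 mul1r.
rewrite (Rintegral_law mXB law (msindot z) (fun x => sin_max _)).
by apply: eq_Rintegral => x _; rewrite /= expR0 mul1r.
Qed.

Lemma rm_cf_shift (B : set R) (t : R) z : bounded_borel B ->
  bounded_borel [set s + t | s in B] -> phi [set s + t | s in B] z = phi B z.
Proof.
move=> bB bBt; have mXB := rm_measurable HX bB.
pose Y' : {mfun T >-> 'rV[R]_d} := HB.pack (X B) (isMeasurableFun.Build _ _ _ _ _ mXB).
rewrite (@rm_cf_law _ z (distribution P Y'))//; last first.
  by move=> A mA; rewrite (rm_homogeneous HX).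
by rewrite (@rm_cf_law _ z (distribution P Y')).
Qed.

Lemma rm_cf_itv_shift (x y t : R) z :
  phi `]x + t, y + t]%classic z = phi `]x, y]%classic z.
Proof.
have e : [set s + t | s in `]x, y]%classic] = `]x + t, y + t]%classic.
  apply/seteqP; split=> [_ [s /= + <-]|s /=]; rewrite !in_itv/=.
    by rewrite ltrD2r lerD2r.
  move=> /andP[h1 h2]; exists (s - t); last by rewrite subrK.
  by rewrite /= in_itv/= ltrBrDr lerBlDr h1.
rewrite -e rm_cf_shift//; first exact: bounded_borel_itv.
by rewrite e; exact: bounded_borel_itv.
Qed.

Lemma rm_cf_itvD (x y z : R) v : x <= y -> y <= z ->
  phi `]x, z]%classic v = phi `]x, y]%classic v * phi `]y, z]%classic v.
Proof.
move=> xy yz; rewrite -(rm_cfU HX)//; try exact: bounded_borel_itv.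
  congr (rm_cf _ _); apply/seteqP; split=> s /=; rewrite !in_itv/=.
    by move=> /andP[-> ->]; case: (leP s y) => _; [left|right].
  by move=> [/andP[-> sy]|/andP[ys ->]]; rewrite ?(le_trans sy)// (le_lt_trans xy).
apply/seteqP; split => // s /= []; rewrite !in_itv/= => /andP[_ sy] /andP[ys _].
by rewrite ltNge sy in ys.
Qed.

Lemma rm_cf0 z : phi set0 z = 1.
Proof.
rewrite /rm_cf (@cfun_ae _ _ _ _ _ (cst 0))//.
- apply: complex_eqP => /=.
    under eq_Rintegral do rewrite cos0.
    rewrite Rintegral_cst// mul1r; exact: (congr1 fine (probability_setT P)).
  under eq_Rintegral do rewrite sin0.
  by rewrite Rintegral_cst// mul0r.
- by apply: (measurable_dotp_rm HX); exact: bounded_borel0.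
- by apply: filterS (random_measure_set0 HX) => w ->; rewrite dotp0r.
Qed.

Lemma rm_cf_at0 (B : set R) : phi B 0 = 1.
Proof.
apply: complex_eqP => /=; rewrite /rm_cf/=.
  under eq_Rintegral do rewrite dotpC dotp0r cos0.
  rewrite Rintegral_cst// mul1r; exact: (congr1 fine (probability_setT P)).
under eq_Rintegral do rewrite dotpC dotp0r sin0.
by rewrite Rintegral_cst// mul0r.
Qed.

(** Halving the interval takes a square root of the characteristic function. Its
    quotient [u] by [cexp (s C)] is [1] or [-1] and continuous along the ray
    through [z], so that its value at [0] decides the sign. *)
Lemma rm_cf_dyadic (k : nat) z :
  phi `]0, 2^-k]%classic z = cexp (Complex (2^-k) 0 * C z).
Proof.
have [cC C0 CE] := HC; have [cRe cIm] := (continuous_complexP C).1 cC.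
elim: k z => [|k ih] z.
  rewrite expr0 invr1 (_ : Complex 1 0 = 1) ?mul1r// -CE.
  apply: rm_cf_law; first exact: bounded_borel_itv.
  by move=> A mA; rewrite -(rm_law HX 0 mA) add0r.
set s : R := 2^-k.+1.
have s0 : 0 <= s by rewrite /s -exprVn exprn_ge0// invr_ge0.
have ss : s + s = 2^-k.
  by rewrite /s exprS invfM -mulrDl -[in RHS](mul1r (2^-k)); congr (_ * _); field.
pose h t := phi `]0, s]%classic (t *: z).
pose E t := cexp (- (Complex s 0 * C (t *: z))).
have hh t : h t ^+ 2 = cexp (Complex s 0 * C (t *: z)) ^+ 2.
  rewrite -cexpMn mulr2n -mulrDl.
  rewrite (_ : Complex s 0 + Complex s 0 = Complex (2^-k) 0); last first.
    by apply: complex_eqP => /=; rewrite ?addr0.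
  rewrite -ih -ss (@rm_cf_itvD _ s)// ?lerDl// expr2; congr (_ * _).
  by rewrite -[X in `]X, _]%classic](add0r s) rm_cf_itv_shift.
pose u t := h t * E t.
have u2 t : u t ^+ 2 = 1.
  by rewrite exprMn hh -exprMn -cexpD subrr cexp0 expr1n.
have uE t : u t = 1 \/ u t = -1.
  by have /eqP := u2 t; rewrite sqrf_eq1 => /orP[]/eqP; by [left|right].
have u0 : u 0 = 1.
  by rewrite /u /h /E scale0r C0 mulr0 oppr0 cexp0 mulr1 rm_cf_at0.
have [chRe chIm] := cfun_continuous P (measurable_dotp_rm HX z (bounded_borel_itv 0 s)).
have hE t : h t = cfun P (fun w => t * dotp z (X `]0, s]%classic w)).
  by rewrite /h /rm_cf; congr cfun; apply/funext => w; rewrite dotpZl.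
have cz : continuous (fun t : R => t *: z) by exact: scalel_continuous.
have cReC : continuous (fun t : R => complex.Re (C (t *: z))).
  exact: (continuous_compT cz cRe).
have cImC : continuous (fun t : R => complex.Im (C (t *: z))).
  exact: (continuous_compT cz cIm).
have ERe t : complex.Re (u t) = complex.Re (h t) * (expR (- (s * complex.Re (C (t *: z)))) * cos (- (s * complex.Im (C (t *: z)))))
   - complex.Im (h t) * (expR (- (s * complex.Re (C (t *: z)))) * sin (- (s * complex.Im (C (t *: z))))).
  by rewrite /u /E; case: (h t) => a b; case: (C _) => c e /=; rewrite !mul0r subr0 addr0.
have csC (g : R -> R) : continuous g -> continuous (fun t => - (s * g t)).
  by move=> cg t; apply: cvgN; apply: cvgMl_tmp; exact: cg.
have cu : continuous (fun t => complex.Re (u t)).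
  have chRe' : continuous (fun t => complex.Re (h t)) by under eq_fun do rewrite hE.
  have chIm' : continuous (fun t => complex.Im (h t)) by under eq_fun do rewrite hE.
  under eq_fun do rewrite ERe.
  move=> t; apply: cvgB; apply: cvgM.
  - exact: chRe'.
  - apply: cvgM.
      exact: (continuous_compT (csC _ cReC) (@continuous_expR R)).
    exact: (continuous_compT (csC _ cImC) (@continuous_cos R)).
  - exact: chIm'.
  - apply: cvgM.
      exact: (continuous_compT (csC _ cReC) (@continuous_expR R)).
    exact: (continuous_compT (csC _ cImC) (@continuous_sin R)).
have u1 : u 1 = 1.
  have : complex.Re (u 1) = 1.
    apply: (continuous_sqr1_eq1 cu); first by rewrite u0.
    by move=> t; case: (uE t) => -> /=; ring.
  case: (uE 1) => -> //= h11; exfalso; move: h11; lra.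
have : u 1 * cexp (Complex s 0 * C z) = cexp (Complex s 0 * C z) by rewrite u1 mul1r.
by rewrite /u /E -mulrA -cexpD scale1r addNr cexp0 mulr1 /h scale1r.
Qed.

Lemma rm_cf_dyadicM (k m : nat) z :
  phi `]0, m%:R * 2^-k]%classic z = cexp (Complex (m%:R * 2^-k) 0 * C z).
Proof.
have e0 : 0 <= (2^-k : R) by rewrite -exprVn exprn_ge0// invr_ge0.
elim: m => [|m ih].
  rewrite mul0r set_itvoc0 rm_cf0 (_ : Complex 0 0 = 0)// mul0r cexp0//.
rewrite (@rm_cf_itvD _ (m%:R * 2^-k)) ?ih; last 2 first.
- by rewrite mulr_ge0.
- by rewrite ler_wpM2r// ler_nat.
have -> : m.+1%:R * 2^-k = 2^-k + m%:R * 2^-k :> R by rewrite -natr1 mulrDl mul1r addrC.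
have := rm_cf_itv_shift 0 (2^-k) (m%:R * 2^-k) z; rewrite add0r => ->.
have -> : Complex (2^-k + m%:R * 2^-k) 0 = Complex (m%:R * 2^-k) 0 + Complex (2^-k) 0 :> R[i].
  by apply: complex_eqP; rewrite /= ?addr0// addrC.
by rewrite rm_cf_dyadic mulrDl cexpD.
Qed.

End random_measure_dyadic.

Section random_measure_law.
Context {R : realType} {d : nat} {mu : probability 'rV[R]_d R}
  {disp} {T : measurableType disp} {P : probability T R}
  {X : set R -> T -> 'rV[R]_d}.
Hypothesis HX : is_random_measure mu P X.
Context (C : 'rV[R]_d -> R[i]).
Hypothesis HC : is_cumulant mu C.
Local Notation phi := (rm_cf (P := P) (X := X)).
Local Notation leb := (@lebesgue_measure R).

Lemma dyadic_floor_cvg (L : R) : 0 <= L ->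
  (Num.truncn (2 ^+ n * L))%:R * 2^-n @[n --> \oo] --> L.
Proof.
move=> L0; apply/cvgrPdist_lt => e e0.
have h : (2^-1 : R) ^+ n @[n --> \oo] --> 0.
  by apply: cvg_expr; rewrite ger0_norm ?invr_ge0// invf_lt1// ltr1n.
move/cvgrPdist_lt : h => /(_ _ e0); apply: filterS => n.
rewrite sub0r normrN ger0_norm ?exprn_ge0 ?invr_ge0// exprVn => h.
have e2 : 0 < (2 ^+ n : R) by rewrite exprn_gt0.
have /truncn_itv/andP[h1 h2] : 0 <= 2 ^+ n * L by rewrite mulr_ge0// ltW.
have le1 : (Num.truncn (2 ^+ n * L))%:R * 2^-n <= L by rewrite ler_pdivrMr// (mulrC L).
have le2 : L < (Num.truncn (2 ^+ n * L))%:R * 2^-n + 2^-n.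
  by rewrite -[X in _ + X]mul1r -mulrDl natr1 ltr_pdivlMr// (mulrC L).
by rewrite ger0_norm; lra.
Qed.

Lemma dyadic_floor_mono (L : R) n : 0 <= L ->
  (Num.truncn (2 ^+ n * L))%:R * 2^-n <= (Num.truncn (2 ^+ n.+1 * L))%:R * 2^-n.+1 :> R.
Proof.
move=> L0; have e2 : 0 < (2 ^+ n : R) by rewrite exprn_gt0.
have x0 : 0 <= 2 ^+ n * L by rewrite mulr_ge0// ltW.
rewrite exprS invfM mulrA ler_pM2r ?invr_gt0// ler_pdivlMr// -natrM ler_nat.
rewrite truncn_ge_nat ?mulr_ge0// natrM -mulrA mulrC ler_wpM2l//.
by have /truncn_itv/andP[] := x0.
Qed.

(** The interval is the increasing union of the [`]y - s n, y]], where the dyadic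
    numbers [s n] increase to its length. The values on the successive differences
    follow by division, as [cexp] does not vanish. *)
Lemma rm_cf_itv (x y : R) z : x <= y ->
  phi `]x, y]%classic z = cexp (Complex (y - x) 0 * C z).
Proof.
move=> xy; set L := y - x; have L0 : 0 <= L by rewrite subr_ge0.
pose m n := Num.truncn (2 ^+ n * L).
pose s n : R := (m n)%:R * 2^-n.
have s0 n : 0 <= s n by rewrite mulr_ge0// -exprVn exprn_ge0// invr_ge0.
have ss n : s n <= s n.+1 by exact: dyadic_floor_mono.
have sL : s n @[n --> \oo] --> L by exact: dyadic_floor_cvg.
have s_le n : s n <= L.
  have e2 : 0 < (2 ^+ n : R) by rewrite exprn_gt0.
  have /truncn_itv/andP[h1 h2] : 0 <= 2 ^+ n * L by rewrite mulr_ge0// ltW.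
  by rewrite /s ler_pdivrMr// mulrC.
pose G n : set R := `]y - s n, y]%classic.
have ndG : nondecreasing_seq G.
  apply/nondecreasing_seqP => n; apply/subsetPset => t; rewrite /G/= !in_itv/=.
  by move=> /andP[h ->]; rewrite andbT (le_lt_trans _ h)// lerD2l lerN2.
have UG : \bigcup_n G n = `]x, y]%classic.
  apply/seteqP; split => t.
    move=> [n _]; rewrite /G/= !in_itv/= => /andP[h ->]; rewrite andbT.
    by rewrite (le_lt_trans _ h)//; have := s_le n; rewrite /L; lra.
  rewrite /= in_itv/= => /andP[h ty].
  have : \forall n \near \oo, y - t < s n.
    by apply: (cvgr_gt L sL); rewrite /L; lra.
  move=> [N _ /(_ N (leqnn N))] /= hN; exists N => //.
  by rewrite /G/= in_itv/= ty andbT; lra.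
have seqDG n : seqD G n.+1 = `]y - s n.+1, y - s n]%classic.
  rewrite /seqD /G; apply/seteqP; split => t; rewrite /= !in_itv/=.
    by move=> [/andP[-> ty] /negP]; rewrite ty andbT -leNgt.
  move=> /andP[-> h]; split; first by rewrite (le_trans h)// gerBl.
  by apply/negP; rewrite negb_and -leNgt h.
pose a n := if n is n'.+1 then s n'.+1 - s n' else s 0%N.
have suma n : \sum_(i < n.+1) a i = s n.
  by elim: n => [|n ih]; rewrite big_ord_recr/= ?big_ord0 ?add0r// ih addrC subrK.
rewrite -UG -eq_bigcup_seqD; apply: (rm_cf_bigcup HX (a := a)).
- by case=> [|n]; rewrite ?seqDG; exact: bounded_borel_itv.
- exact: trivIset_seqD.
- by rewrite eq_bigcup_seqD UG; exact: bounded_borel_itv.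
- have phiG n : phi (G n) z = cexp (Complex (s n) 0 * C z).
    rewrite /G -(rm_cf_dyadicM HX HC n (m n) z).
    have := rm_cf_itv_shift HX 0 (s n) (y - s n) z.
    by rewrite add0r (addrC (s n)) subrK => ->.
  case=> [|n]; first exact: phiG.
  rewrite seqDG /a.
  have e : Complex (s n.+1) 0 = Complex (s n.+1 - s n) 0 + Complex (s n) 0 :> R[i].
    by apply: complex_eqP; rewrite /= ?addr0// subrK.
  have := phiG n.+1; rewrite e mulrDl cexpD -(phiG n) {1}/G.
  rewrite (rm_cf_itvD HX (y := y - s n)).
  + by move/mulIf; apply; rewrite phiG cexp_neq0.
  + by rewrite lerD2l lerN2.
  + by rewrite gerBl.
- rewrite -cvg_shiftS; apply: cvg_trans sL.
  by apply: near_eq_cvg; near=> n; rewrite /= suma.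
Unshelve. all: by end_near. Qed.

Let lam (B : set R) : R := fine (leb B).

Let leb_fin (B : set R) (N : R) : measurable B -> leb (B `&` `]- N, N]%classic) \is a fin_num.
Proof.
move=> mB; rewrite ge0_fin_numE//; apply: (@le_lt_trans _ _ (leb `]- N, N]%classic)).
  by apply: le_measure; rewrite ?inE//; exact: measurableI.
by rewrite lebesgue_measure_itv/=; case: ifPn => _; rewrite ?ltry// -EFinB ltry.
Qed.

(** Inside a fixed interval [K] that contains [B], the traces of half-lines form a
    pi-system where the formula is known, and it passes to complements in [K] and
    to countable disjoint unions. *)
Lemma rm_cfE (B : set R) z : bounded_borel B ->
  phi B z = cexp (Complex (fine (leb B)) 0 * C z).
Proof.
move=> bB; have [mB [M [Mr BM]]] := bB.
pose N : R := `|M| + 1.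
have N0 : 0 < N by rewrite ltr_wpDl.
pose K : set R := `]- N, N]%classic.
have BK : B `<=` K.
  move=> x Bx; have := BM (`|M| + 2^-1) _ x Bx.
  have h : M < `|M| + 2^-1 by rewrite (le_lt_trans (ler_norm M))// ltrDl invr_gt0.
  move=> /(_ h) /=; rewrite ler_norml /K/= in_itv/= /N => /andP[h1 h2].
  have : (2^-1 : R) < 1 by rewrite invf_lt1// ltr1n.
  by move=> h3; apply/andP; split; lra.
have bK : bounded_borel K by exact: bounded_borel_itv.
have mK : measurable K by case: bK.
have bAK A : measurable A -> bounded_borel (A `&` K).
  by move=> mA; apply: (bounded_borelS _ bK); [exact: measurableI|exact: subIsetr].
pose Q (A : set R) := phi (A `&` K) z = cexp (Complex (lam (A `&` K)) 0 * C z).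
have itvQ x y : phi `]x, y]%classic z = cexp (Complex (lam `]x, y]%classic) 0 * C z).
  have [xy|yx] := leP x y.
    suff -> : lam `]x, y]%classic = y - x by exact: rm_cf_itv.
    rewrite /lam lebesgue_measure_itv/= lte_fin; case: ltP => // yx.
    by have /eqP -> : x == y; rewrite ?subrr// eq_le xy.
  rewrite set_itv_ge; last by rewrite bnd_simp -leNgt ltW.
  by rewrite (rm_cf0 HX) /lam measure0/= (_ : Complex 0 0 = 0)// mul0r cexp0.
suff : Q B by rewrite /Q setIidl.
have lamD (A A' : set R) : measurable A -> measurable A' -> A `&` A' = set0 ->
    lam ((A `|` A') `&` K) = lam (A `&` K) + lam (A' `&` K).
  move=> mA mA' AA'; rewrite /lam setIUl measureU//; last 3 first.
  - exact: measurableI.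
  - exact: measurableI.
  - by rewrite setIACA AA' set0I.
  by rewrite fineD//; exact: leb_fin.
suff H : forall S, <<s @RGenOInfty.G R >> S -> Q S.
  exact: H (eq_ind _ (fun S : set (set R) => S B) mB _ (RGenOInfty.measurableE R)).
apply: (@dynkin_induction _ (measurableTypeR R) (@RGenOInfty.G R) Q).
- exact: RGenOInfty.measurableE.
- move=> _ _ [x ->] [y ->]; exists (Num.max x y); apply/seteqP; split => t /=.
    by rewrite !in_itv/= !andbT gt_max => -[-> ->].
  by rewrite !in_itv/= !andbT gt_max => /andP[].
- by rewrite /Q setTI; exact: itvQ.
- move=> _ [x ->]; rewrite /Q.
  have -> : `]x, +oo[%classic `&` K = `]Num.max x (- N), N]%classic.
    apply/seteqP; split => t; rewrite /K/= !in_itv/= ?andbT gt_max.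
      by move=> [-> /andP[-> ->]].
    by move=> /andP[/andP[-> ->] ->].
  exact: itvQ.
- move=> A mA QA; rewrite /Q.
  have e : phi K z = phi (A `&` K) z * phi (~` A `&` K) z.
    rewrite -(rm_cfU HX); [|exact: bAK|apply: bAK; exact: measurableC|].
      by rewrite -setIUl setUv setTI.
    by rewrite setIACA setICr set0I.
  have eK : lam K = lam (A `&` K) + lam (~` A `&` K).
    rewrite -lamD//; [by rewrite setUv setTI|exact: measurableC|exact: setICr].
  have := itvQ (- N) N; rewrite -/K e eK QA.
  have -> : Complex (lam (A `&` K) + lam (~` A `&` K)) 0 =
    Complex (lam (A `&` K)) 0 + Complex (lam (~` A `&` K)) 0 :> R[i].
    by apply: complex_eqP; rewrite /= ?addr0.
  by rewrite mulrDl cexpD => /mulfI; apply; exact: cexp_neq0.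
- move=> F mF tF QF; rewrite /Q setI_bigcupl.
  have tFK : trivIset setT (fun n => F n `&` K) by exact: trivIset_setIr.
  apply: (rm_cf_bigcup HX (a := fun n => lam (F n `&` K))) => //.
  + by move=> n; apply: bAK; exact: mF.
  + by rewrite -setI_bigcupl; apply: bAK; apply: bigcup_measurable => i _; exact: mF.
  + have mFK n : measurable (F n `&` K) by apply: measurableI => //; exact: mF.
    have mU : measurable (\bigcup_n (F n `&` K)) by exact: bigcup_measurable.
    have fU : leb (\bigcup_n (F n `&` K)) = (lam (\bigcup_n (F n `&` K)))%:E.
      rewrite fineK// -setI_bigcupl; apply: leb_fin.
      by apply: bigcup_measurable => i _; exact: mF.
    have := @measure_semi_sigma_additive _ _ _ leb (fun n => F n `&` K) mFK tFK mU.
    rewrite [X in _ --> X]fU => H; apply: (@fine_cvg _ _ _ _ (fun n => (\sum_(i < n) lam (F i `&` K))%:E)).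
    apply: cvg_trans H; apply: near_eq_cvg; near=> n.
    rewrite big_mkord -sumEFin; apply: eq_bigr => i _.
    by rewrite fineK//; apply: leb_fin; exact: mF.
Unshelve. all: by end_near. Qed.

End random_measure_law.

(** * Growth of exponents of type A and B *)

Lemma Rintegral_le_dominated {R : realType} {disp} {T : measurableType disp}
  (m : {measure set T -> \bar R}) (g w : T -> R) (k : R) :
  measurable_fun setT g -> measurable_fun setT w -> (forall x, 0 <= w x) ->
  (\int[m]_x (w x)%:E < +oo)%E -> (forall x, `|g x| <= k * w x) ->
  `|\int[m]_x g x| <= k * \int[m]_x w x.
Proof.
move=> mg mw w0 iw gk.
have Iw : m.-integrable setT (EFin \o w).
  apply/integrableP; split; first exact/measurable_EFinP.
  by under eq_integral do rewrite /= ger0_norm//.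
have Ikw : m.-integrable setT (EFin \o (fun x => k * w x)).
  have -> : EFin \o (fun x => k * w x) = (fun x => k%:E * (EFin \o w) x)%E by [].
  exact: integrableZl.
have Ig : m.-integrable setT (EFin \o g).
  apply: le_integrable Ikw => //; first exact/measurable_EFinP.
  by move=> x _ /=; rewrite lee_fin (le_trans (gk x))// ler_norm.
rewrite -RintegralZl//; apply: (le_trans (le_normr_Rintegral _ Ig)) => //.
apply: le_Rintegral => //.
by have := integrable_abse Ig.
Qed.

Section LK.
Context {R : realType} {d : nat} (nu : {measure set 'rV[R]_d -> \bar R}).
Context (gam : 'rV[R]_d).
Hypothesis levy : levy_measure nu.
Hypothesis AB : (\int[nu]_(x in [set x | (enorm x <= 1)%R]) (enorm x)%:E < +oo)%E.
Local Notation C := (LK_exponent 0 nu gam).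
Local Notation normc := Normc.normc.

(** For a law of type A or B this weight is [nu]-integrable, and it dominates the
    two integrands of the exponent. *)
Let w (x : 'rV[R]_d) : R := Num.min (enorm x) 1.

Let mw : measurable_fun setT w.
Proof. by apply: measurable_minr => //; exact: measurable_enorm. Qed.

Let w0 x : 0 <= w x.
Proof. by rewrite le_min enorm_ge0 ler01. Qed.

Let iw : (\int[nu]_x (w x)%:E < +oo)%E.
Proof.
have [_ l2] := levy.
have me : measurable_fun setT (fun x : 'rV[R]_d => Num.min (enorm x ^+ 2) 1).
  by apply: measurable_minr => //; apply: measurable_funX; exact: measurable_enorm.
have mb : measurable [set x : 'rV[R]_d | enorm x <= 1].
  rewrite (_ : [set x | _] = @enorm R d @^-1` `]-oo, 1]%classic).
    by rewrite -[X in measurable X]setTI; exact: measurable_enorm.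
  by apply/seteqP; split => x; rewrite /= in_itv.
pose e1 : 'rV[R]_d -> \bar R := (fun x => (enorm x)%:E) \_ [set x | enorm x <= 1].
have me1 : measurable_fun setT e1.
  apply: (measurable_restrictT (fun x : 'rV[R]_d => (enorm x)%:E) mb).1.
  apply: measurable_funTS.
  by apply/measurable_EFinP; exact: measurable_enorm.
have e10 x : (0 <= e1 x)%E.
  by rewrite /e1 erestrict_ge0// => y _; rewrite lee_fin enorm_ge0.
have m0 (x : 'rV[R]_d) : 0 <= Num.min (enorm x ^+ 2) 1 by rewrite le_min sqr_ge0 ler01.
apply: (@le_lt_trans _ _ (\int[nu]_x (e1 x + (Num.min (enorm x ^+ 2) 1)%:E))%E).
  apply: ge0_le_integral => //.
  - by move=> x _; rewrite lee_fin.
  - exact/measurable_EFinP.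
  - by apply: emeasurable_funD => //; exact/measurable_EFinP.
  - move=> x _; rewrite /e1 patchE /w; case: ifPn.
      by rewrite inE/= => x1; rewrite -EFinD lee_fin (min_idPl x1) lerDl.
    rewrite notin_setE/= => /negP; rewrite -ltNge => x1.
    rewrite [X in (X + _)%E](_ : _ = 0%E)// add0e lee_fin (min_idPr (ltW x1)).
    by rewrite le_min lexx andbT expr2; nra.
rewrite ge0_integralD//.
- by rewrite -integral_mkcond lte_add_pinfty.
- by move=> x _; rewrite lee_fin.
- exact/measurable_EFinP.
Qed.

Let W := \int[nu]_x w x.

Let LK_ReE z : complex.Re (C z) = \int[nu]_x (cos (dotp z x) - 1).
Proof.
rewrite /LK_exponent /= trmx0 mulmx0 dotp0r mulr0 oppr0 add0r addr0.
by apply: eq_Rintegral => x _; rewrite /= expR0 mul1r ?subr0 ?addr0.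
Qed.

Let LK_ImE z : complex.Im (C z) =
  \int[nu]_x (sin (dotp z x) - dotp z x / (1 + enorm x ^+ 2)) + dotp gam z.
Proof.
rewrite /LK_exponent /= add0r; congr (_ + _).
by apply: eq_Rintegral => x _; rewrite /= expR0 mul1r ?subr0 ?addr0.
Qed.

Lemma LK_exponent_Re_le0 z : complex.Re (C z) <= 0.
Proof.
rewrite LK_ReE /Rintegral; under eq_integral do rewrite -opprB EFinN.
rewrite integral_ge0N; last by move=> x _; rewrite lee_fin one_sub_cos_ge0.
rewrite fineN oppr_le0 fine_ge0// integral_ge0//.
Qed.

(** With [u = <v z, x>], the terms [1 - cos u], [sin u] and the compensator are
    bounded by a multiple of [(|v| + 1) min (|x|, 1)]: use [|u| <= |v| S |x|] for
    small [x] and the bounds on the trigonometric functions for large [x]. *)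
Lemma LK_exponent_growth z : exists2 K, 0 <= K &
  forall v : R, normc (C (v *: z)) <= K * (`|v| + 1).
Proof.
pose S : R := \sum_(i < d) `|z 0 i|.
have S0 : 0 <= S by apply: sumr_ge0.
have W0 : 0 <= W by apply: Rintegral_ge0.
exists (2 * (2 * S + 2) * W + `|dotp gam z|).
  by rewrite addr_ge0// !mulr_ge0// addr_ge0// mulr_ge0.
move=> v; rewrite (le_trans (normc_le_sum _))// LK_ReE LK_ImE.
pose k := 2 * `|v| * S + 2.
have dot_le x : `|dotp (v *: z) x| <= `|v| * S * enorm x.
  by rewrite dotpZl normrM -mulrA ler_wpM2l// dotp_le_enorm.
have mdot : measurable_fun setT (dotp (v *: z)) := measurable_dotp _.
have men := @measurable_enorm R d.
have vS : 0 <= `|v| * S by rewrite mulr_ge0.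
have hRe : `|\int[nu]_x (cos (dotp (v *: z) x) - 1)| <= k * W.
  apply: Rintegral_le_dominated => //.
    by apply: measurable_funB => //; exact: measurable_cos.
  move=> x; rewrite distrC ger0_norm ?one_sub_cos_ge0//.
  have h1 := one_sub_cos_norm (dotp (v *: z) x).
  have h2 := one_sub_cos_le2 (dotp (v *: z) x).
  have h3 := dot_le x; have h4 := enorm_ge0 x.
  by rewrite /w /k; case: (leP (enorm x) 1) => x1; nra.
have hIm : `|\int[nu]_x (sin (dotp (v *: z) x) - dotp (v *: z) x / (1 + enorm x ^+ 2))| <= k * W.
  apply: Rintegral_le_dominated => //.
    apply: measurable_funB; first exact: measurable_sin.
    apply: measurable_funM => //.
    apply: (@measurableT_comp _ _ _ _ _ _ (fun r : R => (1 + r ^+ 2)^-1)) => //.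
    apply: continuous_measurable_fun => r; apply: cvgV.
      by rewrite lt0r_neq0// ltr_pwDl// sqr_ge0.
    by apply: cvgD; [exact: cvg_cst|exact: exprn_continuous].
  move=> x; rewrite (le_trans (ler_normB _ _))//.
  have h1 := norm_sin_le (dotp (v *: z) x).
  have h2 := sin_max (dotp (v *: z) x).
  have h3 := dot_le x; have h4 := enorm_ge0 x.
  have p1 : 1 <= 1 + enorm x ^+ 2 by rewrite lerDl sqr_ge0.
  have p0 : 0 < 1 + enorm x ^+ 2 by rewrite (lt_le_trans _ p1).
  have h5 : `|dotp (v *: z) x / (1 + enorm x ^+ 2)| <= `|v| * S * w x.
    rewrite normrM normfV (gtr0_norm p0) ler_pdivrMr// (le_trans h3)//.
    rewrite -[leRHS]mulrA ler_wpM2l// /w; case: (leP (enorm x) 1) => x1; nra.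
  by move: h5; rewrite /w /k; case: (leP (enorm x) 1) => x1; nra.
have hg : `|dotp gam (v *: z)| = `|v| * `|dotp gam z| by rewrite dotpZr normrM.
rewrite (le_trans (lerD hRe (ler_normD _ _)))// (le_trans (lerD (lexx _) (lerD hIm (lexx _))))//.
rewrite hg /k; have := normr_ge0 v; have := normr_ge0 (dotp gam z).
by move=> g0 v0; nra.
Qed.

End LK.

(** For small [v] continuity at [0] gives the first term. For [|v| >= dd] the
    constant in the linear growth is absorbed, as [|v| + 1 <= (1 + 1 / dd) |v|]. *)
Lemma exponent_bound {R : realType} {d : nat} (C : 'rV[R]_d -> R[i]) z (e K : R) :
  continuous (C : 'rV[R]_d -> R[i]^o) -> C 0 = 0 -> 0 <= K ->
  (forall v : R, Normc.normc (C (v *: z)) <= K * (`|v| + 1)) -> 0 < e ->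
  exists2 K', 0 <= K' &
  forall v : R, Normc.normc (C (v *: z)) <= e * (v != 0)%:R + K' * `|v|.
Proof.
move=> /continuous_complexP[cRe cIm] C0 K0 hK e0.
have cz : continuous (fun t : R => t *: z) by exact: scalel_continuous.
have e2 : 0 < e / 2 by rewrite divr_gt0.
have cRez : continuous (fun t : R => complex.Re (C (t *: z))) := continuous_compT cz cRe.
have := cRez (0 : R); rewrite /continuous_at scale0r C0/=.
move=> /cvgrPdist_lt /(_ _ e2) /nbhs_ballP[d1 /= d10 h1].
have cImz : continuous (fun t : R => complex.Im (C (t *: z))) := continuous_compT cz cIm.
have := cImz (0 : R); rewrite /continuous_at scale0r C0/=.
move=> /cvgrPdist_lt /(_ _ e2) /nbhs_ballP[d2 /= d20 h2].
pose dd := Num.min d1 d2.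
have dd0 : 0 < dd by rewrite lt_min d10.
exists (K * (1 + dd^-1)).
  by rewrite mulr_ge0// addr_ge0// invr_ge0 ltW.
move=> v; have [->|v0] := eqVneq v 0.
  by rewrite scale0r C0 Normc.normc0 normr0 !mulr0 addr0.
rewrite mulr1; have [vd|vd] := ltP `|v| dd.
  have bv D : dd <= D -> ball (0 : R) D v.
    by move=> dD; rewrite /ball/= sub0r normrN (lt_le_trans vd).
  have le1 : dd <= d1 by rewrite ge_min lexx.
  have le2 : dd <= d2 by rewrite ge_min lexx orbT.
  have {}h1 := h1 v (bv _ le1); have {}h2 := h2 v (bv _ le2).
  move: h1 h2; rewrite /= !sub0r !normrN => h1 h2.
  rewrite (le_trans (normc_le_sum _))// -[leLHS]addr0 lerD//.
    by rewrite ltW// [ltRHS]splitr ltrD.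
  by rewrite !mulr_ge0// addr_ge0// invr_ge0 ltW.
rewrite (le_trans (hK v))// -[leLHS]add0r lerD ?(ltW e0)//.
rewrite -mulrA ler_wpM2l// mulrDl mul1r lerD2l.
by rewrite -[leLHS](mulVf (lt0r_neq0 dd0)) ler_wpM2l// invr_ge0 ltW.
Qed.

(** * Difference of two simple integrals *)

Lemma sum_measure_le_integral {R : realType} {disp} {T : measurableType disp}
  (m : {measure set T -> \bar R}) (I : finType) (A : I -> set T) (k : I -> R)
  (u : T -> R) :
  (forall i, measurable (A i)) -> trivIset setT A -> (forall i, 0 <= k i) ->
  measurable_fun setT u -> (forall x, 0 <= u x) -> (forall i x, A i x -> u x = k i) ->
  (\sum_i (k i)%:E * m (A i) <= \int[m]_x (u x)%:E)%E.
Proof.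
move=> mA tA k0 mu u0 uA.
rewrite (eq_bigr (fun i => \int[m]_x ((k i)%:E * (\1_(A i) x)%:E))%E); last first.
  move=> i _; rewrite ge0_integralZl//; [|exact/measurable_EFinP|by rewrite lee_fin].
  by rewrite integral_indic// setIT.
rewrite -ge0_integral_sum//; last 2 first.
- by move=> i; apply: emeasurable_funM => //; exact/measurable_EFinP.
- by move=> i x _; rewrite mule_ge0 ?lee_fin.
apply: ge0_le_integral => //.
- by move=> x _; apply: sume_ge0 => i _; rewrite mule_ge0 ?lee_fin.
- by apply: emeasurable_sum => i; apply: emeasurable_funM => //; exact/measurable_EFinP.
- exact/measurable_EFinP.
move=> x _; have [[i Aix]|nA] := pselect (exists i, A i x).
  rewrite (bigD1 i)//= big1 ?adde0.
    by rewrite indicE mem_set// mule1 lee_fin (uA i).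
  move=> j ji; rewrite indicE memNset ?mule0// => Ajx.
  have ij : j = i by apply: tA => //; exists x.
  by rewrite ij eqxx in ji.
rewrite big1 ?lee_fin// => i _; rewrite indicE memNset ?mule0// => Aix.
by apply: nA; exists i.
Qed.

Lemma integral_one_sub_cosE {R : realType} {disp} {T : measurableType disp}
  (P : probability T R) (Y : T -> R) : measurable_fun setT Y ->
  (\int[P]_x (1 - cos (Y x))%:E = (1 - complex.Re (cfun P Y))%:E)%E.
Proof.
move=> mY.
have mc : measurable_fun setT (fun x => cos (Y x)) by exact: measurable_cos.
have ic : P.-integrable setT (EFin \o (fun x => cos (Y x))).
  by apply: (@integrable_bounded _ _ _ _ _ 1) => // x; exact: cos_max.
have i1 : P.-integrable setT (EFin \o (fun=> 1 : R)).
  by apply: (@integrable_bounded _ _ _ _ _ 1) => // x; rewrite normr1.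
have i2 : P.-integrable setT (EFin \o (fun x => 1 - cos (Y x))).
  apply: (@integrable_bounded _ _ _ _ _ 2); first exact: measurable_funB.
  by move=> x; rewrite ger0_norm ?one_sub_cos_ge0// one_sub_cos_le2.
rewrite -[LHS]fineK; last exact: integrable_fin_num i2.
congr EFin; rewrite -/(Rintegral _ _ _) RintegralB//; congr (_ - _).
by rewrite Rintegral_cst// mul1r; exact: (congr1 fine (probability_setT P)).
Qed.

Section simple_integrals.
Context {R : realType} {d : nat} {mu : probability 'rV[R]_d R}
  {disp} {T : measurableType disp} {P : probability T R}
  {X : set R -> T -> 'rV[R]_d}.
Hypothesis HX : is_random_measure mu P X.
Context (C : 'rV[R]_d -> R[i]).
Hypothesis HC : is_cumulant mu C.
Local Notation leb := (@lebesgue_measure R).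
Local Notation normc := Normc.normc.

Lemma random_measure_bigU (J : choiceType) (s : seq J) (A : J -> set R) : uniq s ->
  (forall j, bounded_borel (A j)) -> trivIset setT A ->
  bounded_borel (\big[setU/set0]_(j <- s) A j) /\
  {ae P, forall w, X (\big[setU/set0]_(j <- s) A j) w = \sum_(j <- s) X (A j) w}.
Proof.
move=> us bA tA; elim: s us => [_|j s ih /= /andP[js us]].
  rewrite big_nil; split; first exact: bounded_borel0.
  by apply: filterS (random_measure_set0 HX) => w ->; rewrite big_nil.
have [bs hs] := ih us; rewrite big_cons; split; first exact: bounded_borelU.
have dis : A j `&` \big[setU/set0]_(i <- s) A i = set0.
  apply/seteqP; split => // x [Ajx]; rewrite -bigcup_seq => -[i /= si Aix].
  have ij : i = j by apply: tA => //; exists x.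
  by rewrite -ij si in js.
have hU := random_measureU HX (bA j) bs dis.
near=> w; rewrite big_cons; transitivity (X (A j) w + X (\big[setU/set0]_(i <- s) A i) w).
  by near: w.
by congr (_ + _); near: w.
Unshelve. all: by end_near. Qed.

Context {I J : finType} (B : set R) (E : I -> set R) (F : J -> set R)
  (r : I -> R) (s : J -> R).
Hypothesis bB : bounded_borel B.
Hypothesis mE : forall i, measurable (E i).
Hypothesis mF : forall j, measurable (F j).
Hypothesis tE : trivIset setT E.
Hypothesis tF : trivIset setT F.
Hypothesis BE : forall x, B x -> exists i, E i x.
Hypothesis BF : forall x, B x -> exists j, F j x.

Let A (p : I * J) : set R := B `&` (E p.1 `&` F p.2).

Let D w : 'rV[R]_d := \sum_i r i *: X (B `&` E i) w - \sum_j s j *: X (B `&` F j) w.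

Let mB : measurable B. Proof. by case: bB. Qed.

Let bA p : bounded_borel (A p).
Proof.
apply: (bounded_borelS _ bB); last exact: subIsetl.
by do 2 apply: measurableI => //.
Qed.

Let tA : trivIset setT A.
Proof.
move=> [i j] [i' j'] _ _ [x [[_ [/= Ei Fj]] [_ [/= Ei' Fj']]]].
have -> : i = i' by apply: tE => //; exists x.
by have -> : j = j' by apply: tF => //; exists x.
Qed.

Let splitE i : {ae P, forall w, X (B `&` E i) w = \sum_j X (A (i, j)) w}.
Proof.
have ti : trivIset setT (fun j => A (i, j)).
  by move=> j j' _ _ h; have [] : (i, j) = (i, j') by exact: tA.
have [_] := random_measure_bigU (index_enum_uniq J) (fun j => bA (i, j)) ti.
suff -> : \big[setU/set0]_(j <- index_enum J) A (i, j) = B `&` E i by [].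
rewrite -bigcup_seq; apply/seteqP; split=> [x [j _ [Bx [Ex _]]]//|x [Bx Ex]].
by have [j Fj] := BF Bx; exists j; rewrite /= ?mem_index_enum.
Qed.

Let splitF j : {ae P, forall w, X (B `&` F j) w = \sum_i X (A (i, j)) w}.
Proof.
have ti : trivIset setT (fun i => A (i, j)).
  by move=> i i' _ _ h; have [] : (i, j) = (i', j) by exact: tA.
have [_] := random_measure_bigU (index_enum_uniq I) (fun i => bA (i, j)) ti.
suff -> : \big[setU/set0]_(i <- index_enum I) A (i, j) = B `&` F j by [].
rewrite -bigcup_seq; apply/seteqP; split=> [x [i _ [Bx [_ Fx]]]//|x [Bx Fx]].
by have [i Ei] := BE Bx; exists i; rewrite /= ?mem_index_enum.
Qed.

Lemma ae_all (K : finType) (Q : K -> T -> Prop) :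
  (forall k, {ae P, forall w, Q k w}) -> {ae P, forall w, forall k, Q k w}.
Proof.
move=> h; have : {ae P, forall w, forall k, k \in index_enum K -> Q k w}.
  elim: (index_enum K) => [|k l ih]; first by apply: aeW.
  near=> w => k'; rewrite inE => /orP[/eqP ->|]; first by near: w; exact: h.
  by move: k'; near: w.
by apply: filterS => w hw k; apply: hw; rewrite mem_index_enum.
Unshelve. all: by end_near. Qed.

Let measurable_D z : measurable_fun setT (fun w => dotp z (D w)).
Proof.
have -> : (fun w => dotp z (D w)) = (fun w => \sum_i r i * dotp z (X (B `&` E i) w)
    - \sum_j s j * dotp z (X (B `&` F j) w)).
  apply/funext => w; rewrite /D dotpDr dotpNr !dotp_sumr.
  by congr (_ - _); apply: eq_bigr => k _; rewrite dotpZr.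
apply: measurable_funB; apply: measurable_sum => k; apply: measurable_funM => //;
  apply: (measurable_dotp_rm HX); apply: (bounded_borelS _ bB); try exact: subIsetl;
  exact: measurableI.
Qed.

(** On the common refinement [A] of the two partitions the difference is a linear
    combination of independent values of [X]. *)
Lemma cfun_simple_diff z : cfun P (fun w => dotp z (D w)) =
  cexp (\sum_p Complex (fine (leb (A p))) 0 * C ((r p.1 - s p.2) *: z)).
Proof.
have -> : cfun P (fun w => dotp z (D w)) =
    cfun P (fun w => \sum_p dotp ((r p.1 - s p.2) *: z) (X (A p) w)).
  apply: cfun_ae => //.
    by apply: measurable_sum => p; exact: (measurable_dotp_rm HX).
  have hE := ae_all splitE; have hF := ae_all splitF.
  near=> w.
  have wE : forall i, X (B `&` E i) w = \sum_j X (A (i, j)) w by near: w.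
  have wF : forall j, X (B `&` F j) w = \sum_i X (A (i, j)) w by near: w.
  rewrite /D dotpDr dotpNr !dotp_sumr.
  under eq_bigr do rewrite dotpZr wE dotp_sumr mulr_sumr.
  under [X in _ - X]eq_bigr do rewrite dotpZr wF dotp_sumr mulr_sumr.
  rewrite [X in _ - X]exchange_big/= -sumrB.
  transitivity (\sum_i \sum_j dotp ((r i - s j) *: z) (X (A (i, j)) w)).
    apply: eq_bigr => i _; rewrite -sumrB; apply: eq_bigr => j _.
    by rewrite dotpZl -mulrBl.
  by rewrite pair_bigA/=; apply: eq_bigr => -[].
rewrite (rm_cf_family HX _ bA tA) cexp_sum; apply: eq_bigr => p _.
exact: (rm_cfE HX HC).
Unshelve. all: by end_near. Qed.

Hypothesis Cle0 : forall z, complex.Re (C z) <= 0.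

Lemma normc_cfun_simple_diff z :
  normc (1 - cfun P (fun w => dotp z (D w))) <=
  \sum_p fine (leb (A p)) * normc (C ((r p.1 - s p.2) *: z)).
Proof.
rewrite cfun_simple_diff (le_trans (normc_one_sub_cexp _))//.
  rewrite raddf_sum; apply: sumr_le0 => p _.
  by rewrite [leLHS]ReZ mulr_ge0_le0// fine_ge0.
rewrite (le_trans (normc_sum _ _))// ler_sum// => p _.
by rewrite normcZ// fine_ge0.
Qed.

(** With [Y] the difference of the two integrals in the direction [z], the
    averaging inequality applies to [1 - E exp (i t Y)] for [t] in [[0, S]]; there
    the linear term of the bound on the exponent is at most [K S |r - s|]. *)
Lemma prob_simple_diff z (S e K : R) : 0 < S -> 0 <= e -> 0 <= K ->
  (forall v : R, normc (C (v *: z)) <= e * (v != 0)%:R + K * `|v|) ->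
  (P [set w | 2 <= S * `|dotp z (D w)|]%R <=
   (2 * \sum_p fine (leb (A p)) *
      (e * (r p.1 - s p.2 != 0)%:R + K * S * `|r p.1 - s p.2|))%:E)%E.
Proof.
move=> S0 e0 K0 hC.
apply: large_values_mass_le => // t /andP[t0 tS].
rewrite integral_one_sub_cosE; last exact: measurable_funM.
have -> : (fun w => t * dotp z (D w)) = (fun w => dotp (t *: z) (D w)).
  by apply/funext => w; rewrite dotpZl.
rewrite lee_fin; apply: (@le_trans _ _ (normc (1 - cfun P (fun w => dotp (t *: z) (D w))))).
  rewrite (le_trans _ (Re_le_normc _))// (le_trans _ (ler_norm _))//.
rewrite (le_trans (normc_cfun_simple_diff _))// ler_sum// => p _.
rewrite ler_wpM2l ?fine_ge0// scalerA (le_trans (hC _))//.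
rewrite lerD//.
  rewrite ler_wpM2l//; have [->|_] := eqVneq (r p.1 - s p.2) 0.
    by rewrite mul0r eqxx.
  by case: (_ == _).
rewrite normrM (ger0_norm t0) -mulrA ler_wpM2l// mulrC ler_wpM2r//.
Qed.

End simple_integrals.

(** * Approximation by simple functions, fast Cauchy sequences *)

Section fast_cauchy.
Context {R : realType} {disp} {T : measurableType disp} (P : probability T R).
Context (W : nat -> T -> R).
Hypothesis mW : forall n, measurable_fun setT (W n).

Let A n : set T := [set w | 2^-n <= `|W n.+1 w - W n w|].

Let mA n : measurable (A n).
Proof.
rewrite (_ : A n = (fun w => `|W n.+1 w - W n w|) @^-1` `[2^-n, +oo[%classic).
  rewrite -[X in measurable X]setTI.
  by apply: measurableT_comp => //; exact: measurable_funB.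
by apply/seteqP; split => x; rewrite /= in_itv/= andbT.
Qed.

Hypothesis PA : forall n, (P (A n) <= (2^-n)%:E)%E.

Let bad n : set T := \bigcup_k A (n + k)%N.

Let mbad n : measurable (bad n).
Proof. by apply: bigcup_measurable. Qed.

Let geo n m : \sum_(k < m) 2^-(n + k) = 2 * 2^-n * (1 - 2^-m) :> R.
Proof.
elim: m => [|m ih]; first by rewrite big_ord0 expr0 invr1 subrr mulr0.
rewrite big_ord_recr/= ih exprD exprS !invfM.
by set x := 2^-n; set y := 2^-m; field.
Qed.

Let half_ge0 n : 0 <= 2^-n :> R.
Proof. by rewrite -exprVn exprn_ge0// invr_ge0. Qed.

Let Pbad n : (P (bad n) <= (2 * 2^-n)%:E)%E.
Proof.
apply: (@le_trans _ _ (\sum_(k <oo) P (A (n + k)%N))%E).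
  by apply: measure_sigma_subadditive => //; exact: mbad.
apply: lime_le; first by apply: is_cvg_nneseries => k _ _; exact: measure_ge0.
apply: nearW => m; rewrite big_mkord.
apply: (@le_trans _ _ (\sum_(k < m) (2^-(n + k))%:E)%E).
  by apply: lee_sum => k _; exact: PA.
by rewrite sumEFin lee_fin geo -[leRHS]mulr1 ler_wpM2l ?mulr_ge0// gerBl.
Qed.

Let good_bound n w m : ~ bad n w -> `|W (n + m)%N w - W n w| <= 2 * 2^-n.
Proof.
move=> nb; have step k : `|W (n + k).+1 w - W (n + k)%N w| <= 2^-(n + k).
  by rewrite leNgt; apply/negP => h; apply: nb; exists k => //; exact: ltW.
have : `|W (n + m)%N w - W n w| <= \sum_(k < m) 2^-(n + k).
  elim: m => [|m ih]; first by rewrite addn0 subrr normr0 big_ord0.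
  rewrite big_ord_recr/= addnS.
  have -> : W (n + m).+1 w - W n w = (W (n + m)%N w - W n w) + (W (n + m).+1 w - W (n + m)%N w).
    by ring.
  by rewrite (le_trans (ler_normD _ _))// lerD.
by move/le_trans; apply; rewrite geo -[leRHS]mulr1 ler_wpM2l ?mulr_ge0// gerBl.
Qed.

Let bad_mono n m w : (n <= m)%N -> ~ bad n w -> ~ bad m w.
Proof.
move=> nm nb [k _ h]; apply: nb; exists (m - n + k)%N => //.
by rewrite addnA subnKC.
Qed.

Let half_cvg0 : 2 * 2^-n @[n --> \oo] --> (0 : R).
Proof.
rewrite -[X in _ --> X](mulr0 2); apply: cvgMl_tmp.
have -> : (fun n => 2^-n : R) = (fun n => 2^-1 ^+ n) by apply/funext => n; rewrite exprVn.
by apply: cvg_expr; rewrite ger0_norm ?invr_ge0// invf_lt1// ltr1n.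
Qed.

Let good_cvg n w : ~ bad n w ->
  exists2 l, W m w @[m --> \oo] --> l & forall m, (n <= m)%N -> `|W m w - l| <= 2 * 2^-m.
Proof.
move=> nb.
have b m k : (n <= m)%N -> `|W (m + k)%N w - W m w| <= 2 * 2^-m.
  by move=> nm; apply: good_bound; exact: bad_mono nb.
have /cvg_ex[l Wl] : cvg (W m w @[m --> \oo]).
  apply: cauchy_cvg; apply: cauchy_exP => e e0.
  have : \forall m \near \oo, 2 * 2^-m < e.
    by apply: (cvgr_lt (0 : R) half_cvg0).
  move=> [N _ hN]; pose m := maxn n N.
  exists (W m w); exists m => // k /= mk.
  rewrite /ball/= distrC -(subnKC mk).
  by rewrite (le_lt_trans (b _ _ (leq_maxl _ _)))// hN//= leq_maxr.
exists l => // m nm.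
have h : `|W m w - W (k + m)%N w| @[k --> \oo] --> `|W m w - l|.
  apply: cvg_norm; apply: cvgB; first exact: cvg_cst.
  by rewrite (cvg_shiftn m (fun k => W k w)).
rewrite -(cvg_lim _ h)//; apply: limr_le; first by apply/cvg_ex; exists `|W m w - l|.
by apply: nearW => k; rewrite distrC addnC; exact: b.
Qed.

(** Outside [bad n], an event of probability at most [2 * 2^-n], all increments
    from [n] on are dominated by a geometric series. The limit is taken as an upper
    limit, which is measurable everywhere. *)
Lemma fast_cauchy_cvg : exists2 Z : T -> R, measurable_fun setT Z &
  forall e : R, 0 < e -> P [set w | e < `|W n w - Z w|] @[n --> \oo] --> 0%E.
Proof.
pose Z w := fine (limn_esup (fun n => (W n w)%:E)).
have mZ : measurable_fun setT Z.
  apply: (@measurableT_comp _ _ _ _ _ _ (@fine R)) => //.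
  by apply: measurable_fun_limn_esup => n; exact/measurable_EFinP.
have ZE n w : ~ bad n w -> `|W n w - Z w| <= 2 * 2^-n.
  move=> nb; have [l Wl h] := good_cvg nb.
  have -> : Z w = l; last exact: h.
  have Wl' : (W n w)%:E @[n --> \oo] --> l%:E.
    by apply: cvg_EFin => //; exact: nearW.
  rewrite /Z is_cvg_limn_esupE; last by apply/cvg_ex; exists l%:E.
  by rewrite (cvg_lim _ Wl').
exists Z => // e e0.
apply: (@squeeze_cvge _ _ _ _ (fun=> 0%E) _ (fun n => (2 * 2^-n)%:E)).
- have : \forall m \near \oo, 2 * 2^-m < e by apply: (cvgr_lt (0 : R) half_cvg0).
  apply: filterS => n ne; rewrite measure_ge0/=.
  apply: (le_trans _ (Pbad n)); apply: le_measure; rewrite ?inE//.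
    rewrite (_ : [set w | _] = (fun w => `|W n w - Z w|) @^-1` `]e, +oo[%classic).
      rewrite -[X in measurable X]setTI.
      by apply: measurableT_comp => //; exact: measurable_funB.
    by apply/seteqP; split => x; rewrite /= in_itv/= andbT.
  move=> w /= h; apply: contrapT => nb; have := ZE n w nb.
  by rewrite leNgt (lt_trans ne h).
- exact: cvg_cst.
- by apply: cvg_EFin; [exact: nearW|exact: half_cvg0].
Qed.

End fast_cauchy.

Import HBSimple.

Section simple_functions.
Context {R : realType}.
Local Notation leb := (@lebesgue_measure R).

(** Multiplication by the indicator of [{F <> 0}] keeps the approximation and makes
    the approximants vanish where [F] does. The sets where two of them differ then
    have bounded measure. *)
Lemma simple_approx (F : R -> R) : leb.-integrable setT (EFin \o F) ->
  exists G : nat -> R -> R,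
  [/\ forall n, measurable_fun setT (G n), forall n, finite_set (range (G n)),
      forall n s, F s = 0 -> G n s = 0, forall s, G n s @[n --> \oo] --> F s &
      (\int[leb]_s `|F s - G n s|%:E)%E @[n --> \oo] --> 0%E].
Proof.
move=> iF.
have mF : measurable_fun setT F by apply/measurable_EFinP; case/integrableP: iF.
have [g [ig gF gF1]] := approximation_sfun_integrable measurableT iF.
have mg n : measurable_fun setT (g n : R -> R).
  by apply/measurable_EFinP; case/integrableP: (ig n).
pose N : set R := [set s | F s != 0].
have mN : measurable N.
  rewrite (_ : N = F @^-1` [set~ 0]); last by apply/seteqP; split => s /= /eqP.
  by rewrite -[X in measurable X]setTI; apply: mF => //; exact: measurableC.
exists (fun n s => g n s * \1_N s); split.
- by move=> n; exact: measurable_funM.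
- move=> n; apply: (@sub_finite_set _ _ (range (g n) `|` [set 0])).
    move=> _ [s _ <-]; rewrite indicE; case: (s \in N); rewrite ?mulr1 ?mulr0; last by right.
    by left; exists s.
  by rewrite finite_setU; split; [exact: fimfunP|exact: finite_set1].
- by move=> n s Fs; rewrite indicE memNset ?mulr0//= /N/= Fs eqxx.
- move=> s; have [Ns|/negP/negPn/eqP Fs] := pselect (N s).
    rewrite indicE mem_set//; under eq_fun do rewrite mulr1.
    by have := gF s I; move/fine_cvg.
  rewrite Fs indicE memNset; last by rewrite /N/= Fs eqxx.
  by under eq_fun do rewrite mulr0; exact: cvg_cst.
- apply: (@squeeze_cvge _ _ _ _ (fun=> 0%E) _ (fun n => \int[leb]_(s in setT) `|(F s)%:E - (g n s)%:E|)%E) => //; last exact: cvg_cst.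
  apply: nearW => n; rewrite integral_ge0//=; apply: ge0_le_integral => //.
  + apply/measurable_EFinP; apply: measurableT_comp => //; apply: measurable_funB => //.
    by exact: measurable_funM.
  + apply/measurable_EFinP; apply: measurableT_comp => //; exact: measurable_funB.
  + move=> s _; rewrite lee_fin indicE; have [sN|sN] := boolP (s \in N).
      by rewrite mulr1.
    move: sN; rewrite notin_setE => /negP/negPn/eqP ->.
    by rewrite mulr0 subrr normr0.
Qed.

Lemma simple_approx_fast (F : R -> R) (eta : nat -> R) :
  leb.-integrable setT (EFin \o F) -> (forall n, 0 < eta n) ->
  exists G : nat -> R -> R,
  [/\ forall n, measurable_fun setT (G n), forall n, finite_set (range (G n)),
      forall n s, F s = 0 -> G n s = 0, forall s, G n s @[n --> \oo] --> F s &
      forall n, (\int[leb]_s `|F s - G n s|%:E <= (eta n)%:E)%E].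
Proof.
move=> iF eta0; have [G [mG fG G0 GF GF1]] := simple_approx iF.
have /choice[N hN] n : exists N, (n <= N)%N /\ (\int[leb]_s `|F s - G N s|%:E <= (eta n)%:E)%E.
  move/fine_cvgP : GF1 => [[N1 _ h1] /cvgrPdist_lt/(_ _ (eta0 n))[N2 _ h2]].
  pose N := maxn n (maxn N1 N2).
  exists N; split; first exact: leq_maxl.
  have n1 : (N1 <= N)%N by rewrite /N !leq_max leqnn orbT.
  have n2 : (N2 <= N)%N by rewrite /N !leq_max leqnn !orbT.
  rewrite -[leLHS]fineK; last exact: h1.
  have := h2 N n2; rewrite /= sub0r normrN => h; rewrite lee_fin.
  by rewrite (le_trans (ler_norm _))// ltW.
exists (fun n => G (N n)); split => //.
- by move=> n s; exact: G0.
- move=> s; apply: (cvg_comp N (fun n => G n s) _ (GF s)).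
  move=> Q [M _ hM]; exists M => // n /= Mn; apply: hM => /=.
  by rewrite (leq_trans Mn)//; have [] := hN n.
- by move=> n; have [] := hN n.
Qed.

Lemma measurable_ointerval (a b : \bar R) : measurable (ointerval a b).
Proof.
rewrite (_ : ointerval a b = EFin @^-1` `]a, b[%classic).
  rewrite -[X in measurable X]setTI; apply: EFin_measurable => //.
  exact: emeasurable_itv.
by apply/seteqP; split => s; rewrite /= in_itv.
Qed.

Lemma simple_onP (a b : \bar R) (G : R -> R) : measurable_fun setT G ->
  finite_set (range G) -> exists phi : simple_on a b,
  (forall j s, simple_set phi j s -> G s = simple_coef phi j) /\
  (forall s, ointerval a b s -> exists j, simple_set phi j s).
Proof.
move=> mG /finite_seqP[v0 v0E]; pose v := in_tuple (undup v0).
pose E j := ointerval a b `&` G @^-1` [set tnth v j].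
have mE j : measurable (E j).
  apply: measurableI; first exact: measurable_ointerval.
  by rewrite -[X in measurable X]setTI; exact: mG.
have sE j : E j `<=` ointerval a b by exact: subIsetl.
have tE : trivIset setT E.
  move=> i j _ _ [s [[_ /= Gi] [_ /= Gj]]].
  have : tnth v i = tnth v j by rewrite -Gi -Gj.
  by rewrite !(tnth_nth 0) => /eqP; rewrite nth_uniq ?undup_uniq// => /eqP/val_inj.
exists (@SimpleOn R a b _ (tnth v) E mE sE tE); split => [j s [_ ->]//|s abs].
have : G s \in v.
  rewrite mem_undup; have : range G (G s) by exists s.
  by rewrite v0E.
by move=> /tnthP[j Gj]; exists j; split.
Qed.

Lemma simple_valE (a b : \bar R) (phi : simple_on a b) (G : R -> R) s :
  (forall j s, simple_set phi j s -> G s = simple_coef phi j) ->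
  (exists j, simple_set phi j s) -> simple_val phi s = G s.
Proof.
move=> hG [j js]; rewrite /simple_val (bigD1 j)//= big1 ?addr0.
  by rewrite indicE mem_set// mulr1 (hG j).
move=> i ij; rewrite indicE memNset ?mulr0// => Eis.
have e : i = j by apply: (@simple_disjoint _ _ _ phi) => //; exists s.
by rewrite e eqxx in ij.
Qed.

End simple_functions.

(** * Local integrability *)

Lemma bounded_borel_fin {R : realType} (B : set R) : bounded_borel B ->
  @lebesgue_measure R B \is a fin_num.
Proof.
move=> [mB [M [Mr BM]]]; rewrite ge0_fin_numE//.
pose N : R := `|M| + 1.
apply: (@le_lt_trans _ _ (@lebesgue_measure R `[- N, N]%classic)).
  apply: le_measure; rewrite ?inE// => x Bx; rewrite /= in_itv/= -ler_norml.
  by apply: BM => //; rewrite (le_lt_trans (ler_norm M))// ltrDl.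
by rewrite lebesgue_measure_itv/=; case: ifPn => _; rewrite ?ltry// -EFinB ltry.
Qed.

Lemma inner_borel_bounded {R : realType} (a b : \bar R) (B : set R) :
  inner_borel a b B -> bounded_borel B.
Proof.
move=> [mB Bab iB sB]; split => //.
have [[x Bx]|B0] := pselect (B !=set0); last first.
  exists 0; split => // M _ y By; exfalso; apply: B0; by exists y.
have lb y : B y -> (ereal_inf (EFin @` B) <= y%:E)%E.
  by move=> By; apply: ereal_inf_lbound; exists y.
have ub y : B y -> (y%:E <= ereal_sup (EFin @` B))%E.
  by move=> By; apply: ereal_sup_ubound; exists y.
have [l hl] : exists l : R, forall y, B y -> l <= y.
  case: (ereal_inf _) iB lb => [r| |] iB lb.
  - by exists r => y /lb; rewrite lee_fin.
  - by exists 0 => y /lb; rewrite leye_eq.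
  - by rewrite ltNge leNye in iB.
have [u hu] : exists u : R, forall y, B y -> y <= u.
  case: (ereal_sup _) sB ub => [r| |] sB ub.
  - by exists r => y /ub; rewrite lee_fin.
  - by rewrite ltNge leey in sB.
  - by exists 0 => y /ub; rewrite leeNy_eq.
exists (`|l| + `|u|); split; rewrite ?num_real// => M MM y By /=.
have h1 := hl y By; have h2 := hu y By; rewrite (le_trans _ (ltW MM))//.
have := ler_norm u; have := ler_norm (- l).
have := normr_ge0 l; have := normr_ge0 u.
by rewrite !normrN ler_norml => *; apply/andP; split; lra.
Qed.

Section locally_integrable.
Context {R : realType} {d : nat} {mu : probability 'rV[R]_d R}
  {disp} {T : measurableType disp} {P : probability T R}
  {X : set R -> T -> 'rV[R]_d}.
Hypothesis HX : is_random_measure mu P X.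
Context (C : 'rV[R]_d -> R[i]).
Hypothesis HC : is_cumulant mu C.
Hypothesis Cle0 : forall z, complex.Re (C z) <= 0.
Local Notation leb := (@lebesgue_measure R).
Local Notation normc := Normc.normc.

Lemma measurable_simple_integral (a b : \bar R) (phi : simple_on a b) (B : set R) :
  bounded_borel B -> measurable_fun setT (simple_integral X phi B).
Proof.
move=> bB; apply: measurable_rVP => i.
rewrite (_ : (fun w => _) = (fun w => \sum_j simple_coef phi j * X (B `&` simple_set phi j) w 0 i)).
  apply: measurable_sum => j; apply: measurable_funM => //.
  apply: (@measurableT_comp _ _ _ _ _ _ (fun x : 'rV[R]_d => x 0 i)).
    exact: measurable_coord.
  apply: (rm_measurable HX); apply: (bounded_borelS _ bB); last exact: subIsetl.
  by apply: measurableI; [case: bB|exact: simple_measurable].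
by apply/funext => w; rewrite /simple_integral summxE; apply: eq_bigr => j _; rewrite mxE.
Qed.

Lemma cvg_in_probability_coord (W : nat -> T -> 'rV[R]_d) :
  (forall n, measurable_fun setT (W n)) ->
  (forall i, exists2 Z : T -> R, measurable_fun setT Z &
    forall e : R, 0 < e -> P [set w | e < `|W n w 0 i - Z w|] @[n --> \oo] --> 0%E) ->
  cvg_in_probability P W.
Proof.
move=> mW hZ.
have /choice[Z hZ'] : forall i, exists Z : T -> R, measurable_fun setT Z /\
    forall e : R, 0 < e -> P [set w | e < `|W n w 0 i - Z w|] @[n --> \oo] --> 0%E.
  by move=> i; have [Z] := hZ i; exists Z.
have mrow : measurable_fun setT (fun w => \row_i Z i w : 'rV[R]_d).
  by apply: measurable_rVP => i; under eq_fun do rewrite mxE; have [] := hZ' i.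
exists (fun w => \row_i Z i w) => // e e0.
pose e' := e / d.+1%:R.
have e'0 : 0 < e' by rewrite divr_gt0.
have mD n i : measurable [set w | e' < `|W n w 0 i - Z i w|].
  rewrite (_ : [set w | _] = (fun w => `|W n w 0 i - Z i w|) @^-1` `]e', +oo[%classic).
    rewrite -[X in measurable X]setTI.
    apply: measurableT_comp => //; apply: measurable_funB; last by have [] := hZ' i.
    apply: (@measurableT_comp _ _ _ _ _ _ (fun x : 'rV[R]_d => x 0 i)) => //.
    exact: measurable_coord.
  by apply/seteqP; split => x; rewrite /= in_itv/= andbT.
have mE n : measurable [set w | e < enorm (W n w - \row_i Z i w)].
  rewrite (_ : [set w | _] = (fun w => enorm (W n w - \row_i Z i w)) @^-1` `]e, +oo[%classic).
    rewrite -[X in measurable X]setTI.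
    apply: (@measurableT_comp _ _ _ _ _ _ (@enorm R d)) => //; first exact: measurable_enorm.
    apply: measurable_rVP => i; under eq_fun do rewrite !mxE.
    apply: measurable_funB; last by have [] := hZ' i.
    apply: (@measurableT_comp _ _ _ _ _ _ (fun x : 'rV[R]_d => x 0 i)) => //.
    exact: measurable_coord.
  by apply/seteqP; split => x; rewrite /= in_itv/= andbT.
apply: (@squeeze_cvge _ _ _ _ (fun=> 0%E) _
  (fun n => \sum_(i < d) P [set w | (e' < `|W n w 0 i - Z i w|)%R])%E).
- apply: nearW => n; rewrite measure_ge0/=.
  apply: (@le_trans _ _ (P (\big[setU/set0]_(i < d) [set w | e' < `|W n w 0 i - Z i w|]))).
    apply: le_measure; rewrite ?inE//; first exact: bigsetU_measurable.
    move=> w /= h; rewrite -bigcup_seq; apply: contrapT => hn.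
    have small i : `|W n w 0 i - Z i w| <= e'.
      rewrite leNgt; apply/negP => hi; apply: hn; exists i => //=.
      by rewrite mem_index_enum.
    have : enorm (W n w - \row_i Z i w) <= e.
      rewrite (le_trans (enorm_le_sum _))//.
      apply: (@le_trans _ _ (\sum_(i < d) e')).
        by apply: ler_sum => i _; rewrite !mxE.
      rewrite sumr_const card_ord -mulr_natr /e' -mulrA ler_piMr ?(ltW e0)//.
      by rewrite mulrC ler_pdivrMr// mul1r ler_nat.
    by rewrite leNgt h.
  elim: (index_enum _) => [|i s ih]; first by rewrite !big_nil measure0.
  rewrite !big_cons (le_trans (measureU2 _ _ _))//; first exact: bigsetU_measurable.
  by apply: leeD.
- exact: cvg_cst.
- have s0 : 0%E = \sum_(i < d) (0%E : \bar R) by rewrite big1.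
  rewrite [X in _ --> X]s0; apply: (@cvg_nnesum _ _ _ _ _ _ _ (fun=> 0%E)) => i _.
    by apply: nearW => n; exact: measure_ge0.
  by have [_ h] := hZ' i; exact: h.
Qed.

(** The approximating simple functions are chosen so close to [f] in [L^1]
    that successive integrals over any [B] differ by more than [2^-n] with
    probability at most [2^-n]. The tolerance depends on the constants in the
    bound of the exponent, hence on [n], but not on [B]: one sequence serves all
    [B] at once. *)
Lemma locally_integrable (a b : \bar R) (f : R -> R) :
  (forall z (e : R), 0 < e -> exists2 K, 0 <= K &
    forall v : R, normc (C (v *: z)) <= e * (v != 0)%:R + K * `|v|) ->
  measurable_fun (ointerval a b) f ->
  (leb [set s | ((f \_ (ointerval a b)) s : R) != 0%R] < +oo)%E ->
  leb.-integrable setT (EFin \o (f \_ (ointerval a b))) ->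
  locally_integrable_wrt P X a b f.
Proof.
move=> Csmall mf; set F : R -> R := f \_ (ointerval a b); set N := [set s | _] => LN iF.
split => //.
have F_out s : ~ ointerval a b s -> F s = 0.
  by move=> h; rewrite /F patchE memNset.
have mF : measurable_fun setT F by apply/measurable_EFinP; case/integrableP: iF.
have mN : measurable N.
  rewrite (_ : N = F @^-1` [set~ 0]); last by apply/seteqP; split => s /= /eqP.
  by rewrite -[X in measurable X]setTI; apply: mF => //; exact: measurableC.
pose L := fine (leb N).
have LE : leb N = L%:E by rewrite fineK// ge0_fin_numE.
have L0 : 0 <= L by exact: fine_ge0.
have half0 n : 0 < 2^-n :> R by rewrite invr_gt0 exprn_gt0.
(* The first term of the bound on the exponent contributes [eps n * L], at most
   [2^-n / 4]. *)
pose eps n : R := 2^-n / (4 * (L + 1)).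
have eps0 n : 0 < eps n by rewrite divr_gt0// mulr_gt0// ltr_wpDl.
have /choice[K hK] : forall n, exists K : R, 0 <= K /\ forall (i : 'I_d) (v : R),
    normc (C (v *: delta_mx 0 i)) <= eps n * (v != 0)%:R + K * `|v|.
  move=> n; have /choice[Ki hKi] : forall i : 'I_d, exists K : R, 0 <= K /\ forall v : R,
      normc (C (v *: delta_mx 0 i)) <= eps n * (v != 0)%:R + K * `|v|.
    by move=> i; have [K K0 hK] := Csmall (delta_mx 0 i) _ (eps0 n); exists K.
  exists (\sum_i Ki i); split; first by apply: sumr_ge0 => i _; have [] := hKi i.
  move=> i v; have [_ h] := hKi i; rewrite (le_trans (h v))// lerD2l ler_wpM2r//.
  rewrite (bigD1 i)//= lerDl; apply: sumr_ge0 => j _; by have [] := hKi j.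
(* For this [S n] the event [2 <= S n * |y|] is [2^-n <= |y|]. *)
pose S n : R := 2 * 2 ^+ n.
have S0 n : 0 < S n by rewrite mulr_gt0// exprn_gt0.
have K0 n : 0 <= K n by have [] := hK n.
have eps_ge0 n : 0 <= eps n by exact: ltW.
have S_ge0 n : 0 <= S n by exact: ltW.
have KS0 n : 0 <= K n * S n by rewrite mulr_ge0// ltW.
pose del n := 2^-n / (4 * (K n * S n + 1)).
have del0 n : 0 < del n by rewrite divr_gt0// mulr_gt0// ltr_wpDl.
(* Two successive distances to [F] must add up to at most [del n], whence the
   minimum with the tolerance of the previous index. *)
pose eta n := Num.min (del n) (del n.-1) / 2.
have eta0 n : 0 < eta n by rewrite divr_gt0// lt_min !del0.
have [G [mG fG G0 GF GF1]] := simple_approx_fast iF eta0.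
have /choice[phi hphi] : forall n, exists phi : simple_on a b,
  (forall j s, simple_set phi j s -> G n s = simple_coef phi j) /\
  (forall s, ointerval a b s -> exists j, simple_set phi j s).
  by move=> n; exact: simple_onP.
exists phi; split.
  apply: aeW => s abs.
  have -> : (fun n => simple_val (phi n) s) = (fun n => G n s).
    by apply/funext => n; have [h1 h2] := hphi n; rewrite (simple_valE h1)//; exact: h2.
  have := GF s; suff -> : F s = f s by [].
  by rewrite /F patchE mem_set.
move=> B iB; have bB := inner_borel_bounded iB; have [mB Bab _ _] := iB.
have mW n := measurable_simple_integral (phi n) bB.
apply: cvg_in_probability_coord => // i.
apply: fast_cauchy_cvg.
  move=> n; apply: (@measurableT_comp _ _ _ _ _ _ (fun x : 'rV[R]_d => x 0 i)) => //.
  exact: measurable_coord.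
move=> n; have [hn1 hn2] := hphi n; have [hm1 hm2] := hphi n.+1.
have h := prob_simple_diff HX HC (simple_coef (phi n.+1)) (simple_coef (phi n))
   bB (@simple_measurable _ _ _ (phi n.+1)) (@simple_measurable _ _ _ (phi n))
   (@simple_disjoint _ _ _ (phi n.+1)) (@simple_disjoint _ _ _ (phi n))
   (fun x Bx => hm2 x (Bab x Bx)) (fun x Bx => hn2 x (Bab x Bx)) Cle0
   (S0 n) (ltW (eps0 n)) (K0 n) (proj2 (hK n) i).
have -> : [set w | 2^-n <= `|simple_integral X (phi n.+1) B w 0 i - simple_integral X (phi n) B w 0 i|]
  = [set w | 2 <= S n * `|dotp (delta_mx 0 i) (simple_integral X (phi n.+1) B w - simple_integral X (phi n) B w)|].
  apply/seteqP; split => w /=; rewrite dotp_delta !mxE /S -mulrA -[X in X <= _ * _]mulr1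
    ler_pM2l// -ler_pdivrMl ?exprn_gt0// mulr1//.
apply: (le_trans h); set k := (X in _ * X).
suff : (k%:E <= (2^-n / 2)%:E)%E.
  by rewrite !lee_fin; lra.
pose u s := eps n * (G n.+1 s - G n s != 0)%:R + K n * S n * `|G n.+1 s - G n s|.
have u0 s : 0 <= u s.
  by apply: addr_ge0; apply: mulr_ge0.
have mGG : measurable_fun setT (fun s => G n.+1 s - G n s) by exact: measurable_funB.
have mu1 : measurable_fun setT (fun s => (G n.+1 s - G n s != 0)%:R : R).
  rewrite (_ : (fun s => _) = \1_[set s | G n.+1 s - G n s != 0]); last first.
    by apply/funext => s; rewrite indicE; congr (_%:R); rewrite mem_setE.
  apply: measurable_indic.
  rewrite (_ : [set s | _] = (fun s => G n.+1 s - G n s) @^-1` [set~ 0]); last first.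
    by apply/seteqP; split => s /= /eqP.
  by rewrite -[X in measurable X]setTI; apply: mGG => //; exact: measurableC.
have mu' : measurable_fun setT u.
  by apply: measurable_funD; apply: measurable_funM => //; exact: measurableT_comp.
apply: (@le_trans _ _ (\int[leb]_s (u s)%:E)%E).
  pose A (p : 'I_(simple_card (phi n.+1)) * 'I_(simple_card (phi n))) :=
    B `&` (simple_set (phi n.+1) p.1 `&` simple_set (phi n) p.2).
  have mA p : measurable (A p).
    by apply: measurableI => //; apply: measurableI; exact: simple_measurable.
  have tA : trivIset setT A.
    move=> [i1 j1] [i2 j2] _ _ [x [[_ [/= Ei Fj]] [_ [/= Ei' Fj']]]].
    have -> : i1 = i2 by apply: (@simple_disjoint _ _ _ (phi n.+1)) => //; exists x.
    by have -> : j1 = j2 by apply: (@simple_disjoint _ _ _ (phi n)) => //; exists x.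
  pose kk (p : 'I_(simple_card (phi n.+1)) * 'I_(simple_card (phi n))) :=
    eps n * (simple_coef (phi n.+1) p.1 - simple_coef (phi n) p.2 != 0)%:R +
    K n * S n * `|simple_coef (phi n.+1) p.1 - simple_coef (phi n) p.2|.
  have kk0 p : 0 <= kk p by apply: addr_ge0; apply: mulr_ge0.
  have := @sum_measure_le_integral _ _ _ leb _ _ _ _ mA tA kk0 mu' u0.
  move=> h2; apply: le_trans (h2 _); last first.
    by move=> p x [_ [/= e1 e2]]; rewrite /u /kk (hm1 _ _ e1) (hn1 _ _ e2).
  rewrite /k -sumEFin; apply: lee_sum => p _.
  have fA : leb (A p) \is a fin_num.
    exact: (bounded_borel_fin (bounded_borelS (mA p) bB (@subIsetl _ _ _))).
  by rewrite -/(A p) -/(kk p) EFinM (fineK fA) muleC lexx.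
have mFG m : measurable_fun setT (fun s => `|F s - G m s|).
  by apply: measurableT_comp => //; exact: measurable_funB.
have emFG m : measurable_fun setT (fun s => `|F s - G m s|%:E).
  by apply/measurable_EFinP; exact: mFG.
have emFG2 : measurable_fun setT (fun s => `|F s - G n.+1 s|%:E + `|F s - G n s|%:E)%E.
  exact: emeasurable_funD.
have emN : measurable_fun setT (fun s => (\1_N s : R)%:E).
  by apply/measurable_EFinP.
apply: (@le_trans _ _ (\int[leb]_s ((eps n)%:E * (\1_N s)%:E +
   (K n * S n)%:E * (`|F s - G n.+1 s|%:E + `|F s - G n s|%:E)))%E).
  apply: ge0_le_integral => //.
  - by move=> s _; rewrite lee_fin.
  - exact/measurable_EFinP.
  - by apply: emeasurable_funD; apply: emeasurable_funM.
  - move=> s _; rewrite -[leRHS]/((eps n * \1_N s + K n * S n *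
      (`|F s - G n.+1 s| + `|F s - G n s|))%:E) lee_fin /u indicE.
    have [Ns|Ns] := pselect (N s).
      rewrite mem_set// mulr1 lerD//.
        by rewrite ler_piMr ?(ltW (eps0 n))//; case: (_ == _).
      rewrite ler_wpM2l//.
      have -> : G n.+1 s - G n s = (F s - G n s) - (F s - G n.+1 s) by ring.
      by rewrite (le_trans (ler_normB _ _))// addrC.
    have Fs : F s = 0 by move: Ns => /negP/negPn/eqP.
    rewrite !G0// subrr eqxx normr0 !mulr0 addr0 memNset// mulr0 add0r.
    by rewrite !mulr_ge0// addr_ge0.
rewrite ge0_integralD//; last 4 first.
- by move=> s _; rewrite mule_ge0// lee_fin.
- exact: emeasurable_funM.
- by move=> s _; rewrite mule_ge0 ?adde_ge0 ?lee_fin.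
- exact: emeasurable_funM.
rewrite ge0_integralZl//; last by rewrite lee_fin.
rewrite [X in ((eps n)%:E * X + _)%E](_ : _ = L%:E); last first.
  by rewrite integral_indic// setIT; exact: LE.
rewrite ge0_integralZl//;
  [|by move=> s _; rewrite adde_ge0 ?lee_fin|by rewrite lee_fin KS0].
rewrite ge0_integralD//; [|exact: emFG|exact: emFG].
apply: (@le_trans _ _ ((eps n)%:E * L%:E + (K n * S n)%:E * ((eta n.+1)%:E + (eta n)%:E))%E).
  rewrite leeD2l// lee_wpmul2l ?lee_fin//; apply: leeD; exact: GF1.
rewrite -[leLHS]/((eps n * L + K n * S n * (eta n.+1 + eta n))%:E) lee_fin.
have frac (x c : R) : 0 <= x -> 0 <= c -> x * (c / (4 * (x + 1))) <= c / 4.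
  move=> x0 c0; have x1 : 0 < 4 * (x + 1) by rewrite mulr_gt0// ltr_wpDl.
  rewrite mulrA ler_pdivrMr//; nra.
have e1 : eps n * L <= 2^-n / 4 by rewrite mulrC frac// ltW.
have e2 : eta n.+1 + eta n <= del n.
  rewrite /eta [leRHS]splitr lerD// ler_wpM2r ?invr_ge0//=.
    by rewrite ge_min lexx orbT.
  by rewrite ge_min lexx.
have e3 : K n * S n * del n <= 2^-n / 4 by rewrite frac// ltW.
have e4 : K n * S n * (eta n.+1 + eta n) <= 2^-n / 4.
  by apply: le_trans e3; rewrite ler_wpM2l.
by lra.
Qed.

End locally_integrable.

(** * Integrability conditions are sufficient *)

Section sufficiency.
Context {R : realType} {d : nat} (a b : \bar R) (f : R -> R).
Hypothesis mf : measurable_fun (ointerval a b) f.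
Local Notation leb := (@lebesgue_measure R).
Local Notation normc := Normc.normc.
Let F : R -> R := f \_ (ointerval a b).

Let FE s : ointerval a b s -> F s = f s.
Proof. by move=> h; rewrite /F patchE mem_set. Qed.

Let F0 s : ~ ointerval a b s -> F s = 0.
Proof. by move=> h; rewrite /F patchE memNset. Qed.

Let mo : measurable (ointerval a b) := measurable_ointerval a b.

Lemma measurable_restrict_ointerval : measurable_fun setT F.
Proof. exact: (measurable_restrictT f mo).1. Qed.

Lemma integral_ointervalE (g : R -> R) : g 0 = 0 ->
  (\int[leb]_(s in ointerval a b) (g (f s))%:E = \int[leb]_s (g (F s))%:E)%E.
Proof.
move=> g0; rewrite integral_mkcond; apply: eq_integral => s _.
rewrite patchE; case: ifPn => [|]; first by rewrite inE => h; rewrite FE.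
by rewrite notin_setE => h; rewrite F0// g0.
Qed.

Let N : set R := [set s | F s != 0].

Lemma measurable_support_ointerval : measurable N.
Proof.
rewrite (_ : N = F @^-1` [set~ 0]); last by apply/seteqP; split => s /= /eqP.
rewrite -[X in measurable X]setTI; apply: measurable_restrict_ointerval => //.
exact: measurableC.
Qed.

Lemma integral_indic_ointerval :
  (\int[leb]_(s in ointerval a b) (\1_[set s | f s != 0%R] s)%:E = leb N)%E.
Proof.
pose g (x : R) : R := (x != 0)%:R.
transitivity (\int[leb]_(s in ointerval a b) (g (f s))%:E)%E.
  by apply: eq_integral => s _; rewrite indicE /g mem_setE.
rewrite integral_ointervalE ?/g ?eqxx//.
transitivity (\int[leb]_s (\1_N s)%:E)%E.
  by apply: eq_integral => s _; rewrite indicE mem_setE.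
by rewrite integral_indic ?setIT//; exact: measurable_support_ointerval.
Qed.

Lemma measurable_normc_scale (C : 'rV[R]_d -> R[i]) (z : 'rV[R]_d) :
  continuous (C : 'rV[R]_d -> R[i]^o) ->
  measurable_fun setT (fun s => (normc (C (F s *: z)))%:E).
Proof.
move=> cC; have mF := measurable_restrict_ointerval.
have mz : measurable_fun setT (fun s => F s *: z).
  by apply: measurable_rVP => i; under eq_fun do rewrite mxE; exact: measurable_funM.
have [cRe cIm] := (continuous_complexP C).1 cC.
have mRe : measurable_fun setT (fun s => complex.Re (C (F s *: z))).
  apply: (@measurableT_comp _ _ _ _ _ _ (fun x => complex.Re (C x))) => //.
  exact: continuous_measurable_rV.
have mIm : measurable_fun setT (fun s => complex.Im (C (F s *: z))).
  apply: (@measurableT_comp _ _ _ _ _ _ (fun x => complex.Im (C x))) => //.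
  exact: continuous_measurable_rV.
apply/measurable_EFinP; under eq_fun do rewrite normcE.
apply: (@measurableT_comp _ _ _ _ _ _ (@Num.sqrt R)).
  by apply: continuous_measurable_fun; exact: sqrt_continuous.
by apply: measurable_funD; exact: measurable_funX.
Qed.

(** Both parts of the domain condition follow from the bound
    [e 1_(v <> 0) + K |v|] on the exponent, taken at [v = F s]. *)
Lemma ID_AB_sub_D0 :
  (\int[leb]_(s in ointerval a b) (\1_[set s | f s != 0%R] s)%:E < +oo)%E ->
  (\int[leb]_(s in ointerval a b) `|f s|%:E < +oo)%E ->
  @ID_AB R d `<=` D0 a b f.
Proof.
rewrite integral_indic_ointerval (integral_ointervalE (g := Num.norm)) ?normr0// => hN hF.
have mF := measurable_restrict_ointerval; have mN := measurable_support_ointerval.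
have iF : leb.-integrable setT (EFin \o F).
  by apply/integrableP; split; [exact/measurable_EFinP|exact: hF].
move=> mu [IDmu [A [nu [gam [[_ _ levy HC] A0 AB]]]]].
rewrite A0 in HC; set C := LK_exponent 0 nu gam in HC.
have [cC C0 CE] := HC.
have Csmall z (e : R) : 0 < e -> exists2 K, 0 <= K &
    forall v : R, normc (C (v *: z)) <= e * (v != 0)%:R + K * `|v|.
  by move=> e0; have [K K0 hK] := LK_exponent_growth gam levy AB z; exact: exponent_bound hK e0.
split => //.
  move=> disp T P X HX; apply: (locally_integrable HX HC) => //.
  by move=> z; exact: LK_exponent_Re_le0.
exists C => // z.
rewrite (integral_ointervalE (g := fun x => normc (C (x *: z)))); last first.
  by rewrite scale0r C0 Normc.normc0.
have [K K0 hK] := Csmall z 1 ltr01.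
apply: (@le_lt_trans _ _ (\int[leb]_s ((\1_N s)%:E + K%:E * `|F s|%:E))%E).
  apply: ge0_le_integral => //.
  - by move=> s _; rewrite lee_fin normc_ge0.
  - exact: measurable_normc_scale.
  - apply: emeasurable_funD; first exact/measurable_EFinP.
    apply: emeasurable_funM => //; apply/measurable_EFinP; exact: measurableT_comp.
  - move=> s _; rewrite -[leRHS]/((\1_N s + K * `|F s|)%:E) lee_fin.
    by rewrite (le_trans (hK _))// mul1r indicE mem_setE.
have mnF : measurable_fun setT (fun s => `|F s|%:E).
  by apply/measurable_EFinP; exact: measurableT_comp.
rewrite ge0_integralD//; last 3 first.
- exact/measurable_EFinP.
- by move=> s _; rewrite mule_ge0.
- exact: emeasurable_funM.
rewrite ge0_integralZl//.
rewrite integral_indic// setIT lte_add_pinfty//.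
by rewrite lte_mul_pinfty.
Qed.

End sufficiency.

(** * Mixtures of probabilities *)

Section unit_mass.
Context {R : realType} {disp} {T : measurableType disp}.
Variable m : {measure set T -> \bar R}.

(** The proof of unit mass is an argument, so that the probability structure can be
    inferred from the term. *)
Definition unit_mass of m setT = 1%E : set T -> \bar R := m.

Variable m1 : m setT = 1%E.
HB.instance Definition _ := isMeasure.Build _ _ _ (unit_mass m1)
  (measure0 m) (measure_ge0 m) (@measure_semi_sigma_additive _ _ _ m).
HB.instance Definition _ := Measure_isProbability.Build _ _ _ (unit_mass m1) m1.

Definition to_probability : probability T R := unit_mass m1.

End unit_mass.

Section mixture.
Context {R : realType} {disp} {T : measurableType disp}.
Variables (p : nat -> R) (p0 : forall n, 0 <= p n) (m : nat -> {measure set T -> \bar R}).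

Definition mixture : {measure set T -> \bar R} :=
  mseries (fun n => mscale (NngNum (p0 n)) (m n)) 0.

Lemma mixtureE A : mixture A = (\sum_(n <oo) (p n)%:E * m n A)%E.
Proof. by []. Qed.

Lemma ge0_integral_mixture (h : T -> \bar R) :
  measurable_fun setT h -> (forall x, 0 <= h x)%E ->
  (\int[mixture]_x h x = \sum_(n <oo) (p n)%:E * \int[m n]_x h x)%E.
Proof.
move=> mh h0; rewrite ge0_integral_measure_series//.
by apply: eq_eseriesr => n _; rewrite ge0_integral_mscale.
Qed.

End mixture.

Section mixture_probability.
Context {R : realType} {disp} {T : measurableType disp}.
Variables (p : nat -> R) (p0 : forall n, 0 <= p n) (m : nat -> probability T R).
Hypothesis p1 : series p n @[n --> \oo] --> (1 : R).

Let mix := mixture p0 (fun n => m n : {measure set T -> \bar R}).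

Lemma mixture_setT : mix setT = 1%E.
Proof.
rewrite mixtureE; apply: cvg_lim => //.
rewrite (_ : (fun _ => _) = EFin \o series p).
  exact: cvg_EFin (nearW _ _) p1.
apply/funext => n /=; rewrite /series/= -sumEFin; apply: eq_bigr => k _.
rewrite -[RHS]mule1; congr (_ * _)%E; exact: probability_setT.
Qed.

Definition pmixture : probability T R := to_probability mixture_setT.

Lemma ge0_integral_pmixture (h : T -> R) (M : R) :
  measurable_fun setT h -> (forall x, 0 <= h x) -> (forall x, h x <= M) ->
  series (fun n => p n * \int[m n]_x h x) n @[n --> \oo] --> (\int[pmixture]_x h x : R).
Proof.
move=> mh h0 hM.
have ih (P : probability T R) : P.-integrable setT (EFin \o h).
  by apply: integrable_bounded mh _ => x; rewrite ger0_norm.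
have E : (\int[pmixture]_x (h x)%:E = \sum_(n <oo) (p n * \int[m n]_x h x)%:E)%E.
  transitivity (\sum_(n <oo) (p n)%:E * \int[m n]_x (h x)%:E)%E.
    apply: (ge0_integral_mixture p0 (fun n => m n)); first exact/measurable_EFinP.
    by move=> x; rewrite lee_fin.
  apply: eq_eseriesr => n _; rewrite EFinM; congr (_ * _)%E.
  rewrite fineK//; exact: integrable_fin_num (ih _).
have Efin := integrable_fin_num measurableT (ih pmixture).
have := @is_cvg_nneseries R (fun n => (p n * \int[m n]_x h x)%:E) xpredT 0.
move=> /(_ _)/cvg_ex[|l]; first by move=> n _ _; rewrite lee_fin mulr_ge0// Rintegral_ge0.
move=> cl; have /cvg_lim-/(_ (@ereal_hausdorff R)) ll := cl.
have lE : l = (\int[pmixture]_x h x)%:E.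
  by rewrite /Rintegral fineK// E -ll.
rewrite lE in cl; have {}cl := @fine_cvg _ _ _ _ _ _ cl; move: (cl eventually_filter).
apply: cvg_trans; apply: near_eq_cvg; apply: nearW => n /=.
by rewrite sumEFin.
Qed.

(** The nonnegative case is applied to [1 + h]. *)
Lemma integral_pmixture (h : T -> R) :
  measurable_fun setT h -> (forall x, `|h x| <= 1) ->
  series (fun n => p n * \int[m n]_x h x) n @[n --> \oo] --> (\int[pmixture]_x h x : R).
Proof.
move=> mh h1; have ih (P : probability T R) : P.-integrable setT (EFin \o h).
  exact: integrable_bounded mh h1.
have i1 (P : probability T R) : P.-integrable setT (EFin \o cst 1).
  by apply: (@integrable_bounded _ _ _ _ _ 1) => // x; rewrite normr1.
have E (P : probability T R) : \int[P]_x (1 + h x) = 1 + \int[P]_x h x.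
  transitivity ((\int[P]_x (cst 1) x) + \int[P]_x h x); first by rewrite -RintegralD; [|exact: measurableT|exact: i1|exact: ih].
  congr (_ + _).
  by rewrite Rintegral_cst// mul1r; exact: (congr1 fine (probability_setT P)).
have hb x : -1 <= h x <= 1 by rewrite -ler_norml.
have H := @ge0_integral_pmixture (fun x => 1 + h x) 2.
have {}H := H ltac:(by apply: measurable_funD).
have {}H := H ltac:(by move=> x; have := hb x; lra).
have {}H := H ltac:(by move=> x; have := hb x; lra).
rewrite E in H.
have := cvgB H p1 => /(_ eventually_filter); rewrite (addrC 1) addrK.
apply: cvg_trans; apply: near_eq_cvg; apply: nearW => n /=.
transitivity (\sum_(0 <= k < n) p k * \int[m k]_x (1 + h x) - \sum_(0 <= k < n) p k) => //.
rewrite /series/= -sumrB; apply: eq_bigr => k _.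
by rewrite E mulrDr mulr1 addrC addKr.
Qed.

End mixture_probability.

(** * Convolution of probabilities *)

Section convolution.
Context {R : realType} {d : nat}.
Notation V := 'rV[R]_d.
Implicit Types m : probability V R.

Lemma measurable_addrV : measurable_fun setT (fun z : V * V => z.2 + z.1).
Proof.
apply: measurable_rVP => i; under eq_fun do rewrite mxE.
apply: measurable_funD.
  by apply: (@measurableT_comp _ _ _ _ _ _ (fun x : V => x 0 i)) => //; exact: measurable_coord.
by apply: (@measurableT_comp _ _ _ _ _ _ (fun x : V => x 0 i)) => //; exact: measurable_coord.
Qed.

Lemma measurable_addrV_r (y : V) : measurable_fun setT (fun x : V => x + y).
Proof.
apply: measurable_rVP => i; under eq_fun do rewrite mxE.
by apply: measurable_funD => //; exact: measurable_coord.
Qed.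

Lemma product_setT m1 m2 : (m2 \x m1)%E setT = 1%E.
Proof.
rewrite -setXTT product_measure1E// -[RHS]mule1.
congr (_ * _)%E; exact: probability_setT.
Qed.

Definition prodp m1 m2 : probability (V * V)%type R :=
  to_probability (product_setT m1 m2).

Definition addV (z : V * V) : V := z.2 + z.1.
HB.instance Definition _ := isMeasurableFun.Build _ _ _ _ addV measurable_addrV.

(** The law of a sum of independent vectors, built on the product measure so that
    Tonelli and the product rule for characteristic functions apply. *)
Definition convp m1 m2 : probability V R := distribution (prodp m1 m2) addV.

Lemma measurable_translate (y : V) (A : set V) : measurable A ->
  measurable [set x | A (x + y)].
Proof.
by move=> mA; rewrite -[X in measurable X]setTI; exact: measurable_addrV_r.
Qed.

Lemma measurable_integral_addV m (h : V -> \bar R) :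
  measurable_fun setT h -> (forall x, 0 <= h x)%E ->
  measurable_fun setT (fun y : V => \int[m]_x h (x + y)%R)%E.
Proof.
move=> mh h0.
apply: (@measurable_fun_fubini_tonelli_F _ _ _ _ _ m (fun z : V * V => h (z.2 + z.1)%R)) => //.
by apply: (@measurableT_comp _ _ _ _ _ _ h) => //; exact: measurable_addrV.
Qed.

Lemma ge0_integral_convp m1 m2 (h : V -> \bar R) :
  measurable_fun setT h -> (forall x, 0 <= h x)%E ->
  (\int[convp m1 m2]_x h x = \int[m2]_y \int[m1]_x h (x + y)%R)%E.
Proof.
move=> mh h0; rewrite ge0_integral_distribution//.
rewrite (fubini_tonelli1 (h \o addV))//.
  exact: measurableT_comp.
by move=> w; exact: h0.
Qed.

Lemma measurable_mass_translate m (A : set V) : measurable A ->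
  measurable_fun setT (fun y : V => m [set x | A (x + y)]).
Proof.
move=> mA; rewrite (_ : (fun _ => _) = fun y => \int[m]_x (\1_A (x + y)%R)%:E)%E.
  apply: (@measurable_integral_addV m (fun x => (\1_A x)%:E)); last by move=> x; rewrite lee_fin.
  by apply/measurable_EFinP; exact: measurable_indic.
apply/funext => y; have mAy := measurable_translate y mA.
rewrite -[X in m X]setIT -integral_indic//.
Qed.

Lemma char_funE m z : char_fun m z = cfun m (dotp z).
Proof.
by apply: complex_eqP => /=; apply: eq_Rintegral => x _ /=; rewrite expR0 mul1r.
Qed.

Lemma measurable_fst_snd_addV z :
  measurable_fun setT (fun w : V * V => dotp z w.1) /\
  measurable_fun setT (fun w : V * V => dotp z w.2).
Proof. by split; apply: (@measurableT_comp _ _ _ _ _ _ (dotp z)) => //; exact: measurable_dotp. Qed.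

Lemma prodp_rect m1 m2 A B : measurable A -> measurable B ->
  (prodp m1 m2 (fst @^-1` A `&` snd @^-1` B) = m2 A * m1 B)%E.
Proof.
by move=> mA mB; exact: product_measure1E.
Qed.

Lemma prodp_fst m1 m2 A : measurable A -> prodp m1 m2 (fst @^-1` A) = m2 A.
Proof.
move=> mA; have := prodp_rect m1 m2 mA measurableT.
rewrite preimage_setT setIT => ->; rewrite -[RHS]mule1; congr (_ * _)%E.
exact: probability_setT.
Qed.

Lemma prodp_snd m1 m2 B : measurable B -> prodp m1 m2 (snd @^-1` B) = m1 B.
Proof.
move=> mB; have := prodp_rect m1 m2 measurableT mB.
rewrite preimage_setT setTI => ->; rewrite -[RHS]mul1e; congr (_ * _)%E.
exact: probability_setT.
Qed.

Lemma char_fun_convp m1 m2 z :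
  char_fun (convp m1 m2) z = char_fun m1 z * char_fun m2 z.
Proof.
rewrite !char_funE; set P := prodp m1 m2.
have [md1 md2] := measurable_fst_snd_addV z; have md := measurable_dotp z.
have mc := measurable_cos md; have ms := measurable_sin md.
have E (Y : V * V -> V) m : measurable_fun setT Y ->
    (forall A, measurable A -> P (Y @^-1` A) = m A) ->
    cfun P (fun w => dotp z (Y w)) = cfun m (dotp z).
  move=> mY law; apply: complex_eqP => /=.
    exact: (Rintegral_law mY law mc (fun x => cos_max _)).
  exact: (Rintegral_law mY law ms (fun x => sin_max _)).
rewrite -(E addV)// -(E snd)//; last by move=> B; exact: prodp_snd.
rewrite -(E fst)//; last by move=> B; exact: prodp_fst.
rewrite -cfunD//.
  by congr cfun; apply/funext => w; rewrite dotpDr.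
move=> A B mA mB.
rewrite setIC.
transitivity (P (fst @^-1` (dotp z @^-1` B) `&` snd @^-1` (dotp z @^-1` A))) => //.
have mAz : measurable (dotp z @^-1` A) by rewrite -[X in measurable X]setTI; exact: md.
have mBz : measurable (dotp z @^-1` B) by rewrite -[X in measurable X]setTI; exact: md.
rewrite prodp_rect// muleC; congr (_ * _)%E.
  by rewrite -(prodp_snd m1 m2).
by rewrite -(prodp_fst m1 m2).
Qed.

End convolution.

(** * Compound Poisson laws *)

Section poisson_weights.
Context {R : realType}.
Implicit Types s t : R.

Definition poisson t k : R := expR (- t) * (t ^+ k / k`!%:R).

Lemma poisson_ge0 t : 0 <= t -> forall k, 0 <= poisson t k.
Proof. by move=> t0 k; rewrite mulr_ge0 ?expR_ge0// divr_ge0// exprn_ge0. Qed.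

Lemma poisson_genfun t x :
  series (fun k => poisson t k * x ^+ k) n @[n --> \oo] --> (expR (t * (x - 1)) : R).
Proof.
have := is_cvg_series_exp_coeff (t * x).
rewrite -/(expR (t * x)) => cv.
have cvx : series (exp_coeff (t * x)) n @[n --> \oo] --> (expR (t * x) : R) by exact: cv.
rewrite (_ : t * (x - 1) = - t + t * x); last by rewrite mulrBr mulr1 addrC.
rewrite expRD.
have := cvgM (@cvg_cst _ (expR (- t)) _ _ eventually_filter) cvx.
move=> /(_ eventually_filter).
apply: cvg_trans; apply: near_eq_cvg; apply: nearW => n /=.
transitivity (expR (- t) * \sum_(0 <= k < n) exp_coeff (t * x) k) => //.
rewrite /series/= mulr_sumr; apply: eq_bigr => k _.
by rewrite /poisson /exp_coeff /= exprMn mulrAC !mulrA.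
Qed.

Lemma poisson_sum t : series (poisson t) n @[n --> \oo] --> (1 : R).
Proof.
have := @poisson_genfun t 1; rewrite subrr mulr0 expR0.
by under [X in series X]eq_fun do rewrite expr1n mulr1.
Qed.

Lemma poissonD s t n :
  \sum_(0 <= i < n.+1) poisson t i * poisson s (n - i) = poisson (s + t) n.
Proof.
rewrite /poisson exprDn opprD expRD mulr_suml mulr_sumr big_mkord.
apply: eq_bigr => i _.
have le : (i <= n)%N by rewrite -ltnS.
have f0 k : k`!%:R != 0 :> R by rewrite pnatr_eq0 -lt0n fact_gt0.
have e : n`!%:R = 'C(n, i)%:R * (i`!%:R * (n - i)`!%:R) :> R by rewrite -!natrM bin_fact.
rewrite -[_ *+ 'C(n, i)]mulr_natr e; field.
rewrite !f0/= pnatr_eq0 -lt0n bin_gt0 le//.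
Qed.

End poisson_weights.

Section series_convolution.
Context {R : realType}.
Variables (u v : nat -> R) (c : nat -> \bar R).
Hypotheses (u0 : forall n, 0 <= u n) (v0 : forall n, 0 <= v n).
Hypothesis c0 : forall n, (0 <= c n)%E.
Local Open Scope ereal_scope.

(** Summation along the diagonals [n = j + k]. *)
Lemma nneseries_convolution :
  \sum_(k <oo) (u k)%:E * (\sum_(j <oo) (v j)%:E * c (j + k)%N) =
  \sum_(n <oo) (\sum_(0 <= i < n.+1) u i * v (n - i)%N)%R%:E * c n.
Proof.
pose w k n : \bar R := if (k <= n)%N then (u k * v (n - k)%N)%:E * c n else 0.
have w0 k n : 0 <= w k n.
  by rewrite /w; case: ifP => // _; rewrite mule_ge0// lee_fin mulr_ge0.
transitivity (\sum_(k <oo) \sum_(n <oo) w k n).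
  apply: eq_eseriesr => k _; rewrite -nneseriesZl; last by move=> j _; rewrite mule_ge0 ?lee_fin.
  transitivity (\sum_(j <oo) w k (j + k)%N).
    apply: eq_eseriesr => j _; rewrite /w leq_addl addnK EFinM muleA//.
  rewrite nneseries_addn// eseries_cond eseries_mkcond; apply: eq_eseriesr => n _ /=.
  by rewrite /w; case: (k <= n)%N.
rewrite nneseries_interchange//; apply: eq_eseriesr => n _.
rewrite (nneseries_split 0 n.+1)// add0n [X in _ + X]eseries0 ?adde0; last first.
  by move=> k nk _; rewrite /w leqNgt nk.
rewrite -sumEFin ge0_sume_distrl; last by move=> i _; rewrite lee_fin mulr_ge0.
by apply: eq_big_nat => i /andP[_ le]; rewrite /w -ltnS le.
Qed.

End series_convolution.

Section compound_poisson.
Context {R : realType} {d : nat} (sigma : probability 'rV[R]_d R).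
Notation V := 'rV[R]_d.

Fixpoint powp k : probability V R :=
  if k is k'.+1 then convp (powp k') sigma else \d_(0 : V).

Lemma ge0_integral_powpD j k (h : V -> \bar R) :
  measurable_fun setT h -> (forall x, 0 <= h x)%E ->
  (\int[powp k]_y \int[powp j]_x h (x + y)%R = \int[powp (j + k)]_x h x)%E.
Proof.
elim: k h => [|k IH] h mh h0.
  rewrite integral_dirac//=; last exact: measurable_integral_addV.
  rewrite diracT mul1e addn0; apply: eq_integral => x _; by rewrite addr0.
have mhv (v : V) : measurable_fun setT (fun x : V => h (x + v)%R).
  by apply: (@measurableT_comp _ _ _ _ _ _ h) => //; exact: measurable_addrV_r.
rewrite addnS ge0_integral_convp//; last by move=> y; exact: integral_ge0.
  rewrite ge0_integral_convp//; apply: eq_integral => v _.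
  rewrite -(IH _ (mhv v))//; apply: eq_integral => u _.
  by apply: eq_integral => x _; rewrite addrA.
exact: measurable_integral_addV.
Qed.

(** Convolution powers add, with the convolution written as in [conv]. *)
Lemma conv_powp j k A : measurable A ->
  (\int[powp k]_y powp j [set x | A (x + y)%R] = powp (j + k) A)%E.
Proof.
move=> mA; have mI : measurable_fun setT (fun x : V => (\1_A x : R)%:E).
  by apply/measurable_EFinP; exact: measurable_indic.
have E (m : probability V R) (B : set V) : measurable B -> m B = (\int[m]_x (\1_B x)%:E)%E.
  by move=> mB; rewrite integral_indic// setIT.
rewrite (E _ A)// -ge0_integral_powpD//.
by apply: eq_integral => y _; rewrite E//; exact: measurable_translate.
Qed.

Lemma char_fun_powp k z : char_fun (powp k) z = char_fun sigma z ^+ k.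
Proof.
elim: k => [|k IH]; last by rewrite exprSr -IH -char_fun_convp.
rewrite char_funE expr0; have md := measurable_dotp z.
have mc := measurable_cos md; have ms := measurable_sin md.
apply: complex_eqP; rewrite /= /Rintegral.
  rewrite integral_dirac//=; last exact/measurable_EFinP.
  by rewrite indicT mul1r dotp0r cos0.
rewrite integral_dirac//=; last exact/measurable_EFinP.
by rewrite indicT mul1r dotp0r sin0.
Qed.

Section intensity.
Variables (t : R) (t0 : 0 <= t).

Definition cpoisson : probability V R :=
  pmixture (poisson_ge0 t0) powp (@poisson_sum R t).

End intensity.

Lemma eq_cpoisson s t (s0 : 0 <= s) (t0 : 0 <= t) : s = t ->
  cpoisson s0 = cpoisson t0 :> (set V -> \bar R).
Proof. by move=> st; subst t; rewrite (bool_irrelevance s0 t0). Qed.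

(** The semigroup property: the double mixture is summed along the diagonals, where
    the Poisson weights convolve by the binomial formula. *)
Lemma conv_cpoisson s t (s0 : 0 <= s) (t0 : 0 <= t) (st0 : 0 <= s + t) A :
  measurable A -> Defs.conv (cpoisson s0) (cpoisson t0) A = cpoisson st0 A.
Proof.
move=> mA; pose h y := (\sum_(j <oo) (poisson s j)%:E * powp j [set x : V | A (x + y)%R])%E.
have hj0 j y : (0 <= (poisson s j)%:E * powp j [set x : V | A (x + y)%R])%E.
  by rewrite mule_ge0// lee_fin poisson_ge0.
have mhj j : measurable_fun setT (fun y : V => (poisson s j)%:E * powp j [set x | A (x + y)%R])%E.
  by apply: emeasurable_funM => //; exact: measurable_mass_translate.
have mh : measurable_fun setT h.
  by apply: ge0_emeasurable_sum => // j y _ _; exact: hj0.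
transitivity (\int[cpoisson t0]_y h y)%E => //.
transitivity (\sum_(k <oo) (poisson t k)%:E * \int[powp k]_y h y)%E.
  apply: (ge0_integral_mixture (poisson_ge0 t0) (fun k => powp k)) => //.
  by move=> y; exact: nneseries_ge0.
transitivity (\sum_(k <oo) (poisson t k)%:E * \sum_(j <oo) (poisson s j)%:E * powp (j + k)%N A)%E.
  apply: eq_eseriesr => k _; congr (_ * _)%E.
  rewrite integral_nneseries//; apply: eq_eseriesr => j _.
  rewrite ge0_integralZl//; first by rewrite conv_powp.
  - exact: measurable_mass_translate.
  - by rewrite lee_fin poisson_ge0.
rewrite (@nneseries_convolution _ _ _ (fun n => powp n A))//; try exact: poisson_ge0.
by apply: eq_eseriesr => n _; rewrite poissonD.
Qed.

Lemma conv_pow_cpoisson s (s0 : 0 <= s) n (sn0 : 0 <= s *+ n) A :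
  measurable A -> conv_pow (cpoisson s0) n A = cpoisson sn0 A.
Proof.
elim: n sn0 A => [|n IH] sn0 A mA /=.
  transitivity (\sum_(k <oo) (poisson (s *+ 0) k)%:E * powp k A)%E => //.
  rewrite (nneseries_split 0 1)//; last first.
    by move=> k _; rewrite mule_ge0// lee_fin poisson_ge0.
  rewrite big_nat1 eseries0 ?adde0 ?add0n; last first.
    by move=> k k0 _; rewrite /poisson mulr0n expr0n gtn_eqF// mul0r mulr0 mul0e.
  by rewrite /poisson mulr0n oppr0 expR0 expr0 fact0 divr1 mulr1 mul1e.
have sn0' : 0 <= s *+ n by rewrite mulrn_wge0.
have sn0'' : 0 <= s *+ n + s by rewrite addr_ge0.
transitivity (Defs.conv (cpoisson sn0') (cpoisson s0) A).
  by apply: eq_integral => y _; rewrite IH//; exact: measurable_translate.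
rewrite (conv_cpoisson sn0' s0 sn0'')//.
by rewrite (eq_cpoisson sn0'' sn0)// mulrSr.
Qed.

(** An [n]-th convolution root of the law of intensity [t] is the law of intensity
    [t / n]. *)
Lemma ID_cpoisson t (t0 : 0 <= t) : ID (cpoisson t0).
Proof.
move=> n n0; have s0 : 0 <= t / n%:R by rewrite divr_ge0.
exists (cpoisson s0) => A mA.
have sn0 : 0 <= t / n%:R *+ n by rewrite mulrn_wge0.
rewrite (conv_pow_cpoisson s0 sn0)//.
by rewrite (eq_cpoisson sn0 t0)// -mulr_natr divfK// pnatr_eq0 -lt0n.
Qed.

End compound_poisson.

(** * Symmetric jump laws *)

Section symmetric_jumps.
Context {R : realType} {d : nat} (sigma : probability 'rV[R]_d R).
Notation V := 'rV[R]_d.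
Hypothesis sym : forall h : V -> \bar R, measurable_fun setT h ->
  (forall x, 0 <= h x)%E -> (\int[sigma]_x h (- x)%R = \int[sigma]_x h x)%E.

Definition cos_moment (z : V) : R := \int[sigma]_x cos (dotp z x).

(** The positive part of [h] is the reflection of its negative part, so both have
    the same integral [I]; for [I = +oo] too, [fine (I - I)] is [0]. *)
Lemma integral_odd (h : V -> R) : measurable_fun setT h ->
  (forall x, h (- x) = - h x) -> \int[sigma]_x h x = 0.
Proof.
move=> mh hodd; rewrite /Rintegral integralE.
have mh' : measurable_fun setT (EFin \o h) by exact/measurable_EFinP.
have := sym (measurable_funepos mh') (fun x => funepos_ge0 _ x).
rewrite (_ : (\int[_]_x _)%E = \int[sigma]_x ((EFin \o h)^\- x))%E; last first.
  by apply: eq_integral => x _; rewrite funeposE funenegE /= hodd EFinN.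
move=> ->; case: (\int[_]_x _)%E => [r| |]//=.
by rewrite subrr.
Qed.

Lemma char_fun_symmetric z : char_fun sigma z = Complex (cos_moment z) 0.
Proof.
rewrite char_funE; apply: complex_eqP => //=.
apply: integral_odd; first exact: measurable_sin (measurable_dotp z).
by move=> x; rewrite dotpNr sinN.
Qed.

(** The characteristic function of the [n]-th convolution power is the real number
    [cos_moment z ^+ n], so the mixture is the Poisson generating function. *)
Lemma char_fun_cpoisson_symmetric t (t0 : 0 <= t) z :
  char_fun (cpoisson sigma t0) z = Complex (expR (t * (cos_moment z - 1))) 0.
Proof.
have md := measurable_dotp z; have mc := measurable_cos md; have ms := measurable_sin md.
have pw n : cfun (powp sigma n) (dotp z) = Complex (cos_moment z ^+ n) 0.
  rewrite -char_funE char_fun_powp char_fun_symmetric.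
  elim: n => [|n IH]; rewrite ?expr0// !exprS IH.
  by apply: complex_eqP => /=; rewrite ?mulr0 ?mul0r ?subr0 ?addr0.
rewrite char_funE; apply: complex_eqP => /=.
- have H := @integral_pmixture _ _ _ _ (poisson_ge0 t0) (powp sigma) (@poisson_sum R t) _
    mc (fun x => cos_max _).
  apply: cvg_unique H _ => //.
  have := @poisson_genfun R t (cos_moment z).
  apply: cvg_trans; apply: near_eq_cvg; apply: nearW => n.
  by apply: eq_bigr => k _; have [<-] := pw k.
- have H := @integral_pmixture _ _ _ _ (poisson_ge0 t0) (powp sigma) (@poisson_sum R t) _
    ms (fun x => sin_max _).
  apply: cvg_unique H _ => //.
  apply: cvg_trans (@cvg_cst R 0 _ \oo _); apply: near_eq_cvg; apply: nearW => n.
  by rewrite /series/= big1// => k _; have [_ ->] := pw k; rewrite mulr0.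
Qed.

Lemma LK_exponent_symmetric z : LK_exponent 0 sigma 0 z = Complex (cos_moment z - 1) 0.
Proof.
have md := measurable_dotp z; have mc := measurable_cos md; have ms := measurable_sin md.
rewrite /LK_exponent trmx0 mulmx0 dotp0r mulr0 oppr0.
have -> : dotp 0 z = 0 by rewrite dotpC dotp0r.
apply: complex_eqP => /=; rewrite add0r addr0.
- under eq_Rintegral do rewrite /= expR0 mul1r subr0.
  rewrite RintegralB//; last 2 first.
  + exact: integrable_bounded mc (fun x => cos_max _).
  + by apply: (@integrable_bounded _ _ _ _ _ 1) => // x; rewrite normr1.
  rewrite Rintegral_cst// mul1r; congr (_ - _).
  exact: (congr1 fine (probability_setT sigma)).
- apply: integral_odd; last first.
    move=> x; rewrite !expR0 !mul1r !subr0 dotpNr sinN.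
    have -> : enorm (- x) = enorm x by rewrite /enorm dotpNr dotpC dotpNr opprK.
    by ring.
  under eq_fun do rewrite expR0 mul1r subr0.
  apply: measurable_funB => //; apply: measurable_funM => //.
  apply: (@measurableT_comp _ _ _ _ _ _ (fun x : R => (1 + x ^+ 2)^-1)); last exact: measurable_enorm.
  apply: continuous_measurable_fun => x; apply: cvgV.
    by rewrite gt_eqF// ltr_wpDr// sqr_ge0.
  apply: cvgD; first exact: cvg_cst.
  exact: exprn_continuous.
Qed.

Hypothesis atom0 : sigma [set 0] = 0%E.
Hypothesis cont : continuous cos_moment.

Lemma ID_AB_cpoisson_symmetric t0 : ID_AB (@cpoisson R d sigma 1 t0).
Proof.
have md := @measurable_enorm R d.
split; first exact: ID_cpoisson.
have intb (D : set V) (h : V -> R) : measurable D -> measurable_fun setT h -> (forall x, 0 <= h x) ->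
   (forall x, D x -> h x <= 1) -> (\int[sigma]_(x in D) (h x)%:E < +oo)%E.
  move=> mD mh h0 h1; apply: (@le_lt_trans _ _ (\int[sigma]_(x in D) (cst 1 x)))%E.
    apply: ge0_le_integral => //; try by move=> x Dx; rewrite lee_fin.
    exact/measurable_EFinP/measurable_funTS.
  rewrite integral_cst// mul1e -ge0_fin_numE//; exact: fin_num_measure.
exists 0, sigma, 0; split => //.
- split => //.
  + exact: trmx0.
  + by move=> z; rewrite trmx0 mulmx0 dotp0r.
  + split => //; apply: intb => //.
    * apply: measurable_minr => //; exact: measurable_funX.
    * by move=> x; rewrite le_min sqr_ge0 ler01.
    * by move=> x _; rewrite ge_min lexx orbT.
  + split.
    * apply/continuous_complexP; split.
        under eq_fun do rewrite LK_exponent_symmetric/=.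
        have c1 : continuous (fun r : R => r - 1).
          by move=> r; apply: cvgB; [exact: cvg_id|exact: cvg_cst].
        exact: (continuous_compT cont c1).
      under eq_fun do rewrite LK_exponent_symmetric/=.
      exact: cst_continuous.
    * rewrite LK_exponent_symmetric /cos_moment.
      under eq_Rintegral do rewrite dotpC dotp0r cos0.
      apply: complex_eqP => //=; rewrite Rintegral_cst// mul1r.
      by apply/eqP; rewrite subr_eq0; apply/eqP; exact: (congr1 fine (probability_setT sigma)).
    * move=> z; rewrite char_fun_cpoisson_symmetric LK_exponent_symmetric mul1r.
      by apply: complex_eqP => /=; rewrite ?cos0 ?sin0 ?mulr1 ?mulr0.
- apply: intb => //; last by move=> x; exact: enorm_ge0.
  rewrite (_ : [set x | _] = @enorm R d @^-1` `]-oo, 1]%classic).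
    by rewrite -[X in measurable X]setTI; exact: md.
  by apply/seteqP; split => x /=; rewrite in_itv.
Qed.

(** The modulus of the characteristic function is [exp (Re C)], so the real part is
    the same for all exponents of the law. *)
Lemma cumulant_cpoisson_ge t0 (C : V -> R[i]) z :
  is_cumulant (@cpoisson R d sigma 1 t0) C -> 1 - cos_moment z <= Normc.normc (C z).
Proof.
move=> [_ _ /(_ z)]; rewrite char_fun_cpoisson_symmetric mul1r => E.
have E' : cexp (Complex (cos_moment z - 1) 0) = cexp (C z).
  by rewrite -E; apply: complex_eqP => /=; rewrite ?cos0 ?sin0 ?mulr1 ?mulr0.
have := cexp_inj_Re E' => /= E1.
apply: le_trans (Re_le_normc (C z)); rewrite -E1 -normrN opprB; exact: ler_norm.
Qed.

End symmetric_jumps.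

(** * A jump law with prescribed jumps *)

Lemma continuous_uniform_approx {R : realType} {T : topologicalType} (g : T -> R)
  (S : nat -> T -> R) (u : nat -> R) : (forall n, continuous (S n)) ->
  u n @[n --> \oo] --> (0 : R) -> (forall n t, `|g t - S n t| <= u n) -> continuous g.
Proof.
move=> cS u0 gS t; apply/cvgrPdist_lt => e e0.
have e3 : 0 < e / 3 by lra.
have [N _ /(_ N (leqnn N)) hN] := cvgr_lt (0 : R) u0 _ e3.
have := cS N t => /cvgrPdist_lt/(_ _ e3); apply: filterS => w.
have := gS N t; have := gS N w; move: hN => /=.
rewrite !ler_norml !ltr_norml => ? /andP[? ?] /andP[? ?] /andP[? ?].
by apply/andP; split; lra.
Qed.

Section half_weights.
Context {R : realType}.

Definition halfpow n : R := 2^-1 ^+ n.+1.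

Lemma halfpow_ge0 n : 0 <= halfpow n.
Proof. by rewrite exprn_ge0. Qed.

Lemma series_halfpow n : series halfpow n = 1 - 2^-1 ^+ n.
Proof.
elim: n => [|n IH]; first by rewrite /series/= big_geq// subrr.
rewrite /series/= big_nat_recr//= -[X in X + _]/(series halfpow n) IH /halfpow exprS.
by field.
Qed.

Lemma cvg_half : (2^-1 ^+ n : R) @[n --> \oo] --> (0 : R).
Proof. by apply: cvg_expr; rewrite ger0_norm// invf_lt1// ltr1n. Qed.

Lemma halfpow_sum : series halfpow n @[n --> \oo] --> (1 : R).
Proof.
under eq_fun do rewrite series_halfpow.
have := cvgB (@cvg_cst R (1 : R) _ \oo _) cvg_half; rewrite subr0; exact.
Qed.

End half_weights.

Section coin.
Context {R : realType} {d : nat}.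
Notation V := 'rV[R]_d.

Let half_ge0 : 0 <= 2^-1 :> R. Proof. by []. Qed.

Definition coin_measure (y : V) : {measure set V -> \bar R} :=
  mscale (NngNum half_ge0) (measure_add (dirac y) (dirac (- y))).

Lemma coin_measureE y A : (coin_measure y A = (2^-1)%:E * (\d_y A + \d_(- y)%R A))%E.
Proof. by rewrite -measure_addE. Qed.

Lemma coin_measure_setT y : coin_measure y setT = 1%E.
Proof.
by rewrite coin_measureE !diracT -EFinD -EFinM; congr EFin; field.
Qed.

Definition coin y : probability V R := to_probability (coin_measure_setT y).

Lemma ge0_integral_coin y (h : V -> \bar R) : measurable_fun setT h ->
  (forall x, 0 <= h x)%E ->
  (\int[coin y]_x h x = (2^-1)%:E * (h y + h (- y)%R))%E.
Proof.
move=> mh h0; transitivity (\int[coin_measure y]_x h x)%E => //.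
rewrite ge0_integral_mscale// ge0_integral_measure_add//; congr (_ * _)%E.
by rewrite !integral_dirac// !diracT !mul1e.
Qed.

Lemma coin_atom0 y : y != 0 -> coin y [set 0] = 0%E.
Proof.
move=> y0; transitivity ((2^-1 : R)%:E * (\d_y [set 0%R] + \d_(- y)%R [set 0%R]))%E.
  exact: coin_measureE.
by rewrite !diracE !memNset ?adde0 ?mule0//=; apply/eqP; rewrite ?oppr_eq0.
Qed.

Lemma integral_cos_coin y z : \int[coin y]_x cos (dotp z x) = cos (dotp z y).
Proof.
have mc := measurable_cos (measurable_dotp z).
have ic : (coin y).-integrable setT (EFin \o (fun x => cos (dotp z x))).
  by apply: integrable_bounded mc (fun x => cos_max _).
have i1 : (coin y).-integrable setT (EFin \o (fun=> 1)).
  by apply: (@integrable_bounded _ _ _ _ _ 1) => // x; rewrite normr1.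
have H : \int[coin y]_x (1 - cos (dotp z x)) = 1 - cos (dotp z y).
  rewrite /Rintegral ge0_integral_coin; last 2 first.
  - by apply/measurable_EFinP; exact: measurable_funB.
  - by move=> x; rewrite lee_fin one_sub_cos_ge0.
  by rewrite dotpNr cosN -EFinD -EFinM /=; field.
move: H; rewrite RintegralB; [|exact: measurableT|exact: i1|exact: ic].
rewrite Rintegral_cst// mul1r.
have -> : fine (coin y setT) = 1 by exact: (congr1 fine (probability_setT (coin y))).
by lra.
Qed.

End coin.

Section jump_law.
Context {R : realType} {d : nat} (y : nat -> 'rV[R]_d).
Notation V := 'rV[R]_d.

(** The index [n] has probability [halfpow n], and the jump is then [y n] or
    [- y n] with equal chances; the law is symmetric. *)
Definition jump_law : probability V R :=
  pmixture (@halfpow_ge0 R) (fun n => coin (y n)) (@halfpow_sum R).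

Lemma jump_law_sym (h : V -> \bar R) : measurable_fun setT h ->
  (forall x, 0 <= h x)%E ->
  (\int[jump_law]_x h (- x)%R = \int[jump_law]_x h x)%E.
Proof.
move=> mh h0.
have mh' : measurable_fun setT (fun x : V => h (- x)%R).
  apply: (@measurableT_comp _ _ _ _ _ _ h) => //.
  apply: measurable_rVP => i; under eq_fun do rewrite mxE.
  by apply: (@measurableT_comp _ _ _ _ _ _ (@GRing.opp R)) => //; exact: measurable_coord.
have E (g : V -> \bar R) : measurable_fun setT g -> (forall x, 0 <= g x)%E ->
    (\int[jump_law]_x g x = \sum_(n <oo) (halfpow n)%:E * \int[coin (y n)]_x g x)%E.
  by move=> mg g0; exact: (ge0_integral_mixture (@halfpow_ge0 R) (fun n => coin (y n))).
rewrite !E//; apply: eq_eseriesr => n _.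
by rewrite !ge0_integral_coin// opprK (addeC (h (- y n)%R)).
Qed.

Lemma jump_law_atom0 : (forall n, y n != 0) -> jump_law [set 0] = 0%E.
Proof.
move=> y0; transitivity (\sum_(n <oo) (halfpow n)%:E * coin (y n) [set 0%R])%E => //.
by apply: eseries0 => n _ _; rewrite coin_atom0// mule0.
Qed.

Let c z n : R := halfpow n * cos (dotp z (y n)).

Lemma cvg_cos_moment z : series (c z) n @[n --> \oo] --> (cos_moment jump_law z : R).
Proof.
have := @integral_pmixture _ _ _ _ (@halfpow_ge0 R) (fun n => coin (y n)) (@halfpow_sum R) _
  (measurable_cos (measurable_dotp z)) (fun x => cos_max _).
by under [X in series X]eq_fun do rewrite integral_cos_coin.
Qed.

Lemma cos_moment_tail z N : `|cos_moment jump_law z - series (c z) N| <= 2^-1 ^+ N.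
Proof.
have cv : `|series (c z) n - series (c z) N| @[n --> \oo] --> `|cos_moment jump_law z - series (c z) N|.
  by apply: cvg_norm; apply: cvgB; [exact: cvg_cos_moment|exact: cvg_cst].
rewrite -(cvg_lim _ cv)//; apply: limr_le; first by apply/cvg_ex; eexists; exact: cv.
near=> n; have Nn : (N <= n)%N by near: n; exact: nbhs_infty_ge.
rewrite sub_series_geq//.
apply: le_trans (ler_norm_sum _ _ _) _.
apply: (@le_trans _ _ (\sum_(N <= k < n) (halfpow k : R))).
  apply: ler_sum => k _; rewrite normrM ger0_norm ?halfpow_ge0//.
  by rewrite ler_piMr ?halfpow_ge0// cos_max.
rewrite -sub_series_geq// !series_halfpow.
have : 0 <= 2^-1 ^+ n :> R by rewrite exprn_ge0.
by lra.
Unshelve. all: by end_near. Qed.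

(** The partial sums of the series for [cos_moment] are continuous in [z] and
    converge uniformly. *)
Lemma continuous_cos_moment : continuous (cos_moment jump_law).
Proof.
apply: (@continuous_uniform_approx _ _ _ (fun N z => series (c z) N) _ _ cvg_half).
- move=> N; apply: continuous_sumr => n.
  have cg : continuous (fun r : R => halfpow n * cos r).
    by move=> r; apply: cvgM; [exact: cvg_cst|exact: continuous_cos].
  under eq_fun do rewrite /c dotpC.
  exact: (continuous_compT (@continuous_dotp R d (y n)) cg).
- by move=> N z; exact: cos_moment_tail.
Qed.

Lemma eseries_one_sub_cos z :
  (\sum_(n <oo) (halfpow n * (1 - cos (dotp z (y n))))%:E
   = (1 - cos_moment jump_law z)%:E)%E.
Proof.
apply: cvg_lim => //.
rewrite (_ : (fun _ => _) = EFin \o (fun n => series halfpow n - series (c z) n)).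
  by apply: cvg_EFin (nearW _ _) _ => //; apply: cvgB; [exact: halfpow_sum|exact: cvg_cos_moment].
apply/funext => n /=; rewrite /series/= -sumrB -sumEFin; apply: eq_bigr => k _.
by rewrite mulrBr mulr1.
Qed.

End jump_law.

(** The law is compound Poisson of intensity [1] with jump law [jump_law y]. The
    real part of its exponent is minus a series of nonnegative terms, each of which
    is therefore a lower bound of the modulus. *)
Lemma ID_AB_with_jumps {R : realType} {d : nat} (y : nat -> 'rV[R]_d) :
  (forall n, y n != 0) ->
  exists2 mu : probability 'rV[R]_d R, ID_AB mu &
    forall C, is_cumulant mu C -> forall n z,
      halfpow n * (1 - cos (dotp z (y n))) <= Normc.normc (C z).
Proof.
move=> y0; exists (cpoisson (jump_law y) (ler01 : 0 <= 1 :> R)).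
  apply: ID_AB_cpoisson_symmetric.
  - exact: jump_law_sym.
  - exact: jump_law_atom0.
  - exact: continuous_cos_moment.
move=> C HC n z; apply: (@le_trans _ _ (1 - cos_moment (jump_law y) z)); last first.
  by apply: cumulant_cpoisson_ge HC; exact: jump_law_sym.
have t0 k : 0 <= halfpow k * (1 - cos (dotp z (y k))).
  by rewrite mulr_ge0 ?halfpow_ge0// one_sub_cos_ge0.
rewrite -lee_fin -eseries_one_sub_cos.
apply: le_trans (nneseries_lim_ge n.+1 _); last by move=> k _ _; rewrite lee_fin.
rewrite big_nat_recr//= leeDr// sume_ge0// => k _.
by rewrite lee_fin.
Qed.

(** * Dirac laws *)

Section dirac_law.
Context {R : realType} {d : nat} (gamma : 'rV[R]_d).
Notation V := 'rV[R]_d.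

Let delta (x : V) : probability V R := \d_x.

Lemma conv_pow_dirac (x : V) n A : measurable A ->
  conv_pow (delta x) n A = delta (x *+ n) A.
Proof.
elim: n A => [|n IH] A mA; first by rewrite mulr0n.
rewrite /= /Defs.conv.
transitivity (\int[delta x]_y delta (x *+ n) [set u | A (u + y)%R])%E.
  by apply: eq_integral => y _; rewrite IH//; exact: measurable_translate.
rewrite integral_dirac//; last exact: measurable_mass_translate.
rewrite [X in (X * _)%E]diracT mul1e mulrSr.
by rewrite /delta /= !diracE; congr ((_ : bool)%:R%:E); apply/idP/idP; rewrite !inE.
Qed.

Lemma char_fun_dirac z : char_fun (delta gamma) z = cexp (Complex 0 (dotp z gamma)).
Proof.
have md := measurable_dotp z.
have mc := measurable_cos md; have ms := measurable_sin md.
rewrite char_funE; apply: complex_eqP; rewrite /= /Rintegral expR0 mul1r.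
  by rewrite integral_dirac//= ?indicT ?mul1r//; exact/measurable_EFinP.
by rewrite integral_dirac//= ?indicT ?mul1r//; exact/measurable_EFinP.
Qed.

Lemma LK_exponent_dirac z : LK_exponent 0 mzero gamma z = Complex 0 (dotp z gamma).
Proof.
rewrite /LK_exponent trmx0 mulmx0 dotp0r mulr0 oppr0 (dotpC gamma).
by apply: complex_eqP; rewrite /= /Rintegral integral_measure_zero/= !add0r.
Qed.

Lemma ID_AB_dirac : ID_AB (delta gamma).
Proof.
split.
  move=> n n0; exists (delta (n%:R^-1 *: gamma)) => A mA.
  by rewrite conv_pow_dirac// -scaler_nat scalerA divff ?scale1r// pnatr_eq0 -lt0n.
exists 0, mzero, gamma; split => //; last by rewrite integral_measure_zero.
split; [exact: trmx0|by move=> z; rewrite trmx0 mulmx0 dotp0r| |].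
  by split => //; rewrite integral_measure_zero.
split.
- apply/continuous_complexP; split.
    by under eq_fun do rewrite LK_exponent_dirac/=; exact: cst_continuous.
  under eq_fun do rewrite LK_exponent_dirac/= dotpC.
  exact: continuous_dotp.
- by rewrite LK_exponent_dirac dotpC dotp0r.
- by move=> z; rewrite LK_exponent_dirac char_fun_dirac.
Qed.

(** Along the ray through [z], [Im C] and the linear function [t <z, gamma>] are
    continuous logarithms of the same function that agree at [0]. *)
Lemma cumulant_dirac C z : is_cumulant (delta gamma) C ->
  complex.Im (C z) = dotp z gamma.
Proof.
move=> [cC C0 CE].
pose D (t : R) := complex.Im (C (t *: z)) - t * dotp z gamma.
have E t : cexp (C (t *: z)) = cexp (Complex 0 (t * dotp z gamma)).
  by rewrite -CE char_fun_dirac dotpZl.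
have D1 : D 1 = 0.
  apply: continuous_cos1_eq0.
  - have [_ cIm] := (continuous_complexP C).1 cC.
    have cz : continuous (fun t : R => t *: z) by exact: scalel_continuous.
    have c1 : continuous (fun t : R => complex.Im (C (t *: z))).
      exact: (continuous_compT cz cIm).
    move=> t; apply: cvgB; first exact: c1.
    exact: mulrr_continuous.
  - by rewrite /D scale0r C0 mul0r subr0.
  - move=> t; have ReE : complex.Re (C (t *: z)) = 0 by rewrite (cexp_inj_Re (E t)).
    have := E t; rewrite /cexp ReE /= expR0 !mul1r => -[ce se].
    by rewrite cosB ce se -!expr2 cos2Dsin2.
by move: D1; rewrite /D scale1r mul1r => /eqP; rewrite subr_eq0 => /eqP.
Qed.

End dirac_law.

(** * Integrability conditions are necessary *)

Section necessity.
Context {R : realType}.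
Local Notation leb := (@lebesgue_measure R).
Local Notation normc := Normc.normc.

(** The sets where [|F| >= 2 / (n + 1)] increase to [{F <> 0}], and the averaging
    inequality with [S = n + 1] bounds the measure of each by [2 M]. *)
Lemma support_measure_le (F : R -> R) (M : R) : measurable_fun setT F ->
  (forall x, (\int[leb]_s (1 - cos (x * F s))%R%:E <= M%:E)%E) ->
  (leb [set s | F s != 0%R] <= (2 * M)%:E)%E.
Proof.
move=> mF gM; pose A n : set R := [set s | 2 <= n.+1%:R * `|F s|].
have mA n : measurable (A n).
  rewrite (_ : A n = (fun s => n.+1%:R * `|F s|) @^-1` `[2, +oo[%classic).
    rewrite -[X in measurable X]setTI.
    have mG : measurable_fun setT (fun s => n.+1%:R * `|F s|).
      by apply: measurable_funM => //; exact: measurableT_comp.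
    exact: mG.
  by apply/seteqP; split => s; rewrite /A /= in_itv/= andbT.
have NE : [set s | F s != 0] = \bigcup_n A n.
  apply/seteqP; split => [s /= Fs|s [n _]]; last first.
    by apply: contraTneq => ->; rewrite normr0 mulr0; lra.
  have F0 : 0 < `|F s| by rewrite normr_gt0.
  have := archi_boundP (divr_ge0 (ler0n R 2) (ltW F0)); set k := Num.bound _ => hk.
  exists k => //; rewrite /A/= -ler_pdivrMr// (le_trans (ltW hk))// ler_nat//.
have ndA : nondecreasing_seq A.
  move=> m n mn; apply/subsetPset => s; rewrite /A /= => h.
  by rewrite (le_trans h)// ler_wpM2r// ler_nat.
have H := @nondecreasing_cvg_mu _ _ R leb A mA (bigcupT_measurable A mA) ndA.
rewrite NE -(cvg_lim _ H)//; apply: lime_le.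
  by apply/cvg_ex; eexists; exact: H.
apply: nearW => n; exact: large_values_mass_le.
Qed.

Variables (d : nat) (d_gt0 : (0 < d)%N) (a b : \bar R) (f : R -> R).
Hypothesis mf : measurable_fun (ointerval a b) f.
Hypothesis AB : @ID_AB R d `<=` D0 a b f.

Let F : R -> R := f \_ (ointerval a b).
Let mF : measurable_fun setT F := measurable_restrict_ointerval mf.
Let i0 : 'I_d := Ordinal d_gt0.
Let e0 : 'rV[R]_d := delta_mx 0 i0.

Let dotp_e0 : dotp e0 e0 = 1.
Proof. by rewrite dotp_delta mxE !eqxx. Qed.

Lemma cumulant_integral_lty mu z : ID_AB mu ->
  exists C : 'rV[R]_d -> R[i], [/\ is_cumulant mu C,
    measurable_fun setT (fun s => (normc (C (F s *: z)))%:E) &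
    (\int[leb]_s (normc (C (F s *: z)))%:E < +oo)%E].
Proof.
move=> /AB[_ _ [C HC /(_ z)]].
rewrite (@integral_ointervalE _ _ _ _ (fun x => normc (C (x *: z)))); last first.
  by case: HC => _ C0 _; rewrite scale0r C0 Normc.normc0.
move=> Coo; exists C; split => //.
by case: HC => cC _ _; exact: (measurable_normc_scale mf).
Qed.

(** For the Dirac law at the unit vector [e0], [|C (F s e0)|] is at least [|F s|]. *)
Lemma ID_AB_sub_D0_integrable :
  (\int[leb]_(s in ointerval a b) `|f s|%:E < +oo)%E.
Proof.
rewrite (@integral_ointervalE _ _ _ _ Num.norm) ?normr0//.
have [C [HC mC]] := cumulant_integral_lty e0 (ID_AB_dirac e0).
apply: le_lt_trans; apply: ge0_le_integral => //.
  by apply/measurable_EFinP; exact: measurableT_comp.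
move=> s _; rewrite lee_fin (le_trans _ (Im_le_normc _))//.
by rewrite (cumulant_dirac _ HC) dotpZl dotp_e0 mulr1.
Qed.

(** The weights [2^-(n+1)] of the jumps [x n] decrease more slowly than the values
    [g (x n) > 4^n] increase, so the [n]-th jump alone contributes at least
    [2^n / 2] to the integral of [|C|]. *)
Lemma ID_AB_sub_D0_support :
  (\int[leb]_(s in ointerval a b) (\1_[set s | f s != 0%R] s)%:E < +oo)%E.
Proof.
rewrite (integral_indic_ointerval mf) ltNge leye_eq; apply/negP => /eqP Noo.
pose g x := (\int[leb]_s (1 - cos (x * F s))%:E)%E.
have [x xP] : {x : nat -> R & forall n, ((4 ^+ n)%:E < g (x n))%E}.
  apply: (@choice _ _ (fun n x => ((4 ^+ n)%:E < g x)%E)) => n.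
  apply: contrapT => /forallNP h.
  suff : (leb [set s | F s != 0%R] <= (2 * 4 ^+ n)%:E)%E by rewrite Noo.
  by apply: support_measure_le => // x; rewrite leNgt; apply/negP; exact: h.
have x0 n : x n != 0.
  apply/eqP => xn0; have := xP n; rewrite xn0 /g.
  under eq_integral do rewrite mul0r cos0 subrr.
  by rewrite integral0 lte_fin ltNge exprn_ge0.
have y0 n : x n *: e0 != 0.
  rewrite scaler_eq0 negb_or x0/=; apply: contra_eq_neq dotp_e0 => ->.
  by rewrite dotp0r eq_sym oner_eq0.
have [mu ABmu muP] := ID_AB_with_jumps y0.
have [C [HC mC Coo]] := cumulant_integral_lty e0 ABmu.
have C0 : (0 <= \int[leb]_s (normc (C (F s *: e0)))%:E)%E.
  by apply: integral_ge0 => s _; rewrite lee_fin normc_ge0.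
have Cfin : (\int[leb]_s (normc (C (F s *: e0)))%:E)%E \is a fin_num.
  by rewrite ge0_fin_numE.
set I := (\int[leb]_s _)%E in Coo C0 Cfin.
have lower n : (2 ^+ n / 2 <= fine I).
  rewrite -lee_fin fineK//.
  have mcos : measurable_fun setT (fun s => 1 - cos (x n * F s)).
    by apply: measurable_funB => //; apply: measurable_cos; exact: measurable_funM.
  apply: (@le_trans _ _ ((halfpow n)%:E * g (x n))%E).
    apply: (@le_trans _ _ ((halfpow n)%:E * (4 ^+ n)%:E)%E); last first.
      by rewrite lee_pmul2l// ?ltW// lte_fin exprn_gt0.
    rewrite -EFinM lee_fin /halfpow exprS -mulrA -exprMn mulrC.
    by rewrite (_ : 2^-1 * 4 = 2 :> R)//; field.
  rewrite -ge0_integralZl//; last 2 first.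
  - exact/measurable_EFinP.
  - by rewrite lee_fin halfpow_ge0.
  apply: ge0_le_integral => //.
  - by move=> s _; rewrite mule_ge0// lee_fin ?halfpow_ge0 ?one_sub_cos_ge0.
  - by apply: emeasurable_funM => //; exact/measurable_EFinP.
  - move=> s _; rewrite -EFinM lee_fin.
    by have := muP C HC n (F s *: e0); rewrite dotpZl dotpZr dotp_e0 mulr1 [F s * _]mulrC.
have I0 : 0 <= fine I * 2 by rewrite mulr_ge0// fine_ge0.
have := archi_boundP I0; set k := Num.bound _ => hk.
have := lower k; rewrite leNgt ltr_pdivlMr// (lt_le_trans hk)//.
by rewrite -natrX ler_nat ltnW// ltn_expl.
Qed.

End necessity.

Theorem theorem6p5 (R : realType) (d : nat) (d_gt0 : (0 < d)%N)
    (a b : \bar R) (ab : (a < b)%E) (f : R -> R)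
    (mf : measurable_fun (ointerval a b) f) :
  @ID_AB R d `<=` D0 a b f <->
  (\int[@lebesgue_measure R]_(s in ointerval a b)
     (\1_[set s | f s != 0%R] s)%:E < +oo)%E /\
  (\int[@lebesgue_measure R]_(s in ointerval a b) `|f s|%:E < +oo)%E.
Proof.
split=> [AB|[hN hF]]; last exact: ID_AB_sub_D0.
split; [exact: (ID_AB_sub_D0_support d_gt0 mf AB)|exact: (ID_AB_sub_D0_integrable d_gt0 mf AB)].
Qed.
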